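(* Let $d\ge 3$ and consider the annealed Ising model on the random $d$-regular graph. Then the annealed critical exponents are $\boldsymbol{\beta}=\tfrac12$, $\boldsymbol{\delta}=3$, $\boldsymbol{\gamma}=\boldsymbol{\gamma}'=1$, $\boldsymbol{\alpha}=\boldsymbol{\alpha}'=0$. That is: \begin{align*} \mathcal{M}(\beta,0^+) &\asymp (\beta-\beta_c)^{1/2} && \text{for } \beta\searrow\beta_c,\\ \mathcal{M}(\beta_c,B) &\asymp B^{1/3} && \text{for } B\searrow 0,\\ \chi(\beta,0^+) &\asymp (\beta_c-\beta)^{-1} && \text{for } \beta\nearrow\beta_c,\\ \chi(\beta,0^+) &\asymp (\beta-\beta_c)^{-1} && \text{for } \beta\searrow\beta_c,\\ \mathcal{C}(\beta,0^+) &\asymp 1 && \text{for } \beta\nearrow\beta_c,\\ \mathcal{C}(\beta,0^+) &\asymp 1 && \text{for } \beta\searrow\beta_c. \end{align*}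
   Context: Random $d$-regular graph: for $n$ with $dn$ even, take vertices $v_1,\dots,v_n$, each with $d$ incident half-edges, and match the $dn$ half-edges by a uniformly random perfect matching (pairing one arbitrarily selected unmatched half-edge with a uniformly chosen other unmatched half-edge, repeatedly); each matched pair forms an edge. The result is a random multigraph (self-loops and multiple edges allowed). Let $k_{i,j}$ be the number of edges between $v_i$ and $v_j$, and let $\mathbb{E}$ be expectation with respect to the random graph. Annealed Ising model: for $\beta\ge 0$, $B\in\mathbb{R}$ and $\sigma\in\Omega_n=\{+1,-1\}^n$, put $H(\sigma)=-\beta\sum_{i\le j}k_{i,j}\sigma_i\sigma_j-B\sum_{i=1}^n\sigma_i$, $Z_n(\beta,B)=\sum_{\sigma\in\Omega_n}e^{-H(\sigma)}$, and define the annealed measure $\mu_n(\sigma)=\mathbb{E}(e^{-H(\sigma)})/\mathbb{E}(Z_n(\beta,B))$. Thermodynamic quantities: $\psi_n(\beta,B)=\frac1n\log\mathbb{E}(Z_n(\beta,B))$ (annealed pressure), $M_n=\partial_B\psi_n$ (magnetization), $\chi_n=\partial_B^2\psi_n$ (susceptibility). Their limits as $n\to\infty$ are denoted $\psi(\beta,B)$, $\mathcal{M}(\beta,B)$, $\chi(\beta,B)$. It is known from earlier work that $\psi_n\to\psi$ for all $\beta\ge0$, $B\in\mathbb{R}$, with $$\psi(\beta,B)=\frac{\beta d}{2}-B+\max_{0\le t\le 1}\big[H_\beta(t)+2Bt\big],\qquad H_\beta(t)=(t-1)\log(1-t)-t\log t+dF_\beta(t),$$ $$F_\beta(t)=\int_0^{\min\{t,1-t\}}\log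 f_\beta(s)\,ds,\qquad f_\beta(s)=\frac{e^{-2\beta}(1-2s)+\sqrt{1+(e^{-4\beta}-1)(1-2s)^2}}{2(1-s)}$$ (with $0\log 0=0$), and that for $\beta\ge0$, $B\ne0$, or $0<\beta<\beta_c$, $B=0$, the limits $\mathcal{M}$ and $\chi$ exist with $\mathcal{M}(\beta,B)=\partial_B\psi(\beta,B)$ and $\chi(\beta,B)=\partial_B^2\psi(\beta,B)$. The specific heat limit is defined as $\mathcal{C}(\beta,B)=\partial_\beta^2\psi(\beta,B)$. For a function $g(\beta,B)$ write $g(\beta,0^+)=\lim_{B\searrow0}g(\beta,B)$. The critical inverse temperature is $\beta_c=\inf\{\beta>0:\mathcal{M}(\beta,0^+)>0\}$; it is known that $\beta_c=\operatorname{atanh}(1/(d-1))=\frac12\log\frac{d}{d-2}$ for $d\ge3$. Notation: $f(x)\asymp g(x)$ means that the ratio $f(x)/g(x)$ is bounded away from $0$ and from infinity in the specified limit. The critical exponents are defined by: $\mathcal{M}(\beta,0^+)\asymp(\beta-\beta_c)^{\boldsymbol{\beta}}$ as $\beta\searrow\beta_c$; $\mathcal{M}(\beta_c,B)\asymp B^{1/\boldsymbol{\delta}}$ as $B\searrow0$; $\chi(\beta,0^+)\asymp(\beta_c-\beta)^{-\boldsymbol{\gamma}}$ as $\beta\nearrow\beta_c$; $\chi(\beta,0^+)\asymp(\beta-\beta_c)^{-\boldsymbol{\gamma}'}$ as $\beta\searrow\beta_c$; $\mathcal{C}(\beta,0^+)\asymp(\beta_c-\beta)^{-\boldsymbol{\alpha}}$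 as $\beta\nearrow\beta_c$; $\mathcal{C}(\beta,0^+)\asymp(\beta-\beta_c)^{-\boldsymbol{\alpha}'}$ as $\beta\searrow\beta_c$. *)

(* Defs.v *)
From HB Require Import structures.
From Stdlib Require Import Reals.
From mathcomp Require Import all_boot.
From Coquelicot Require Import Coquelicot.

Set Implicit Arguments.
Unset Strict Implicit.
Unset Printing Implicit Defensive.

Local Open Scope R_scope.

Fact Rplus_assoc_law : associative Rplus.
Proof. by move=> x y z; rewrite Rplus_assoc. Qed.
HB.instance Definition _ :=
  Monoid.isComLaw.Build R 0 Rplus Rplus_assoc_law Rplus_comm Rplus_0_l.

(** * Random regular graphs: the configuration model *)

(* [(i, a)] is the [a]-th half-edge incident to vertex [i]. *)
Definition half_edge (n d : nat) : finType := ('I_n * 'I_d)%type.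

(* A perfect matching is encoded by the fixed-point-free involution that maps
   each half-edge to its partner. *)
Definition matchings (n d : nat) : {set {ffun half_edge n d -> half_edge n d}} :=
  [set m : {ffun half_edge n d -> half_edge n d}
    | [forall h, (m h != h) && (m (m h) == h)]].

Definition edges (n d : nat) (m : {ffun half_edge n d -> half_edge n d}) :
  {set {set half_edge n d}} := [set [set h; m h] | h : half_edge n d].

(* [k_{i,j}]; for [i = j] it counts self-loops, each of them once. *)
Definition num_edges (n d : nat) (m : {ffun half_edge n d -> half_edge n d})
    (i j : 'I_n) : nat :=
  #|[set e in edges m | [set h.1 | h in e] == [set i; j]]|.

(* The matching is uniform, so expectations are averages over [matchings n d].
   When [d * n] is odd there is no perfect matching and the value is junk. *)
Definition expectation (n d : nat)
    (X : {ffun half_edge n d -> half_edge n d} -> R) : R :=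
  (\big[Rplus/0]_(m in matchings n d) X m) / INR #|matchings n d|.

(** * The annealed Ising model *)

Definition config (n : nat) : finType := {ffun 'I_n -> bool}.

Definition spin (n : nat) (s : config n) (i : 'I_n) : R :=
  if s i then 1 else -1.

Definition hamiltonian (n d : nat) (b B : R)
    (m : {ffun half_edge n d -> half_edge n d}) (s : config n) : R :=
  - b * (\big[Rplus/0]_(i < n) \big[Rplus/0]_(j < n | (i <= j)%N)
           (INR (num_edges m i j) * spin s i * spin s j))
  - B * (\big[Rplus/0]_(i < n) spin s i).

Definition partition_function (n d : nat) (b B : R)
    (m : {ffun half_edge n d -> half_edge n d}) : R :=
  \big[Rplus/0]_(s : config n) exp (- hamiltonian b B m s).

Definition pressure_n (d n : nat) (b B : R) : R :=
  / INR n * ln (expectation (@partition_function n d b B)).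

Definition magnetization_n (d n : nat) (b B : R) : R :=
  Derive (fun B' => pressure_n d n b B') B.

Definition susceptibility_n (d n : nat) (b B : R) : R :=
  Derive_n (fun B' => pressure_n d n b B') 2 B.

(** * The thermodynamic limit *)

(* Convergence as [n] tends to infinity along the [n] with [d * n] even. *)
Definition is_thermo_lim (d : nat) (u : nat -> R) (l : R) : Prop :=
  filterlim u (within (fun n => ~~ odd (d * n)) eventually) (locally l).

(* [Hierarchy.iota] is definite description: this is the limit of [u] whenever
   the limit exists (it is shadowed by the [iota] of seq.v). *)
Definition thermo_lim (d : nat) (u : nat -> R) : R :=
  Hierarchy.iota (fun l : R => is_thermo_lim d u l).

Definition pressure (d : nat) (b B : R) : R :=
  thermo_lim d (fun n => pressure_n d n b B).

Definition magnetization (d : nat) (b B : R) : R :=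
  thermo_lim d (fun n => magnetization_n d n b B).

Definition susceptibility (d : nat) (b B : R) : R :=
  thermo_lim d (fun n => susceptibility_n d n b B).

Definition specific_heat (d : nat) (b B : R) : R :=
  Derive_n (fun b' => pressure d b' B) 2 b.

(** * Critical behaviour *)

(* [is_right_lim0 g l] means [g(0^+) = l]. *)
Definition is_right_lim0 (g : R -> R) (l : R) : Prop :=
  filterlim g (at_right 0) (locally l).

Definition beta_c (d : nat) : R :=
  real (Glb_Rbar (fun b => 0 < b /\
          exists m, is_right_lim0 (magnetization d b) m /\ 0 < m)).

Definition asymp (F : (R -> Prop) -> Prop) (f g : R -> R) : Prop :=
  exists c C : R, 0 < c /\ 0 < C /\ F (fun x => c <= f x / g x <= C).

(* [b |-> g(b, 0^+)] exists in the limit specified by [F], and is there of the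
   same order as [h]. *)
Definition asymp_right0 (F : (R -> Prop) -> Prop) (g : R -> R -> R)
    (h : R -> R) : Prop :=
  exists g0 : R -> R, F (fun b => is_right_lim0 (g b) (g0 b)) /\ asymp F g0 h.

(* [b1], [de], [ga], [ga'], [al], [al'] are the exponents written in bold as
   beta, delta, gamma, gamma', alpha, alpha'. *)
Definition critical_exponents (d : nat) (b1 de ga ga' al al' : R) : Prop :=
  let bc := beta_c d in
  [/\ asymp_right0 (at_right bc) (magnetization d)
        (fun b => Rpower (b - bc) b1),
      asymp (at_right 0) (magnetization d bc)
        (fun B => Rpower B (/ de)) &
  [/\ asymp_right0 (at_left bc) (susceptibility d)
        (fun b => Rpower (bc - b) (- ga)),
      asymp_right0 (at_right bc) (susceptibility d)
        (fun b => Rpower (b - bc) (- ga')),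
      asymp_right0 (at_left bc) (specific_heat d)
        (fun b => Rpower (bc - b) (- al)) &
      asymp_right0 (at_right bc) (specific_heat d)
        (fun b => Rpower (b - bc) (- al'))]].

(* Main.v *)
From HB Require Import structures.
Require Import Defs.
From Stdlib Require Import Reals Lra Lia Nsatz.
From mathcomp Require Import all_boot.
From Coquelicot Require Import Coquelicot.

Set Implicit Arguments.
Unset Strict Implicit.
Unset Printing Implicit Defensive.

Local Open Scope R_scope.

(** Write [d = k + 1] and [T = tanh b]. Summing over the matchings first, the removal
    of the pair of one half-edge gives a recursion ([pairing_sum_rec]) which is Wick's
    rule for two Gaussian variables with variances [exp b] and covariance [exp (- b)];
    in polar coordinates their moments are integrals over an angle, which obey the
    same recursion ([moment_rec]). Given the angle the spins are independent, so that
    the expected partition function is, up to a factor between [1 / PI] and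
    [(d * n + 1) / PI], the integral over a half-period of [h ^ n], where
    [h t = exp B * (ca * cos t + cb * sin t) ^ d + exp (- B) * (ca * cos t - cb * sin t) ^ d]
    with [ca ^ 2 = cosh b] and [cb ^ 2 = sinh b] ([expectation_partition]).

    For [b > 0] and [B > 0] the function [|h|] has a single maximum, at the angle for
    which [s = sqrt T * tan t] is the solution in [(0, T)] of
    [artanh (s / T) - k * artanh s = B] ([integrand_peak], [field_of_equilibrium]).
    Laplace's method then gives the limits of the pressure, of the magnetization and,
    one order further, of the susceptibility ([thermo_limits]); the second order
    costs no expansion, because near the peak every test function can be compared
    with [h'], and the mean of [h' ^ 2] is known from integration by parts
    ([wmean_order2], [wmean_order1]). The limits are rational functions of [T] and
    [s]. The susceptibility has [stiffness k T s] in its denominator, which is up to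
    positive factors the derivative of the field in [s]. The specific heat follows by
    differentiating [s] in [b], and has one term with the same denominator and a
    factor [s ^ 2] ([equil_heat]).

    As [B] decreases to [0], the root [s] tends to [0] if [k * T <= 1], and to the
    positive root of the zero-field equation otherwise ([root_of_right_lim]); hence
    the critical point is [k * tanh b = 1] ([beta_cE]). Near it the field is
    [(- A * s + C * s ^ 3 / 3) / T ^ 2] up to higher orders, where
    [A = T * (k * T - 1)] is of the order of the distance to criticality and
    [C = k - T] is positive ([field_of_bounds]). So [s ^ 2] is of the order of
    [b - beta_c] above [beta_c], [s ^ 3] is of the order of [B] at [beta_c], and the
    stiffness is of the order of [|b - beta_c|] on both sides: these are the exponents
    of the magnetization and of the susceptibility. In the specific heat the
    vanishing stiffness is compensated by [s ^ 2] above [beta_c], and the term is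
    absent below. *)

(** * Continuity of real functions *)

Lemma cont_plus (f g : R -> R) (t : R) :
  continuous f t -> continuous g t -> continuous (fun x : R => f x + g x) t.
Proof. exact: (@continuous_plus R_UniformSpace R_AbsRing R_NormedModule). Qed.

Lemma cont_opp (f : R -> R) (t : R) :
  continuous f t -> continuous (fun x : R => - f x) t.
Proof. exact: (@continuous_opp R_UniformSpace R_AbsRing R_NormedModule). Qed.

Lemma cont_mult (f g : R -> R) (t : R) :
  continuous f t -> continuous g t -> continuous (fun x : R => f x * g x) t.
Proof. exact: (@continuous_mult R_UniformSpace R_AbsRing). Qed.

Lemma cont_pow (f : R -> R) (n : nat) (t : R) :
  continuous f t -> continuous (fun x : R => f x ^ n) t.
Proof.
move=> cf; elim: n => [|n IH] /=; first exact: continuous_const.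
exact: cont_mult.
Qed.

Lemma cont_abs (f : R -> R) (t : R) :
  continuous f t -> continuous (fun x : R => Rabs (f x)) t.
Proof. by move=> cf; apply: continuous_comp => //; apply: continuous_Rabs. Qed.

Create HintDb cont.

Ltac cont :=
  rewrite /Rminus;
  repeat first [ assumption | solve [auto 2 with cont] | apply: continuous_const | apply: continuous_id
               | apply: cont_plus | apply: cont_opp | apply: cont_mult
               | apply: cont_pow | apply: cont_abs ].

Lemma ex_RInt_cont (f : R -> R) (a b : R) :
  (forall t, continuous f t) -> ex_RInt f a b.
Proof.
by move=> cf; apply: (@ex_RInt_continuous R_CompleteNormedModule) => z _.
Qed.

(** * Sums over perfect matchings *)

Fact Rmult_assoc_law : associative Rmult.
Proof. by move=> x y z; rewrite Rmult_assoc. Qed.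
HB.instance Definition _ :=
  Monoid.isComLaw.Build R 1 Rmult Rmult_assoc_law Rmult_comm Rmult_1_l.
HB.instance Definition _ := Monoid.isMulLaw.Build R 0 Rmult Rmult_0_l Rmult_0_r.
HB.instance Definition _ :=
  Monoid.isAddLaw.Build R Rmult Rplus Rmult_plus_distr_r Rmult_plus_distr_l.

Lemma Rsum_const (I : finType) (P : pred I) (c : R) :
  \big[Rplus/0]_(i | P i) c = INR #|P| * c.
Proof.
rewrite big_const; elim: #|P| => [|m IH]; first by rewrite /=; ring.
by rewrite iterS IH S_INR; ring.
Qed.

(** Extending a perfect matching of [A] by the identity keeps the matchings of all
    subsets of [T] in one type, so that a pair can be removed or added back. *)
Definition pairings (T : finType) (A : {set T}) : {set {ffun T -> T}} :=
  [set m : {ffun T -> T} |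
    [forall x, if x \in A then [&& m x \in A, m x != x & m (m x) == x]
               else m x == x]].

Lemma pairingsP (T : finType) (A : {set T}) (m : {ffun T -> T}) :
  reflect ((forall x, x \in A -> [/\ m x \in A, m x != x & m (m x) = x]) /\
           (forall x, x \notin A -> m x = x))
          (m \in pairings A).
Proof.
rewrite inE; apply: (iffP forallP) => [H|[H1 H2] x].
  split=> x xA; have := H x; rewrite ?xA ?(negbTE xA).
    by case/and3P=> ? ? /eqP.
  by move/eqP.
case: ifPn => xA; last by apply/eqP/H2.
by case: (H1 x xA) => -> -> ->; rewrite eqxx.
Qed.

Definition pairing_sum (T : finType) (w : T -> T -> R) (A : {set T}) : R :=
  \big[Rplus/0]_(m in pairings A) \big[Rmult/1]_(h in A) w h (m h).

Lemma pairing_sum0 (T : finType) (w : T -> T -> R) : pairing_sum w set0 = 1.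
Proof.
rewrite /pairing_sum (big_pred1 [ffun x => x]) => [|m]; first by rewrite big_set0.
apply/pairingsP/eqP => [[_ H]|->].
  by apply/ffunP => x; rewrite ffunE H // inE.
by split=> x; rewrite ?inE // ffunE.
Qed.

Definition unpair (T : finType) (x y : T) (m : {ffun T -> T}) : {ffun T -> T} :=
  [ffun z => if (z == x) || (z == y) then z else m z].

Definition add_pair (T : finType) (x y : T) (m : {ffun T -> T}) : {ffun T -> T} :=
  [ffun z => if z == x then y else if z == y then x else m z].

Lemma add_pairK (T : finType) (A : {set T}) (x y : T) (m : {ffun T -> T}) :
  m \in pairings (A :\ x :\ y) -> unpair x y (add_pair x y m) = m.
Proof.
move/pairingsP=> [_ H]; apply/ffunP => z; rewrite !ffunE.
case: eqVneq => [->|zx] /=; first by rewrite H // !inE eqxx andbF.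
by case: eqVneq => [->|zy] //=; rewrite H // !inE eqxx.
Qed.

Lemma add_pair_in (T : finType) (A : {set T}) (x y : T) (m : {ffun T -> T}) :
  x \in A -> y \in A :\ x -> m \in pairings (A :\ x :\ y) ->
  add_pair x y m \in pairings A.
Proof.
move=> xA yAx /pairingsP[H1 H2].
have /andP[yx yA] : (y != x) && (y \in A) by move: yAx; rewrite !inE.
apply/pairingsP; split=> z zA; rewrite !ffunE.
  case: (eqVneq z x) => [->|zx]; first by rewrite (negbTE yx) eqxx.
  case: (eqVneq z y) => [->|zy]; first by rewrite eqxx eq_sym.
  have zB : z \in A :\ x :\ y by rewrite !inE zy zx.
  have [] := H1 z zB; rewrite !inE => /and3P[mzy mzx mzA] mzz mmz.
  by rewrite (negbTE mzx) (negbTE mzy).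
case: eqVneq zA => [->|zx zA]; first by rewrite xA.
case: eqVneq zA => [->|zy zA]; first by rewrite yA.
by rewrite H2 // !inE (negbTE zA) !andbF.
Qed.

Lemma unpair_in (T : finType) (A : {set T}) (x y : T) (m : {ffun T -> T}) :
  x \in A -> m \in pairings A -> m x = y -> unpair x y m \in pairings (A :\ x :\ y).
Proof.
move=> xA /pairingsP[H1 H2] mxy; have [yA yx myx] := H1 x xA.
rewrite mxy in yA yx myx.
apply/pairingsP; split=> z; rewrite !inE !ffunE.
  case/and3P=> zy zx zA; rewrite (negbTE zx) (negbTE zy) /=.
  have [mzA mzz mmz] := H1 z zA.
  have mzx : m z != x by apply: contraNneq zy => e; rewrite -mmz e mxy.
  have mzy : m z != y by apply: contraNneq zx => e; rewrite -mmz e myx.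
  by rewrite (negbTE mzx) (negbTE mzy) /= mzA.
case: (eqVneq z x) => [//|zx]; case: (eqVneq z y) => [//|zy] /= zA.
exact: H2.
Qed.

Lemma unpairK (T : finType) (A : {set T}) (x y : T) (m : {ffun T -> T}) :
  x \in A -> m \in pairings A -> m x = y -> add_pair x y (unpair x y m) = m.
Proof.
move=> xA /pairingsP[H1 H2] mxy; have [_ _ myx] := H1 x xA.
apply/ffunP=> z; rewrite !ffunE.
case: (eqVneq z x) => [->|zx //=]; first by rewrite mxy.
by case: (eqVneq z y) => [->|zy //=]; rewrite -mxy.
Qed.

(** The partner [y] of [x] may be any other point of [A], and what remains is an
    arbitrary matching of the rest; the pair contributes one factor for each of its
    two points. *)
Lemma pairing_sum_rec (T : finType) (w : T -> T -> R) (A : {set T}) (x : T) :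
  x \in A ->
  pairing_sum w A =
  \big[Rplus/0]_(y in A :\ x) (w x y * w y x * pairing_sum w (A :\ x :\ y)).
Proof.
move=> xA; rewrite /pairing_sum.
rewrite (partition_big (fun m : {ffun T -> T} => m x) (mem (A :\ x))) /=; last first.
  by move=> m /pairingsP[H _]; have [mxA mx _] := H x xA; rewrite !inE mx.
apply: eq_bigr => y yAx; rewrite big_distrr /=.
rewrite (reindex_onto (add_pair x y) (unpair x y)) /=; last first.
  by move=> m /andP[mA /eqP mx]; exact: (unpairK xA mA mx).
have xy : (y == x) = false by move: yAx; rewrite !inE; case: eqVneq.
apply: eq_big => m.
  apply/andP/idP => [[/andP[mA /eqP mx] /eqP e]|mB].
    by rewrite -e; apply: unpair_in.
  rewrite (add_pairK mB) (add_pair_in xA yAx mB) ffunE.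
  by rewrite !eqxx.
move=> _; rewrite (bigD1 x) //= (bigD1 y) /=; last by move: yAx; rewrite !inE andbC.
rewrite !ffunE eqxx eqxx xy -Rmult_assoc; congr (_ * _).
apply: eq_big => [z|z /andP[/andP[_ zx] zy]].
  by rewrite !inE; case: (z == x); case: (z == y); case: (z \in A).
by rewrite ffunE (negbTE zx) (negbTE zy).
Qed.

(** * Trigonometric moments *)

Definition wave (u : R * R) (t : R) : R := fst u * cos t + snd u * sin t.

(** Up to a radial factor, the moment of order [(k, l)] of the Gaussian pair obtained
    by replacing [(cos t, sin t)] in [(wave u t, wave v t)] with two independent
    standard normal variables. *)
Definition moment (u v : R * R) (k l : nat) : R :=
  RInt (fun t => wave u t ^ k * wave v t ^ l) (- (PI / 2)) (PI / 2).

Definition dot (u v : R * R) : R := fst u * fst v + snd u * snd v.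

Lemma wave_derive (u : R * R) (t : R) :
  is_derive (wave u) t (wave (snd u, - fst u) t).
Proof. by rewrite /wave; auto_derive => //=; ring. Qed.

Lemma continuous_wave (u : R * R) (t : R) : continuous (wave u) t.
Proof. by apply: ex_derive_continuous; exists (wave (snd u, - fst u) t); apply: wave_derive. Qed.

#[local] Hint Resolve continuous_wave : cont.

Lemma ex_RInt_moment (u v : R * R) (k l : nat) (a b : R) :
  ex_RInt (fun t => wave u t ^ k * wave v t ^ l) a b.
Proof.
apply: ex_RInt_cont => t.
by cont.
Qed.

Lemma momentC (u v : R * R) (k l : nat) : moment u v k l = moment v u l k.
Proof. by apply: RInt_ext => t _; rewrite Rmult_comm. Qed.

Lemma moment00 (u v : R * R) : moment u v 0 0 = PI.
Proof.
rewrite /moment (RInt_ext _ (fun=> 1)) => [|t _]; last by rewrite /=; ring.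
by rewrite RInt_const /scal /= /mult /=; lra.
Qed.

(** Integrating the derivative of [wave u ^ k * wave v ^ l * (wave u)'] over a
    half-period, on which an even total degree makes the boundary terms cancel,
    gives Wick's rule for Gaussian variables with covariances [dot u u] and
    [dot u v]; the factor [k + l + 1] accounts for the missing radial integral. *)
Lemma moment_rec (u v : R * R) (k l : nat) : odd (k + l) ->
  INR (k + l + 1) * moment u v k.+1 l =
  INR k * dot u u * moment u v k.-1 l + INR l * dot u v * moment u v k l.-1.
Proof.
move=> okl.
pose G t := wave u t ^ k * wave v t ^ l * wave (snd u, - fst u) t.
pose g t := (INR k * dot u u) * (wave u t ^ k.-1 * wave v t ^ l) +
            (INR l * dot u v) * (wave u t ^ k * wave v t ^ l.-1) -
            INR (k + l + 1) * (wave u t ^ k.+1 * wave v t ^ l).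
have dG t : is_derive G t (g t).
  have du := wave_derive u t; have dv := wave_derive v t.
  have dr := wave_derive (snd u, - fst u) t.
  evar (e : R).
  have : is_derive G t e.
    rewrite /G.
    apply: is_derive_mult; last by move=> *; apply: Rmult_comm.
      apply: is_derive_mult; last by move=> *; apply: Rmult_comm.
        by apply: is_derive_pow; exact: du.
      by apply: is_derive_pow; exact: dv.
    exact: dr.
  have -> : e = g t; last by [].
  have cs : sin t * sin t = 1 - cos t * cos t.
    by have := sin2_cos2 t; rewrite /Rsqr; lra.
  rewrite /e /g /plus /mult /= /dot !plus_INR.
  have Ek : INR k * wave u t ^ k = INR k * wave u t ^ k.-1 * wave u t.
    by case: (k) => [|k'] /=; ring.
  have El : INR l * wave v t ^ l = INR l * wave v t ^ l.-1 * wave v t.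
    by case: (l) => [|l'] /=; ring.
  have Ek2 : INR k * (wave u t * wave u t ^ k) =
             INR k * wave u t ^ k.-1 * wave u t * wave u t.
    by rewrite -Ek; ring.
  have uu : wave (snd u, - fst u) t * wave (snd u, - fst u) t =
            fst u * fst u + snd u * snd u - wave u t * wave u t.
    by rewrite /wave /=; nsatz.
  have uv : wave (snd u, - fst u) t * wave (snd v, - fst v) t =
            fst u * fst v + snd u * snd v - wave u t * wave v t.
    by rewrite /wave /=; nsatz.
  have w2 : wave (- fst u, - snd u) t = - wave u t by rewrite /wave /=; ring.
  rewrite w2; nsatz.
have H : is_RInt g (- (PI / 2)) (PI / 2) (minus (G (PI / 2)) (G (- (PI / 2)))).
  apply: is_RInt_derive => t _; first exact: dG.
  have cw w : continuous (wave w) t by exact: continuous_wave.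
  by rewrite /g; cont.
have bd : minus (G (PI / 2)) (G (- (PI / 2))) = 0.
  rewrite /minus /plus /opp /= /G /wave /= cos_neg sin_neg cos_PI2 sin_PI2.
  have e1 w : fst w * 0 + snd w * - (1) = - 1 * (snd w : R) by ring.
  have e2 w : fst w * 0 + snd w * 1 = (snd w : R) by ring.
  rewrite (e1 u) (e1 v) (e2 u) (e2 v) !Rpow_mult_distr.
  have := erefl ((-1) ^ (k + l)%N); rewrite {1}pow_add.
  have -> : (-1) ^ (k + l)%N = -1.
    rewrite -[(k + l)%N]odd_double_half okl -mul2n pow_add.
    by rewrite pow_1_even /=; ring.
  by move=> E; nsatz.
rewrite bd in H.
have H2 : is_RInt g (- (PI / 2)) (PI / 2)
   ((INR k * dot u u) * moment u v k.-1 l + (INR l * dot u v) * moment u v k l.-1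
     - INR (k + l + 1) * moment u v k.+1 l).
  apply: (@is_RInt_minus R_NormedModule).
    apply: (@is_RInt_plus R_NormedModule); apply: (@is_RInt_scal R_NormedModule);
    by apply: (@RInt_correct R_CompleteNormedModule); apply: ex_RInt_moment.
  apply: (@is_RInt_scal R_NormedModule).
  by apply: (@RInt_correct R_CompleteNormedModule); apply: ex_RInt_moment.
have := is_RInt_unique _ _ _ _ H; rewrite (is_RInt_unique _ _ _ _ H2); lra.
Qed.

(** * Matching sums as moments *)

(** The double factorials [(2 j)!!] and [(2 j - 1)!!]. *)
Fixpoint even_fact (j : nat) : R := if j is i.+1 then INR (2 * i + 2) * even_fact i else 1.
Fixpoint odd_fact (j : nat) : R := if j is i.+1 then INR (2 * i + 1) * odd_fact i else 1.

Lemma odd_fact_gt0 (j : nat) : 0 < odd_fact j.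
Proof.
elim: j => [|i IH] /=; first lra.
by apply: Rmult_lt_0_compat => //; apply: lt_0_INR; apply/ltP; rewrite addn1.
Qed.

(** The number of matchings and the normalisation of the moments differ by a
    polynomial factor only, which the pressure does not see. *)
Lemma even_odd_fact (j : nat) :
  odd_fact j <= even_fact j <= INR (2 * j + 1) * odd_fact j.
Proof.
have := odd_fact_gt0 j; elim: j => [|i IH] H; first by rewrite /=; lra.
have Hi := odd_fact_gt0 i; have {}IH := IH Hi.
have e1 : INR (2 * i + 2) = INR (2 * i + 1) + 1.
  by rewrite !plus_INR /=; ring.
have e2 : INR (2 * i.+1 + 1) = INR (2 * i + 1) + 2.
  by rewrite mulnS -addnA addnC plus_INR /=; ring.
have := pos_INR (2 * i + 1); rewrite [even_fact _]/= [odd_fact _]/= e1 e2.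
move: (INR _) IH => c IH c0; nra.
Qed.

Definition sgn (b : bool) : R := if b then 1 else -1.

Lemma card_rem1 (T : finType) (A : {set T}) (x : T) (p : pred T) : x \in A ->
  #|[set h in A | p h]| = (p x + #|[set h in A :\ x | p h]|)%N.
Proof.
move=> xA; rewrite (cardsD1 x) inE xA; congr (_ + _)%N.
by apply: eq_card => z; rewrite !inE andbA.
Qed.

Lemma pairing_sum1 (T : finType) (j : nat) (A : {set T}) : #|A| = (2 * j)%N ->
  INR #|pairings A| = odd_fact j.
Proof.
have -> : INR #|pairings A| = pairing_sum (fun _ _ => 1) A.
  rewrite /pairing_sum (eq_bigr (fun=> 1)) => [|m _]; last by rewrite big1.
  by rewrite Rsum_const Rmult_1_r.
elim: j A => [|j IH] A cA.
  by rewrite (cards0_eq cA) pairing_sum0.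
have [x xA] : exists x, x \in A by apply/card_gt0P; rewrite cA mulnS.
rewrite (pairing_sum_rec _ xA).
rewrite (eq_bigr (fun=> odd_fact j)) => [|y yA].
  rewrite Rsum_const /=; congr (INR _ * _).
  move: cA; rewrite (cardsD1 x) xA mulnS add2n addn1 add1n => -[<-].
  by apply: eq_card.
rewrite IH ?Rmult_1_l //.
by move: cA; rewrite (cardsD1 x) xA (cardsD1 y) yA mulnS => -[].
Qed.

(** Both sides obey the same recursion: [pairing_sum_rec] sorts the partners of a
    point by their spins, which is the right-hand side of [moment_rec]. *)
Lemma pairing_sum_ising (T : finType) (tau : T -> bool) (b : R) (u v : R * R)
    (j : nat) (A : {set T}) :
  dot u u = exp b -> dot v v = exp b -> dot u v = exp (- b) ->
  #|A| = (2 * j)%N ->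
  pairing_sum (fun x y => exp (b / 2 * sgn (tau x) * sgn (tau y))) A =
  even_fact j / PI *
  moment u v #|[set h in A | tau h]| #|[set h in A | ~~ tau h]|.
Proof.
move=> uu vv uv; set w := fun x y => _.
have ww x y : w x y * w y x = exp (b * sgn (tau x) * sgn (tau y)).
  by rewrite /w -exp_plus; congr exp; field.
have PI0 : PI <> 0 by have := PI_RGT_0; lra.
elim: j A => [|j IH] A cA.
  rewrite (cards0_eq cA) pairing_sum0.
  have e p : [set h in (set0 : {set T}) | p h] = set0.
    by apply/setP => z; rewrite !inE.
  by rewrite !e cards0 moment00 /=; field.
have [x xA] : exists x, x \in A by apply/card_gt0P; rewrite cA mulnS.
rewrite (pairing_sum_rec _ xA).
pose k := #|[set h in A :\ x | tau h]|; pose l := #|[set h in A :\ x | ~~ tau h]|.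
have kl : (k + l)%N = (2 * j).+1.
  have : #|A :\ x| = (2 * j).+1 by move: cA; rewrite (cardsD1 x) xA mulnS => -[].
  move <-; rewrite -(cardsID [set h | tau h] (A :\ x)); congr (_ + _)%N.
    by apply: eq_card => z; rewrite !inE.
  by apply: eq_card => z; rewrite !inE andbC.
have E y : y \in A :\ x -> pairing_sum w (A :\ x :\ y) = even_fact j / PI *
    (if tau y then moment u v k.-1 l else moment u v k l.-1).
  move=> yA; rewrite IH; last first.
    by move: cA; rewrite (cardsD1 x) xA (cardsD1 y) yA mulnS => -[].
  by congr (_ * _); rewrite /k /l !(card_rem1 _ yA); case: (tau y).
rewrite (bigID tau) /=.
rewrite (eq_bigr (fun=> exp (b * sgn (tau x)) * (even_fact j / PI * moment u v k.-1 l)))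
    => [|y /andP[yA ty]]; last by rewrite ww (E _ yA) ty /= Rmult_1_r.
rewrite [X in _ + X](eq_bigr (fun=> exp (- (b * sgn (tau x))) * (even_fact j / PI * moment u v k l.-1)))
    => [|y /andP[yA /negbTE ty]]; last first.
  by rewrite ww (E _ yA) ty /=; congr (exp _ * _); ring.
rewrite !Rsum_const.
have -> : #|[pred i in A :\ x | tau i]| = k.
  by apply: eq_card => z; rewrite !inE.
have -> : #|[pred i in A :\ x | ~~ tau i]| = l.
  by apply: eq_card => z; rewrite !inE.
rewrite !(card_rem1 _ xA) -/k -/l.
have okl : odd (k + l) by rewrite kl /= oddM.
have okl' : odd (l + k) by rewrite addnC.
have e2 : INR (2 * j + 2) = INR (k + l + 1) by rewrite kl addn1 addn2.
case: (tau x) => /=; rewrite e2 ?add0n ?add1n.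
  have := moment_rec u v okl; rewrite uu uv Rmult_1_r => H.
  have -> : INR (k + l + 1) * even_fact j / PI * moment u v k.+1 l =
    even_fact j / PI * (INR (k + l + 1) * moment u v k.+1 l) by field.
  by rewrite H; ring.
have vu : dot v u = exp (- b) by rewrite -uv /dot; ring.
have := moment_rec v u okl'; rewrite vv vu !(momentC v u) => H.
have -> : INR (k + l + 1) * even_fact j / PI * moment u v k l.+1 =
    even_fact j / PI * (INR (l + k + 1) * moment u v k l.+1).
  by rewrite (addnC l k); field.
rewrite H; have -> : b * -1 = - b by ring.
by rewrite Ropp_involutive; ring.
Qed.

(** * The annealed partition function as an integral *)

Lemma exp_sum (I : Type) (r : seq I) (P : pred I) (F : I -> R) :
  exp (\big[Rplus/0]_(i <- r | P i) F i) = \big[Rmult/1]_(i <- r | P i) exp (F i).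
Proof.
apply: (big_morph exp) => [x y|]; [exact: exp_plus | exact: exp_0].
Qed.

Lemma RInt_sum (I : Type) (r : seq I) (P : pred I) (F : I -> R -> R) (a b : R) :
  (forall i, ex_RInt (F i) a b) ->
  is_RInt (fun t => \big[Rplus/0]_(i <- r | P i) F i t) a b
          (\big[Rplus/0]_(i <- r | P i) RInt (F i) a b).
Proof.
move=> HF; elim: r => [|i r IH].
  rewrite big_nil; apply: (is_RInt_ext (fun=> 0)) => [t _|]; first by rewrite big_nil.
  by have := @is_RInt_const R_NormedModule a b 0; rewrite /scal /= /mult /= Rmult_0_r.
rewrite big_cons; case Pi: (P i).
  apply: (is_RInt_ext (fun t => F i t + \big[Rplus/0]_(j <- r | P j) F j t)) => [t _|].
    by rewrite big_cons Pi.
  by apply: (@is_RInt_plus R_NormedModule) => //;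
     apply: (@RInt_correct R_CompleteNormedModule).
by apply: (is_RInt_ext _ _ _ _ _ _ IH) => t _; rewrite big_cons Pi.
Qed.

Lemma matchings_pairings (n d : nat) : matchings n d = pairings [set: half_edge n d].
Proof.
apply/setP => m; rewrite !inE; apply: eq_forallb => h.
by rewrite !inE.
Qed.

Lemma matching_edge (n d : nat) (m : {ffun half_edge n d -> half_edge n d})
    (h k : half_edge n d) : m \in matchings n d ->
  ([set k; m k] == [set h; m h]) = (k \in [set h; m h]).
Proof.
rewrite inE => /forallP mm; have mK x : m (m x) = x by have /andP[_ /eqP] := mm x.
apply/eqP/idP => [<-|]; first by rewrite !inE eqxx.
by rewrite !inE => /orP[] /eqP -> //; rewrite mK setUC.
Qed.

Lemma sum_edges (n d : nat) (m : {ffun half_edge n d -> half_edge n d})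
    (f : {set half_edge n d} -> R) : m \in matchings n d ->
  \big[Rplus/0]_(e in edges m) f e =
  \big[Rplus/0]_(h : half_edge n d) (f [set h; m h] / 2).
Proof.
move=> mM; rewrite [RHS](partition_big_imset (fun h => [set h; m h])) /=.
apply: eq_big => [e|_ /imsetP[h _ ->]]; first by rewrite /edges; congr (_ \in _); apply: eq_imset.
rewrite (eq_bigr (fun=> f [set h; m h] / 2)) => [|k /eqP -> //].
rewrite Rsum_const.
have -> : #|[pred k | [set k; m k] == [set h; m h]]| = #|[set h; m h]|.
  by apply: eq_card => k; rewrite -(matching_edge _ _ mM) inE.
move: mM; rewrite inE => /forallP/(_ h)/andP[mh _].
by rewrite cards2 eq_sym mh /=; field.
Qed.

Lemma ordered_pair (n : nat) (i j x y : 'I_n) : (i <= j)%N ->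
  ([set x; y] == [set i; j]) =
  ((i, j) == if (x <= y)%N then (x, y) else (y, x)).
Proof.
move=> ij; apply/eqP/eqP => [E|]; last by case: ifP => _ [-> ->] //; rewrite setUC.
have [xi yi] : x \in [set i; j] /\ y \in [set i; j] by rewrite -E !inE !eqxx orbT.
have [ix jx] : i \in [set x; y] /\ j \in [set x; y] by rewrite E !inE !eqxx orbT.
move: xi yi ix jx; rewrite !inE.
case: (leqP x y) => xy; do 4 (case/orP => /eqP ?); subst => //;
  by try (have ? : i = j by apply/val_inj/eqP; rewrite eqn_leq ?ij ?xy ?(ltnW xy)); subst;
     rewrite ?ltnn in xy *.
Qed.

(** Every edge has two half-edges, hence the factor [1 / 2]; in terms of half-edges
    the energy no longer refers to multiplicities or self-loops. *)
Lemma energy_half_edges (n d : nat) (m : {ffun half_edge n d -> half_edge n d})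
    (x : 'I_n -> R) : m \in matchings n d ->
  \big[Rplus/0]_(i < n) \big[Rplus/0]_(j < n | (i <= j)%N)
    (INR (num_edges m i j) * x i * x j) =
  \big[Rplus/0]_(h : half_edge n d) (x h.1 * x (m h).1 / 2).
Proof.
move=> mM; rewrite pair_big_dep /=.
pose c h (p : 'I_n * 'I_n) := if [set (h : half_edge n d).1; (m h).1] == [set p.1; p.2] then 1 else 0.
rewrite (eq_bigr (fun p => \big[Rplus/0]_(h : half_edge n d) (c h p * (x p.1 * x p.2 / 2))));
    last first.
  move=> [i j] /= _.
  have -> : INR (num_edges m i j) = \big[Rplus/0]_(h : half_edge n d) (c h (i, j) / 2).
    have -> : INR (num_edges m i j) = \big[Rplus/0]_(e in edges m)
        (if [set h.1 | h in e] == [set i; j] then 1 else 0).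
      rewrite -big_mkcondr /= Rsum_const Rmult_1_r; congr INR.
      by apply: eq_card => e; rewrite !inE.
    rewrite (sum_edges _ mM) /=; apply: eq_bigr => h _.
    by rewrite imsetU1 imset_set1.
  by rewrite Rmult_assoc big_distrl; apply: eq_bigr => h _ /=; field.
rewrite exchange_big /=; apply: eq_bigr => h _.
pose p0 := if ((h : half_edge n d).1 <= (m h).1)%N then (h.1, (m h).1) else ((m h).1, h.1).
have p0le : (p0.1 <= p0.2)%N by rewrite /p0; case: ifPn => //=; rewrite -ltnNge => /ltnW.
rewrite (bigD1 p0) //= big1 => [|[i j] /andP[/= ij np]]; last first.
  by rewrite /c /= (ordered_pair _ _ ij) -/p0 (negbTE np); ring.
rewrite /c (ordered_pair _ _ p0le) -/p0 -surjective_pairing eqxx /p0.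
by case: ifP => _ /=; field.
Qed.

Definition integrand (d : nat) (u v : R * R) (B t : R) : R :=
  exp B * wave u t ^ d + exp (- B) * wave v t ^ d.

Lemma Rprod_const (I : finType) (A : {set I}) (c : R) :
  \big[Rmult/1]_(i in A) c = c ^ #|A|.
Proof. by rewrite big_const; elim: #|_| => //= m ->. Qed.

Lemma prod_half_edges (n d : nat) (s : config n) (x y : R) :
  x ^ #|[set h in [set: half_edge n d] | s h.1]| *
  y ^ #|[set h in [set: half_edge n d] | ~~ s h.1]| =
  \big[Rmult/1]_(i < n) (if s i then x ^ d else y ^ d).
Proof.
rewrite -!Rprod_const.
rewrite (eq_bigr (fun i : 'I_n => \big[Rmult/1]_(a < d) (if s i then x else y))); last first.
  by move=> i _; case: (s i); rewrite big_const card_ord; elim: (d) => //= m ->.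
rewrite pair_big /= [RHS](bigID (fun h : half_edge n d => s h.1)) /=.
congr (_ * _).
  by apply: eq_big => [h|h]; rewrite !inE //= => ->.
by apply: eq_big => [h|h]; rewrite !inE //= => /negbTE ->.
Qed.

(** Once the matchings are summed out, the spins interact only through the angle
    [t]: given [t] they are independent, so the sum over configurations is an
    [n]-th power. *)
Lemma expectation_partition (n d j : nat) (b B : R) (u v : R * R) :
  dot u u = exp b -> dot v v = exp b -> dot u v = exp (- b) ->
  (d * n)%N = (2 * j)%N ->
  expectation (@partition_function n d b B) =
  even_fact j / (PI * odd_fact j) *
  RInt (fun t => integrand d u v B t ^ n) (- (PI / 2)) (PI / 2).
Proof.
move=> uu vv uv dn.
have cT : #|[set: half_edge n d]| = (2 * j)%N.
  by rewrite cardsT card_prod !card_ord mulnC.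
have Nj : INR #|matchings n d| = odd_fact j.
  by rewrite matchings_pairings (pairing_sum1 cT).
have O0 := odd_fact_gt0 j; have P0 := PI_RGT_0.
rewrite /expectation Nj.
pose w (s : config n) (h k : half_edge n d) := exp (b / 2 * sgn (s h.1) * sgn (s k.1)).
pose field_weight (s : config n) := \big[Rmult/1]_(i < n) exp (B * sgn (s i)).
have -> : \big[Rplus/0]_(m in matchings n d) partition_function b B m =
    \big[Rplus/0]_(s : config n) (field_weight s * pairing_sum (w s) [set: half_edge n d]).
  rewrite /partition_function exchange_big /=; apply: eq_bigr => s _.
  rewrite /pairing_sum big_distrr /= -matchings_pairings; apply: eq_bigr => m mM.
  rewrite /hamiltonian (energy_half_edges _ mM).
  have -> x y : - (- b * x - B * y) = B * y + b * x by ring.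
  rewrite exp_plus; congr (_ * _).
    by rewrite big_distrr /= exp_sum.
  rewrite big_distrr /= exp_sum; apply: eq_big => [h|h _]; first by rewrite inE.
  by rewrite /w; congr exp; rewrite /spin /sgn; case: (s h.1); case: (s (m h).1); field.
rewrite (eq_bigr (fun s : config n => even_fact j / PI * (field_weight s *
    moment u v #|[set h in [set: half_edge n d] | s h.1]|
               #|[set h in [set: half_edge n d] | ~~ s h.1]|))); last first.
  move=> s _; rewrite /w (pairing_sum_ising (fun h : half_edge n d => s h.1) uu vv uv cT).
  by ring.
rewrite -big_distrr /=.
pose F (s : config n) t := field_weight s *
   (wave u t ^ #|[set h in [set: half_edge n d] | s h.1]| *
    wave v t ^ #|[set h in [set: half_edge n d] | ~~ s h.1]|).
have FE s : field_weight s * moment u v #|[set h in [set: half_edge n d] | s h.1]|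
               #|[set h in [set: half_edge n d] | ~~ s h.1]| =
            RInt (F s) (- (PI / 2)) (PI / 2).
  by symmetry; apply: (@RInt_scal R_CompleteNormedModule); apply: ex_RInt_moment.
rewrite (eq_bigr _ (fun s _ => FE s)).
have exF s : ex_RInt (F s) (- (PI / 2)) (PI / 2).
  by apply: (@ex_RInt_scal R_NormedModule); apply: ex_RInt_moment.
rewrite -(is_RInt_unique _ _ _ _ (@RInt_sum _ (index_enum _) xpredT F _ _ exF)).
rewrite (RInt_ext _ (fun t => integrand d u v B t ^ n)) => [|t _]; first by field; lra.
have -> : integrand d u v B t ^ n =
    \big[Rmult/1]_(i < n) \big[Rplus/0]_(c : bool)
       (exp (B * sgn c) * (if c then wave u t ^ d else wave v t ^ d)).
  rewrite (eq_bigr (fun=> integrand d u v B t)) => [|i _].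
    by rewrite big_const card_ord; elim: (n) => //= m ->.
  by rewrite big_bool /integrand /= Rmult_1_r; congr (_ + exp _ * _); ring.
rewrite bigA_distr_bigA /=; apply: eq_bigr => s _.
by rewrite /F prod_half_edges /field_weight -big_split.
Qed.

(** * Laplace's method *)

Lemma filterlim_R (T : Type) (F : (T -> Prop) -> Prop) (FF : Filter F)
    (f : T -> R) (l : R) :
  filterlim f F (locally l) <->
  forall eps, 0 < eps -> F (fun x => Rabs (f x - l) <= eps).
Proof.
split=> [/filterlim_locally H eps e0|H].
  apply: filter_imp (H (mkposreal _ e0)) => x.
  by rewrite /ball /= /AbsRing_ball /= /abs /minus /plus /opp /=; apply: Rlt_le.
apply/filterlim_locally => -[eps e0].
have e2 : 0 < eps / 2 by lra.
apply: filter_imp (H _ e2) => x Hx.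
rewrite /ball /= /AbsRing_ball /= /abs /minus /plus /opp /=.
by apply: Rle_lt_trans Hx _; lra.
Qed.

Lemma eventually_geometric (q C eps : R) : 0 <= q < 1 -> 0 < eps ->
  eventually (fun n => INR n.+1 * (C * q ^ n) <= eps).
Proof.
move=> q01 e0.
pose p := Rmax q (1 / 2); have p01 : 0 < p < 1.
  by rewrite /p /Rmax; case: Rle_dec; lra.
have qp : q <= p by apply: Rmax_l.
pose y := sqrt (/ p).
have ip : 1 < / p by rewrite -Rinv_1; apply: Rinv_lt_contravar; lra.
have yy : y * y = / p by apply: sqrt_sqrt; lra.
have y1 : 1 < y.
  by have := sqrt_lt_1_alt 1 (/ p); rewrite sqrt_1; apply; lra.
pose D := Rabs C / ((y - 1) * (y - 1)).
have D0 : 0 <= D by apply: Rdiv_le_0_compat; [apply: Rabs_pos | nra].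
have [N HN] := INR_unbounded (2 * D / eps).
exists (S N) => n Hn.
have nb : 2 * D / eps <= INR n.
  by have := le_INR _ _ Hn; rewrite S_INR; lra.
have n1 : 1 <= INR n by apply: (le_INR 1); lia.
have B : forall k, 1 + INR k * (y - 1) <= y ^ k.
  elim=> [|k IH]; first by rewrite /=; lra.
  rewrite S_INR -tech_pow_Rmult; have k0 := pos_INR k.
  have : 0 <= INR k * ((y - 1) * (y - 1)) by apply: Rmult_le_pos; nra.
  by nra.
have Yn : (INR n * (y - 1)) * (INR n * (y - 1)) <= (/ p) ^ n.
  have X0 : 0 <= INR n * (y - 1) by apply: Rmult_le_pos; lra.
  by rewrite -yy Rpow_mult_distr; have := B n => Bn; apply: Rmult_le_compat; lra.
have pn : 0 < p ^ n by apply: pow_lt; lra.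
have inv : (/ p) ^ n * p ^ n = 1 by rewrite -Rpow_mult_distr Rinv_l ?pow1 //; lra.
have D' : Rabs C = D * ((y - 1) * (y - 1)) by rewrite /D; field; lra.
have qn : 0 <= q ^ n <= p ^ n by split; [apply: pow_le | apply: pow_incr]; lra.
have cC := Rle_abs C; have c0 := Rabs_pos C.
apply: (Rle_trans _ (INR n.+1 * (Rabs C * p ^ n))).
  apply: Rmult_le_compat_l; first exact: pos_INR.
  apply: (Rle_trans _ (Rabs C * q ^ n)); first by apply: Rmult_le_compat_r; lra.
  by apply: Rmult_le_compat_l; lra.
rewrite S_INR D'.
have nD : 2 * D <= eps * INR n.
  have := Rmult_le_compat_l eps _ _ (Rlt_le _ _ e0) nb.
  by have -> : eps * (2 * D / eps) = 2 * D by field; lra.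
have Y0 : 0 < (y - 1) * (y - 1) by apply: Rmult_lt_0_compat; lra.
have K : INR n * INR n * ((y - 1) * (y - 1)) * p ^ n <= 1.
  apply: (Rle_trans _ ((/ p) ^ n * p ^ n)); last by rewrite inv; lra.
  by apply: Rmult_le_compat_r; lra.
have Z0 : 0 <= (y - 1) * (y - 1) * p ^ n by nra.
apply: (Rle_trans _ (2 * INR n * (D * ((y - 1) * (y - 1)) * p ^ n))).
  by apply: Rmult_le_compat_r; [rewrite Rmult_assoc; apply: Rmult_le_pos | lra].
apply: (Rle_trans _ (eps * INR n * (INR n * ((y - 1) * (y - 1)) * p ^ n))).
  have -> : 2 * INR n * (D * ((y - 1) * (y - 1)) * p ^ n) =
            (2 * D) * (INR n * ((y - 1) * (y - 1) * p ^ n)) by ring.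
  rewrite (Rmult_assoc (INR n)); apply: Rmult_le_compat_r => //.
  by apply: Rmult_le_pos; lra.
have -> : eps * INR n * (INR n * ((y - 1) * (y - 1)) * p ^ n) =
          eps * (INR n * INR n * ((y - 1) * (y - 1)) * p ^ n) by ring.
by nra.
Qed.

(** The peak is required to dominate [|h|], not [h], since odd powers of the
    integrand may be negative away from it. *)
Record peak (h h1 h2 : R -> R) (a b x0 : R) : Prop := Peak {
  peak_d1 : forall x, is_derive h x (h1 x);
  peak_d2 : forall x, is_derive h1 x (h2 x);
  peak_c2 : forall x, continuous h2 x;
  peak_in : a < x0 < b;
  peak_pos : 0 < h x0;
  peak_max : forall x, a <= x <= b -> x <> x0 -> Rabs (h x) < h x0
}.

Lemma peak_c0 h h1 h2 a b x0 : peak h h1 h2 a b x0 -> forall x : R, continuous h x.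
Proof. move=> pk x; apply: ex_derive_continuous; exists (h1 x); apply: (peak_d1 pk). Qed.

Lemma peak_c1 h h1 h2 a b x0 : peak h h1 h2 a b x0 -> forall x, continuous h1 x.
Proof. by move=> pk x; apply: ex_derive_continuous; exists (h2 x); apply: (peak_d2 pk). Qed.

Arguments peak_c0 {h h1 h2 a b x0} _ _.
Arguments peak_c1 {h h1 h2 a b x0} _ _.
Arguments peak_c2 {h h1 h2 a b x0} _ _.

(** [F] is a limit [n -> oo] restricted to exponents for which [h ^ n] is a
    nonnegative weight; for the spin model these are the [n] with [d * n] even. *)
Record weight_filter (h : R -> R) (F : (nat -> Prop) -> Prop) : Prop := WeightFilter {
  wf_filter : Filter F;
  wf_le : forall P, eventually P -> F P;
  wf_pos : F (fun n => forall x, 0 <= h x ^ n)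
}.

Definition wint (h : R -> R) (a b : R) (n : nat) (phi : R -> R) : R :=
  RInt (fun x => phi x * h x ^ n) a b.

Definition one : R -> R := fun=> 1.

Lemma wint_ex h h1 h2 a b x0 n (phi : R -> R) : peak h h1 h2 a b x0 ->
  (forall x : R, continuous phi x) -> ex_RInt (fun x => phi x * h x ^ n) a b.
Proof.
by move=> pk cphi; apply: ex_RInt_cont => t; have ch := peak_c0 pk t; cont.
Qed.

Lemma wint_lin h h1 h2 a b x0 n (phi psi : R -> R) c e : peak h h1 h2 a b x0 ->
  (forall x : R, continuous phi x) -> (forall x : R, continuous psi x) ->
  wint h a b n (fun x => c * phi x + e * psi x) =
  c * wint h a b n phi + e * wint h a b n psi.
Proof.
move=> pk cphi cpsi; apply: is_RInt_unique.
apply: (is_RInt_ext (fun x => c * (phi x * h x ^ n) + e * (psi x * h x ^ n))).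
  by move=> x _ /=; ring.
apply: (@is_RInt_plus R_NormedModule); apply: (@is_RInt_scal R_NormedModule);
  by apply: (@RInt_correct R_CompleteNormedModule); apply: (wint_ex _ pk).
Qed.

Lemma wint_le h h1 h2 a b x0 n (phi psi : R -> R) : peak h h1 h2 a b x0 ->
  (forall x : R, continuous phi x) -> (forall x : R, continuous psi x) ->
  (forall x, 0 <= h x ^ n) -> (forall x, a <= x <= b -> phi x <= psi x) ->
  wint h a b n phi <= wint h a b n psi.
Proof.
move=> pk cphi cpsi hn le; have ab := peak_in pk.
apply: RInt_le; [lra | exact: (wint_ex _ pk) | exact: (wint_ex _ pk) |].
by move=> x xab; apply: Rmult_le_compat_r => //; apply: le; lra.
Qed.

Lemma below3 (x y z : R) : 0 < x -> 0 < y -> 0 < z ->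
  exists2 e, 0 < e & [/\ e < x, e < y & e < z].
Proof.
move=> x0 y0 z0; have := Rmin_l x (Rmin y z); have := Rmin_r x (Rmin y z).
have := Rmin_l y z; have := Rmin_r y z.
have := Rmin_glb_lt _ _ _ x0 (Rmin_glb_lt _ _ _ y0 z0).
by exists (Rmin x (Rmin y z) / 2); [|split]; lra.
Qed.

Lemma wint_lower h h1 h2 a b x0 F r : peak h h1 h2 a b x0 -> weight_filter h F ->
  0 < r < h x0 -> exists2 c, 0 < c & F (fun n => c * r ^ n <= wint h a b n one).
Proof.
move=> pk [FF _ wp] rh; have ab := peak_in pk; have ch := peak_c0 pk.
have e0 : 0 < h x0 - r by lra.
have [[del d0] Hd] : locally x0 (fun x => r < h x).
  have rx : r < h x0 by lra.
  exact: (ch x0 _ (open_gt r (h x0) rx)).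
have [eta eta0 [eta1 eta2 eta3]] : exists2 e, 0 < e & [/\ e < del, e < x0 - a & e < b - x0].
  by apply: below3; lra.
exists (2 * eta); first lra.
apply: filter_imp wp => n hn.
have ex c e : ex_RInt (fun x => one x * h x ^ n) c e.
  by apply: ex_RInt_cont => t; have cht := ch t; cont.
have pos c e : c <= e -> 0 <= RInt (fun x => one x * h x ^ n) c e.
  by move=> ce; apply: RInt_ge_0 => // x _; rewrite Rmult_1_l.
rewrite /wint -(RInt_Chasles _ a (x0 - eta) b) // -(RInt_Chasles _ (x0 - eta) (x0 + eta) b) //.
rewrite /plus /=.
have -> : 2 * eta * r ^ n = RInt (fun=> r ^ n) (x0 - eta) (x0 + eta).
  by rewrite RInt_const /scal /= /mult /=; ring.
have p1 := pos a (x0 - eta); have p2 := pos (x0 + eta) b.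
have : RInt (fun=> r ^ n) (x0 - eta) (x0 + eta) <=
       RInt (fun x => one x * h x ^ n) (x0 - eta) (x0 + eta).
  apply: RInt_le => //; [lra | exact: ex_RInt_const |] => x xi.
  rewrite Rmult_1_l; apply: pow_incr; split; first lra.
  apply: Rlt_le; apply: Hd.
  rewrite /ball /= /AbsRing_ball /= /abs /minus /plus /opp /=.
  by apply: Rabs_def1; lra.
by lra.
Qed.

(** The powers of a constant below the height of the peak are exponentially small
    against the total weight, which absorbs the factor [n + 1] needed for
    fluctuations. *)
Lemma wint_tail h h1 h2 a b x0 F rho C eps : peak h h1 h2 a b x0 ->
  weight_filter h F -> 0 <= rho < h x0 -> 0 < eps ->
  F (fun n => INR n.+1 * (C * rho ^ n) <= eps * wint h a b n one).
Proof.
move=> pk wf rh e0; have FF := wf_filter wf.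
pose r := (rho + h x0) / 2.
have rr : rho < r < h x0 by rewrite /r; lra.
have r0 : 0 < r < h x0 by lra.
have [c c0 Hc] := wint_lower pk wf r0.
have q01 : 0 <= rho / r < 1.
  split; first by apply: Rdiv_le_0_compat; lra.
  by apply: (Rmult_lt_reg_r r); [lra | rewrite /Rdiv Rmult_assoc Rinv_l; lra].
have ec : 0 < eps * c by nra.
have E := wf_le wf (eventually_geometric C q01 ec).
apply: filter_imp (filter_and _ _ Hc E) => n [H1 H2].
have rn : 0 < r ^ n by apply: pow_lt; lra.
have : (rho / r) ^ n * r ^ n = rho ^ n.
  by rewrite -Rpow_mult_distr; congr (_ ^ _); field; lra.
move: (pow _ n) (pow rho n) H2 => X Y H2 XY; rewrite -XY.
apply: (Rle_trans _ (eps * c * r ^ n)); last by nra.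
have -> : INR n.+1 * (C * (X * r ^ n)) = (INR n.+1 * (C * X)) * r ^ n by ring.
by apply: Rmult_le_compat_r => //; lra.
Qed.

Lemma wint_gt0 h h1 h2 a b x0 F : peak h h1 h2 a b x0 ->
  weight_filter h F -> F (fun n => 0 < wint h a b n one).
Proof.
move=> pk wf; have FF := wf_filter wf.
have r0 : 0 < h x0 / 2 < h x0 by have := peak_pos pk; lra.
have [c c0] := wint_lower pk wf r0; apply: filter_imp => n.
by apply: Rlt_le_trans; apply: Rmult_lt_0_compat => //; apply: pow_lt; lra.
Qed.

Lemma max_abs (f : R -> R) (a b : R) : a <= b -> (forall x, continuous f x) ->
  exists2 z, a <= z <= b & forall x, a <= x <= b -> Rabs (f x) <= Rabs (f z).
Proof.
move=> ab cf.
have [z [H1 H2]] := continuity_ab_maj (fun x => Rabs (f x)) a b ab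
  (fun c _ => proj2 (continuity_pt_filterlim _ _) (cont_abs (cf c))).
by exists z.
Qed.

(** Outside a neighbourhood of the peak [wint_tail] applies, so that a comparison
    of test functions near the peak suffices, even after multiplication by [n]. *)
Lemma wint_local h h1 h2 a b x0 F (phi psi : R -> R) del eps : peak h h1 h2 a b x0 ->
  weight_filter h F ->
  (forall x : R, continuous phi x) -> (forall x : R, continuous psi x) ->
  (forall x, 0 <= psi x) -> 0 < del ->
  (forall x, Rabs (x - x0) < del -> Rabs (phi x) <= psi x) -> 0 < eps ->
  F (fun n => INR n.+1 * Rabs (wint h a b n phi) <=
              INR n.+1 * wint h a b n psi + eps * wint h a b n one).
Proof.
move=> pk wf cphi cpsi psi0 del0 near e0; have FF := wf_filter wf.
have ab := peak_in pk; have ch := peak_c0 pk.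
have [d d0 [d1 d2 d3]] : exists2 e, 0 < e & [/\ e < del, e < x0 - a & e < b - x0].
  by apply: below3; lra.
have [z1 z1i m1] : exists2 z, a <= z <= x0 - d &
    forall x, a <= x <= x0 - d -> Rabs (h x) <= Rabs (h z) by apply: max_abs; lra || auto.
have [z2 z2i m2] : exists2 z, x0 + d <= z <= b &
    forall x, x0 + d <= x <= b -> Rabs (h x) <= Rabs (h z) by apply: max_abs; lra || auto.
have [z3 _ m3] : exists2 z, a <= z <= b &
    forall x, a <= x <= b -> Rabs (phi x) <= Rabs (phi z) by apply: max_abs; lra || auto.
pose rho := Rmax (Rabs (h z1)) (Rabs (h z2)).
have rho1 : Rabs (h z1) <= rho by apply: Rmax_l.
have rho2 : Rabs (h z2) <= rho by apply: Rmax_r.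
have rh : 0 <= rho < h x0.
  split; first by apply: Rle_trans rho1; apply: Rabs_pos.
  by apply: Rmax_lub_lt; apply: (peak_max pk); lra.
pose C := Rabs (phi z3) * (b - a).
apply: filter_imp (filter_and _ _ (wf_pos wf) (wint_tail C pk wf rh e0)) => n [hn tl].
have cabs x : continuous (fun x : R => Rabs (phi x)) x by apply: cont_abs.
have hrn x : a <= x <= b -> d <= Rabs (x - x0) -> h x ^ n <= rho ^ n.
  move=> xab dx; rewrite -(Rabs_pos_eq _ (hn x)) -RPow_abs.
  apply: pow_incr; split; first exact: Rabs_pos.
  have [xl|xr] : x <= x0 - d \/ x0 + d <= x.
    by move: dx; rewrite /Rabs; case: Rcase_abs; lra.
  - by apply: Rle_trans rho1; apply: m1; lra.
  - by apply: Rle_trans rho2; apply: m2; lra.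
have le1 : Rabs (wint h a b n phi) <= wint h a b n psi + C * rho ^ n.
  have -> : C * rho ^ n = RInt (fun=> Rabs (phi z3) * rho ^ n) a b.
    by rewrite RInt_const /scal /= /mult /= /C; ring.
  have ex1 := wint_ex n pk cpsi.
  have ex2 := ex_RInt_const a b (Rabs (phi z3) * rho ^ n : R_NormedModule).
  have E := @RInt_plus R_CompleteNormedModule _ _ _ _ ex1 ex2.
  apply: (Rle_trans _ _ _ _ (Req_le _ _ E)).
  apply: Rle_trans (abs_RInt_le _ _ _ _ (wint_ex n pk cphi)) _; first lra.
  apply: RInt_le; [lra | | exact: (@ex_RInt_plus R_NormedModule) |].
    apply: (ex_RInt_ext (fun x => Rabs (phi x) * h x ^ n)).
      by move=> x _; rewrite Rabs_mult (Rabs_pos_eq _ (hn x)).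
    exact: (wint_ex n pk cabs).
  move=> x xab; rewrite Rabs_mult (Rabs_pos_eq _ (hn x)) /plus /=.
  have rn : 0 <= rho ^ n by apply: pow_le; lra.
  have p3 := Rabs_pos (phi z3); have hx := hn x; have px := psi0 x.
  case: (Rlt_le_dec (Rabs (x - x0)) d) => dx.
    have : Rabs (phi x) <= psi x by apply: near; lra.
    by nra.
  have q1 : Rabs (phi x) <= Rabs (phi z3) by apply: m3; lra.
  have q2 : h x ^ n <= rho ^ n by apply: hrn => //; lra.
  have q3 := Rabs_pos (phi x).
  have : Rabs (phi x) * h x ^ n <= Rabs (phi z3) * rho ^ n by apply: Rmult_le_compat.
  by nra.
apply: Rle_trans (Rmult_le_compat_l _ _ _ (pos_INR n.+1) le1) _.
by rewrite Rmult_plus_distr_l; lra.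
Qed.

Lemma flim_plus (T : Type) (F : (T -> Prop) -> Prop) {FF : Filter F} (f g : T -> R) (a b : R) :
  filterlim f F (locally a) -> filterlim g F (locally b) ->
  filterlim (fun x => f x + g x) F (locally (a + b)).
Proof.
move=> ff fg; exact: (filterlim_comp_2 _ _ _ ff fg (@filterlim_plus R_AbsRing R_NormedModule a b)).
Qed.

Lemma flim_mult (T : Type) (F : (T -> Prop) -> Prop) {FF : Filter F} (f g : T -> R) (a b : R) :
  filterlim f F (locally a) -> filterlim g F (locally b) ->
  filterlim (fun x => f x * g x) F (locally (a * b)).
Proof.
move=> ff fg; exact: (filterlim_comp_2 _ _ _ ff fg (@filterlim_mult R_AbsRing a b)).
Qed.

Lemma flim_opp (T : Type) (F : (T -> Prop) -> Prop) {FF : Filter F} (f : T -> R) (a : R) :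
  filterlim f F (locally a) -> filterlim (fun x => - f x) F (locally (- a)).
Proof.
move=> ff; exact: (filterlim_comp _ _ _ _ _ _ _ _ ff (@filterlim_opp R_AbsRing R_NormedModule a)).
Qed.

Lemma flim_minus (T : Type) (F : (T -> Prop) -> Prop) {FF : Filter F} (f g : T -> R) (a b : R) :
  filterlim f F (locally a) -> filterlim g F (locally b) ->
  filterlim (fun x => f x - g x) F (locally (a - b)).
Proof. by move=> ff fg; apply: flim_plus => //; apply: flim_opp. Qed.

Lemma flim_const (T : Type) (F : (T -> Prop) -> Prop) {FF : Filter F} (a : R) :
  filterlim (fun _ : T => a) F (locally a).
Proof. exact: filterlim_const. Qed.

Lemma flim_cont (T : Type) (F : (T -> Prop) -> Prop) (f : T -> R) (g : R -> R) (a : R) :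
  filterlim f F (locally a) -> continuous g a ->
  filterlim (fun x => g (f x)) F (locally (g a)).
Proof. by move=> ff cg; exact: (filterlim_comp _ _ _ _ _ _ _ _ ff cg). Qed.

Lemma flim_inv (T : Type) (F : (T -> Prop) -> Prop) (f : T -> R) (a : R) : a <> 0 ->
  filterlim f F (locally a) -> filterlim (fun x => / f x) F (locally (/ a)).
Proof.
move=> a0 ff; apply: (flim_cont ff); apply: ex_derive_continuous.
by auto_derive.
Qed.

Lemma flim_eq (T : Type) (F : (T -> Prop) -> Prop) {FF : Filter F} (f g : T -> R) (a b : R) :
  filterlim f F (locally a) -> F (fun x => f x = g x) -> a = b ->
  filterlim g F (locally b).
Proof. by move=> ff fg <-; apply: filterlim_ext_loc ff. Qed.

Lemma flim_inv_S (F : (nat -> Prop) -> Prop) {FF : Filter F} :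
  (forall P, eventually P -> F P) ->
  filterlim (fun n => / INR n.+1) F (locally 0).
Proof.
move=> Fe; apply/filterlim_R => eps e0; apply: Fe.
have [N HN] := INR_unbounded (/ eps); exists N => n nN.
have n1 : INR N <= INR n by apply: le_INR.
have n0 : 0 < INR n.+1 by apply: lt_0_INR; lia.
rewrite Rminus_0_r Rabs_pos_eq; last by apply: Rlt_le; apply: Rinv_0_lt_compat.
rewrite -(Rinv_inv eps); apply: Rinv_le_contravar; first exact: Rinv_0_lt_compat.
by rewrite S_INR; lra.
Qed.

Definition wmean (h : R -> R) (a b : R) (n : nat) (phi : R -> R) : R :=
  wint h a b n phi / wint h a b n one.

Lemma INR_S_ge1 (n : nat) : 1 <= INR n.+1.
Proof. by rewrite S_INR; have := pos_INR n; lra. Qed.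

Lemma cont_one (x : R) : continuous one x.
Proof. exact: continuous_const. Qed.
#[local] Hint Resolve cont_one : cont.

Lemma wmean_lim h h1 h2 a b x0 F (phi : R -> R) : peak h h1 h2 a b x0 ->
  weight_filter h F -> (forall x : R, continuous phi x) ->
  filterlim (fun n => wmean h a b n phi) F (locally (phi x0)).
Proof.
move=> pk wf cphi; have FF := wf_filter wf; apply/filterlim_R => eps e0.
have e2 : 0 < eps / 2 by lra.
have [[del d0] Hd] : locally x0 (fun x => Rabs (phi x - phi x0) <= eps / 2).
  by move/filterlim_R: (cphi x0); apply.
pose f (x : R) := 1 * phi x + - phi x0 * one x.
have cf : forall x : R, continuous f x by move=> x; rewrite /f; cont.
have cc : forall x : R, continuous (fun _ : R => eps / 2) x by move=> x; cont.
have near x : Rabs (x - x0) < del -> Rabs (f x) <= eps / 2.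
  move=> xd; have := Hd x xd; rewrite /f /one.
  by have -> : 1 * phi x + - phi x0 * 1 = phi x - phi x0 by ring.
have := wint_local pk wf cf cc (fun=> Rlt_le _ _ e2) d0 near e2.
move/filter_and => /(_ _ (wint_gt0 pk wf)); apply: filter_imp => n [].
rewrite (wint_lin n _ _ pk) //; last exact: cont_one.
have -> : wint h a b n (fun=> eps / 2) = eps / 2 * wint h a b n one.
  have -> : eps / 2 * wint h a b n one = eps / 2 * wint h a b n one + 0 * wint h a b n one by ring.
  by rewrite -(wint_lin n _ _ pk); [apply: RInt_ext => x _; rewrite /one /=; ring | |]; exact: cont_one.
rewrite /wmean; move: (wint _ _ _ _ one) (wint _ _ _ _ phi) => I J H I0.
have -> : J / I - phi x0 = (1 * J + - phi x0 * I) / I by field; lra.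
rewrite Rabs_div ?(Rabs_pos_eq I); try lra.
apply: (Rmult_le_reg_r I) => //; rewrite /Rdiv Rmult_assoc Rinv_l ?Rmult_1_r; last lra.
have n1 := INR_S_ge1 n; move: (Rabs _) H => A H.
apply: (Rmult_le_reg_l (INR n.+1)); first lra.
have eI : 0 < eps * I by apply: Rmult_lt_0_compat.
by nra.
Qed.

(** Integral of the derivative of [h ^ (n + 1) * h']. *)
Lemma wint_ibp2 h h1 h2 a b x0 n : peak h h1 h2 a b x0 ->
  INR n.+1 * wint h a b n (fun x => h1 x * h1 x) =
  h b ^ n.+1 * h1 b - h a ^ n.+1 * h1 a - wint h a b n (fun x => h x * h2 x).
Proof.
move=> pk; have ch := peak_c0 pk; have ch1 := peak_c1 pk; have ch2 := peak_c2 pk.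
have c11 : forall x : R, continuous (fun x : R => h1 x * h1 x) x by move=> x; cont.
have c02 : forall x : R, continuous (fun x : R => h x * h2 x) x by move=> x; cont.
pose g (x : R) := (INR n.+1 * (h1 x * h1 x) + 1 * (h x * h2 x)) * h x ^ n.
have H : is_RInt g a b (minus (h b ^ n.+1 * h1 b) (h a ^ n.+1 * h1 a)).
  apply: (@is_RInt_derive R_CompleteNormedModule (fun x => h x ^ n.+1 * h1 x)) => x _.
    have E : g x = plus (mult (INR n.+1 * h1 x * h x ^ n) (h1 x)) (mult (h x ^ n.+1) (h2 x)).
      by rewrite /g S_INR /plus /mult /=; ring.
    rewrite E; apply: is_derive_mult; [|exact: (peak_d2 pk)|by move=> *; apply: Rmult_comm].
    by have := is_derive_pow h n.+1 x (h1 x) (peak_d1 pk x); apply.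
  by rewrite /g; cont.
have := is_RInt_unique _ _ _ _ H.
have -> : RInt g a b = wint h a b n (fun x => INR n.+1 * (h1 x * h1 x) + 1 * (h x * h2 x)) by [].
by rewrite (wint_lin n _ _ pk) // /minus /plus /opp /=; lra.
Qed.

Lemma wint_ibp1 h h1 h2 a b x0 n : peak h h1 h2 a b x0 ->
  INR n.+1 * wint h a b n h1 = h b ^ n.+1 - h a ^ n.+1.
Proof.
move=> pk; have ch := peak_c0 pk; have ch1 := peak_c1 pk.
pose g (x : R) := (INR n.+1 * h1 x + 0 * one x) * h x ^ n.
have H : is_RInt g a b (minus (h b ^ n.+1) (h a ^ n.+1)).
  apply: (@is_RInt_derive R_CompleteNormedModule (fun x => h x ^ n.+1)) => x _.
    have -> : g x = INR n.+1 * h1 x * h x ^ n by rewrite /g; ring.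
    by have := is_derive_pow h n.+1 x (h1 x) (peak_d1 pk x); apply.
  by rewrite /g; cont.
have := is_RInt_unique _ _ _ _ H.
have -> : RInt g a b = wint h a b n (fun x => INR n.+1 * h1 x + 0 * one x) by [].
by rewrite (wint_lin n _ _ pk) // ?/minus /plus /opp /=; [lra | exact: cont_one].
Qed.

Lemma boundary_small h h1 h2 a b x0 F C eps : peak h h1 h2 a b x0 ->
  weight_filter h F -> 0 < eps ->
  F (fun n => Rabs (h a ^ n.+1) * C <= eps * wint h a b n one /\
              Rabs (h b ^ n.+1) * C <= eps * wint h a b n one).
Proof.
move=> pk wf e0; have FF := wf_filter wf; have ab := peak_in pk.
have aux z : a <= z <= b -> z <> x0 ->
    F (fun n => Rabs (h z ^ n.+1) * C <= eps * wint h a b n one).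
  move=> zab zx.
  have rh : 0 <= Rabs (h z) < h x0.
    by split; [apply: Rabs_pos | apply: (peak_max pk)].
  have := wint_tail (Rabs (h z) * Rabs C) pk wf rh e0.
  move/filter_and => /(_ _ (wint_gt0 pk wf)); apply: filter_imp => n [H I0].
  apply: Rle_trans H; rewrite -RPow_abs.
  have n1 := INR_S_ge1 n; have hz := Rabs_pos (h z); have cC := Rle_abs C.
  have pz : 0 <= Rabs (h z) ^ n by apply: pow_le.
  have c0 := Rabs_pos C.
  have q1 : 0 <= Rabs (h z) * Rabs (h z) ^ n by apply: Rmult_le_pos.
  have q2 : 0 <= Rabs (h z) * Rabs (h z) ^ n * Rabs C by apply: Rmult_le_pos.
  rewrite -tech_pow_Rmult.
  apply: (Rle_trans _ (Rabs (h z) * Rabs (h z) ^ n * Rabs C)); first by nra.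
  have -> : INR n.+1 * (Rabs (h z) * Rabs C * Rabs (h z) ^ n) =
            INR n.+1 * (Rabs (h z) * Rabs (h z) ^ n * Rabs C) by ring.
  by nra.
by apply: filter_and; apply: aux; lra.
Qed.

Lemma wmean_d1_sqr h h1 h2 a b x0 F : peak h h1 h2 a b x0 ->
  weight_filter h F ->
  filterlim (fun n => INR n.+1 * wmean h a b n (fun x => h1 x * h1 x)) F
            (locally (- (h x0 * h2 x0))).
Proof.
move=> pk wf; have FF := wf_filter wf.
have ch := peak_c0 pk; have ch1 := peak_c1 pk; have ch2 := peak_c2 pk.
have c02 : forall x : R, continuous (fun x : R => h x * h2 x) x by move=> x; cont.
have bd : filterlim (fun n => (h b ^ n.+1 * h1 b - h a ^ n.+1 * h1 a) / wint h a b n one)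
                    F (locally 0).
  apply/filterlim_R => eps e0; have e2 : 0 < eps / 2 by lra.
  have H := boundary_small (Rabs (h1 a) + Rabs (h1 b)) pk wf e2.
  apply: filter_imp (filter_and _ _ H (wint_gt0 pk wf)) => n [[Ha Hb] I0].
  rewrite Rminus_0_r Rabs_div ?(Rabs_pos_eq (wint _ _ _ _ _)); try lra.
  apply: (Rmult_le_reg_r (wint h a b n one)) => //.
  rewrite /Rdiv Rmult_assoc Rinv_l ?Rmult_1_r; last lra.
  apply: Rle_trans (Rabs_triang _ _) _; rewrite Rabs_Ropp (Rabs_mult _ (h1 a)) (Rabs_mult _ (h1 b)).
  have p1 := Rabs_pos (h a ^ n.+1); have p2 := Rabs_pos (h b ^ n.+1).
  have p3 := Rabs_pos (h1 a); have p4 := Rabs_pos (h1 b).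
  have := Rmult_le_pos _ _ p1 p4; have := Rmult_le_pos _ _ p2 p3. lra.
pose proof (flim_minus bd (wmean_lim pk wf c02)) as H.
apply: (flim_eq H); last by ring.
apply: filter_imp (wint_gt0 pk wf) => n I0.
rewrite /wmean; have := wint_ibp2 n pk => E.
have -> : INR n.+1 * (wint h a b n (fun x => h1 x * h1 x) / wint h a b n one) =
  (INR n.+1 * wint h a b n (fun x => h1 x * h1 x)) / wint h a b n one by rewrite /Rdiv; ring.
by rewrite E; field; lra.
Qed.

(** The derivative of [h] is the natural coordinate at the peak: a test function
    vanishing there to second order is compared with its square, whose mean is
    computed exactly by integration by parts. *)
Lemma wmean_order2 h h1 h2 a b x0 F (phi : R -> R) c : peak h h1 h2 a b x0 ->
  weight_filter h F -> (forall x : R, continuous phi x) ->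
  (forall eps, 0 < eps -> exists2 del, 0 < del &
     forall x, Rabs (x - x0) < del ->
       Rabs (phi x - c * (h1 x * h1 x)) <= eps * (h1 x * h1 x)) ->
  filterlim (fun n => INR n.+1 * wmean h a b n phi) F
            (locally (c * - (h x0 * h2 x0))).
Proof.
move=> pk wf cphi near; have FF := wf_filter wf.
have ch1 := peak_c1 pk.
have c11 : forall x : R, continuous (fun x : R => h1 x * h1 x) x by move=> x; cont.
have L := wmean_d1_sqr pk wf.
set K := - (h x0 * h2 x0).
have K0 : 0 < Rabs K + 2 by have := Rabs_pos K; lra.
pose f (x : R) := 1 * phi x + - c * (h1 x * h1 x).
have cf : forall x : R, continuous f x by move=> x; rewrite /f; cont.
have small : filterlim (fun n => INR n.+1 * wmean h a b n f) F (locally 0).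
  apply/filterlim_R => eps e0.
  have e1 : 0 < eps / (Rabs K + 2) by apply: Rdiv_lt_0_compat.
  set e := eps / _ in e1; have Ee : e * (Rabs K + 2) = eps by rewrite /e; field; lra.
  have [del d0 nr] := near e e1.
  have cpsi : forall x : R, continuous (fun x : R => e * (h1 x * h1 x)) x by move=> x; cont.
  have psi0 x : 0 <= e * (h1 x * h1 x) by apply: Rmult_le_pos; [lra | nra].
  have nr' x : Rabs (x - x0) < del -> Rabs (f x) <= e * (h1 x * h1 x).
    move=> xd; have := nr x xd; rewrite /f.
    by have -> : 1 * phi x + - c * (h1 x * h1 x) = phi x - c * (h1 x * h1 x) by ring.
  have W := wint_local pk wf cf cpsi psi0 d0 nr' e1.
  have [L' _] := filterlim_R FF (fun n => INR n.+1 * wmean h a b n (fun x => h1 x * h1 x)) K.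
  have {}L' := L' L 1 Rlt_0_1.
  apply: filter_imp (filter_and _ _ (filter_and _ _ W L') (wint_gt0 pk wf)) => n [[H1 H2] I0].
  have E : wint h a b n (fun x => e * (h1 x * h1 x)) = e * wint h a b n (fun x => h1 x * h1 x).
    have -> : e * wint h a b n (fun x => h1 x * h1 x) =
       e * wint h a b n (fun x => h1 x * h1 x) + 0 * wint h a b n one by ring.
    rewrite -(wint_lin n _ _ pk) //; last exact: cont_one.
    by apply: RInt_ext => x _ /=; ring.
  rewrite E in H1; rewrite Rminus_0_r /wmean.
  have n1 := INR_S_ge1 n.
  rewrite Rabs_mult Rabs_div ?(Rabs_pos_eq (wint h a b n one)) ?(Rabs_pos_eq (INR n.+1)); try lra.
  apply: (Rmult_le_reg_r (wint h a b n one)) => //.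
  have -> : INR n.+1 * (Rabs (wint h a b n f) / wint h a b n one) * wint h a b n one =
            INR n.+1 * Rabs (wint h a b n f) by field; lra.
  apply: Rle_trans H1 _; rewrite -Ee.
  have : INR n.+1 * wmean h a b n (fun x => h1 x * h1 x) <= Rabs K + 1.
    by have := Rle_abs K; move: H2; rewrite /Rabs; do 2 (case: Rcase_abs => ?); lra.
  rewrite /wmean => H3.
  have {}H3 : INR n.+1 * wint h a b n (fun x => h1 x * h1 x) <= (Rabs K + 1) * wint h a b n one.
    have := Rmult_le_compat_r _ _ _ (Rlt_le _ _ I0) H3.
    have -> // : INR n.+1 * (wint h a b n (fun x => h1 x * h1 x) / wint h a b n one) * wint h a b n one = INR n.+1 * wint h a b n (fun x => h1 x * h1 x) by field; lra.
  have := Rmult_le_compat_l _ _ _ (Rlt_le _ _ e1) H3.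
  by lra.
pose proof (flim_plus small (flim_mult (@flim_const _ F FF c) L)) as H.
apply: (flim_eq H); last by rewrite -/K; ring.
apply: filter_imp (wint_gt0 pk wf) => n I0.
rewrite /wmean (wint_lin n _ _ pk) //; field; lra.
Qed.

(** The Cauchy-Schwarz inequality for the weight [h ^ n]. *)
Lemma wmean_sqr h h1 h2 a b x0 n (f : R -> R) : peak h h1 h2 a b x0 ->
  (forall x : R, continuous f x) -> (forall x, 0 <= h x ^ n) -> 0 < wint h a b n one ->
  wmean h a b n f * wmean h a b n f <= wmean h a b n (fun x => f x * f x).
Proof.
move=> pk cf hn I0.
have cff : forall x : R, continuous (fun x : R => f x * f x) x by move=> x; cont.
have [t E] : exists t, t = wmean h a b n f by eexists.
have Ef : wint h a b n f = t * wint h a b n one by rewrite E /wmean; field; lra.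
have c1 : forall x : R, continuous (fun x : R => (- (t * t)) * one x + 0 * one x) x.
  by move=> x; cont.
have c2 : forall x : R, continuous (fun x : R => 1 * (f x * f x) + (- (2 * t)) * f x) x.
  by move=> x; cont.
have H : wint h a b n (fun x => (- (t * t)) * one x + 0 * one x) <=
         wint h a b n (fun x => 1 * (f x * f x) + (- (2 * t)) * f x).
  apply: (wint_le pk) => // x _.
  have : 0 <= (f x - t) * (f x - t) by apply: Rle_0_sqr.
  by rewrite /one; lra.
rewrite !(wint_lin n _ _ pk) // in H; try exact: cont_one.
rewrite Ef in H; rewrite -E /wmean.
apply: (Rmult_le_reg_r (wint h a b n one)) => //.
rewrite /Rdiv Rmult_assoc (Rmult_assoc _ (/ _)) Rinv_l ?Rmult_1_r; last lra.
by lra.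
Qed.

(** At first order the mean of [h'] itself is a boundary term, and the remainder
    is handled by the Cauchy-Schwarz inequality. *)
Lemma wmean_order1 h h1 h2 a b x0 F (phi : R -> R) c : peak h h1 h2 a b x0 ->
  weight_filter h F -> (forall x : R, continuous phi x) ->
  (forall eps, 0 < eps -> exists2 del, 0 < del &
     forall x, Rabs (x - x0) < del ->
       Rabs (phi x - c * h1 x) <= eps * Rabs (h1 x)) ->
  filterlim (fun n => INR n.+1 * (wmean h a b n phi * wmean h a b n phi)) F (locally 0).
Proof.
move=> pk wf cphi near; have FF := wf_filter wf.
have ch1 := peak_c1 pk.
pose f (x : R) := 1 * phi x + - c * h1 x.
have cf : forall x : R, continuous f x by move=> x; rewrite /f; cont.
have cff : forall x : R, continuous (fun x : R => f x * f x) x by move=> x; cont.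
have L2 : filterlim (fun n => INR n.+1 * wmean h a b n (fun x => f x * f x)) F (locally 0).
  have -> : 0 = 0 * - (h x0 * h2 x0) by ring.
  apply: (wmean_order2 pk wf cff) => eps e0.
  have e1 : 0 < Rmin eps 1 by apply: Rmin_glb_lt; lra.
  have [del d0 nr] := near _ e1; exists del => // x xd.
  have := nr x xd; have -> : phi x - c * h1 x = f x by rewrite /f; ring.
  move=> Hf; have -> : f x * f x - 0 * (h1 x * h1 x) = f x * f x by ring.
  rewrite Rabs_pos_eq; last by nra.
  have -> : f x * f x = Rabs (f x) * Rabs (f x) by rewrite -Rabs_mult Rabs_pos_eq //; nra.
  have -> : h1 x * h1 x = Rabs (h1 x) * Rabs (h1 x) by rewrite -Rabs_mult Rabs_pos_eq //; nra.
  have p1 := Rabs_pos (f x); have p2 := Rabs_pos (h1 x).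
  have m1 := Rmin_l eps 1; have m2 := Rmin_r eps 1.
  move: (Rmin _ _) e1 Hf m1 m2 => e e1 Hf m1 m2.
  have : Rabs (f x) * Rabs (f x) <= (e * Rabs (h1 x)) * (e * Rabs (h1 x)).
    by apply: Rmult_le_compat.
  have : e * e <= eps by nra.
  have : 0 <= Rabs (h1 x) * Rabs (h1 x) by nra.
  by nra.
have L1 : filterlim (fun n => INR n.+1 * wmean h a b n h1) F (locally 0).
  apply/filterlim_R => eps e0; have e2 : 0 < eps / 2 by lra.
  apply: filter_imp (filter_and _ _ (boundary_small 1 pk wf e2) (wint_gt0 pk wf)) => n [[Ha Hb] I0].
  have -> : INR n.+1 * wmean h a b n h1 - 0 = (INR n.+1 * wint h a b n h1) / wint h a b n one.
    by rewrite /wmean /Rdiv; ring.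
  rewrite (wint_ibp1 n pk) Rabs_div ?(Rabs_pos_eq (wint h a b n one)); try lra.
  apply: (Rmult_le_reg_r (wint h a b n one)) => //.
  rewrite /Rdiv Rmult_assoc Rinv_l ?Rmult_1_r; last lra.
  by apply: Rle_trans (Rabs_triang _ _) _; rewrite Rabs_Ropp; lra.
have L1' : filterlim (fun n => (INR n.+1 * wmean h a b n h1) * wmean h a b n h1) F (locally 0).
  by pose proof (flim_mult L1 (wmean_lim pk wf ch1)) as H; rewrite Rmult_0_l in H.
pose proof (flim_plus (flim_mult (@flim_const _ F FF 2) L2)
                    (flim_mult (@flim_const _ F FF (2 * c * c)) L1')) as B.
have B0 : 2 * 0 + 2 * c * c * 0 = 0 by ring.
rewrite {}B0 in B.
apply/filterlim_R => eps e0.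
have B' := proj1 (@filterlim_R _ F FF _ 0) B eps e0.
apply: filter_imp (filter_and _ _ (filter_and _ _ B' (wint_gt0 pk wf)) (wf_pos wf)) => n [[H I0] hn].
have n1 := INR_S_ge1 n.
have CS := wmean_sqr pk cf hn I0.
have E : wmean h a b n phi = wmean h a b n f + c * wmean h a b n h1.
  by rewrite /wmean (wint_lin n _ _ pk) //; field; lra.
rewrite Rminus_0_r Rabs_pos_eq; last first.
  by apply: Rmult_le_pos; [lra | nra].
have := Rle_abs (2 * (INR n.+1 * wmean h a b n (fun x => f x * f x)) +
   2 * c * c * (INR n.+1 * wmean h a b n h1 * wmean h a b n h1)).
move: H; rewrite Rminus_0_r => H H'.
apply: Rle_trans (Rle_trans _ _ _ H' H); rewrite E.
move: (wmean h a b n f) (wmean h a b n h1) CS => p q CS.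
have : (p + c * q) * (p + c * q) <= 2 * (p * p) + 2 * c * c * (q * q).
  have : 0 <= (p - c * q) * (p - c * q) by apply: Rle_0_sqr.
  by lra.
move=> Hpq; apply: (Rle_trans _ (INR n.+1 * (2 * wmean h a b n (fun x => f x * f x) + 2 * c * c * (q * q)))).
  by apply: Rmult_le_compat_l; lra.
by lra.
Qed.

Lemma wint_pressure h h1 h2 a b x0 F : peak h h1 h2 a b x0 ->
  weight_filter h F ->
  filterlim (fun n => / INR n * ln (wint h a b n one)) F (locally (ln (h x0))).
Proof.
move=> pk wf; have FF := wf_filter wf; have ab := peak_in pk; have h0 := peak_pos pk.
apply/filterlim_R => eps e0.
pose r := h x0 * exp (- (eps / 2)).
have ex1 : 0 < exp (- (eps / 2)) < 1.
  by split; [apply: exp_pos | rewrite -exp_0; apply: exp_increasing; lra].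
have r0 : 0 < r < h x0 by rewrite /r; nra.
have [c c0 Hc] := wint_lower pk wf r0.
have [N HN] := INR_unbounded (2 / eps * (Rabs (ln c) + Rabs (ln (b - a)))).
have big : F (fun n => (N <= n)%coq_nat /\ (1 <= n)%coq_nat).
  by apply: (wf_le wf); exists (S N) => n Hn; lia.
apply: filter_imp (filter_and _ _ (filter_and _ _ big Hc) (wf_pos wf)) => n [[[nN n1] lo] hn].
have n0 : 0 < INR n by apply: lt_0_INR; lia.
have rn : 0 < r ^ n by apply: pow_lt; lra.
have I0 : 0 < wint h a b n one by apply: Rlt_le_trans lo; apply: Rmult_lt_0_compat.
have up : wint h a b n one <= (b - a) * h x0 ^ n.
  have -> : (b - a) * h x0 ^ n = RInt (fun=> h x0 ^ n) a b.
    by rewrite RInt_const /scal /= /mult /=; ring.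
  apply: RInt_le; [lra | exact: (wint_ex n pk cont_one) | exact: ex_RInt_const |].
  move=> x xab; rewrite Rmult_1_l -(Rabs_pos_eq _ (hn x)) -RPow_abs.
  apply: pow_incr; split; first exact: Rabs_pos.
  case: (Req_dec x x0) => [->|xx]; first by rewrite Rabs_pos_eq; lra.
  by apply: Rlt_le; apply: (peak_max pk); lra.
have hxn : 0 < h x0 ^ n by apply: pow_lt.
have lup : ln (wint h a b n one) <= ln (b - a) + INR n * ln (h x0).
  rewrite -ln_pow // -ln_mult //; last by lra.
  by apply: ln_le.
have llo : ln c + INR n * (ln (h x0) - eps / 2) <= ln (wint h a b n one).
  have -> : ln (h x0) - eps / 2 = ln r.
    by rewrite /r ln_mult ?ln_exp //; lra.
  rewrite -ln_pow -?ln_mult //; try lra.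
  by apply: ln_le => //; apply: Rmult_lt_0_compat.
have big2 : Rabs (ln c) + Rabs (ln (b - a)) <= eps / 2 * INR n.
  have : INR N <= INR n by apply: le_INR.
  move=> H; have {}H : 2 / eps * (Rabs (ln c) + Rabs (ln (b - a))) <= INR n by lra.
  have := Rmult_le_compat_l (eps / 2) _ _ _ H.
  have -> : eps / 2 * (2 / eps * (Rabs (ln c) + Rabs (ln (b - a)))) =
       Rabs (ln c) + Rabs (ln (b - a)) by field; lra.
  by apply; lra.
have p1 := Rabs_pos (ln c); have p2 := Rabs_pos (ln (b - a)).
have p3 := Rle_abs (ln (b - a)); have p4 := Rle_abs (- ln c).
rewrite Rabs_Ropp in p4.
have -> : / INR n * ln (wint h a b n one) - ln (h x0) =
   (ln (wint h a b n one) - INR n * ln (h x0)) / INR n by field; lra.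
rewrite Rabs_div ?(Rabs_pos_eq (INR n)); try lra.
apply: (Rmult_le_reg_r (INR n)) => //.
rewrite /Rdiv Rmult_assoc Rinv_l ?Rmult_1_r; last lra.
have en : 0 < eps * INR n by apply: Rmult_lt_0_compat.
by apply: Rabs_le; lra.
Qed.

(** * The dominant angle *)

Lemma pow_lt_compat (x y : R) (n : nat) : 0 <= x < y -> x ^ n.+1 < y ^ n.+1.
Proof.
move=> xy; elim: n => [|n IH]; first by rewrite !pow_1; lra.
have p := pow_le x n.+1; rewrite -(tech_pow_Rmult x) -(tech_pow_Rmult y).
by apply: Rmult_le_0_lt_compat; lra || (apply: p; lra) || exact: IH.
Qed.

(** In the coordinate [r = sqrt T * tan t] of the angle, the logarithmic derivative
    of the integrand has this sign, by [log_profile_derive]. *)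
Definition balance (K : nat) (T B r : R) : R :=
  exp B * (1 + r) ^ K * (T - r) - exp (- B) * (1 - r) ^ K * (T + r).

Record equilibrium (K : nat) (T B s : R) : Prop := Equilibrium {
  eq_in : 0 < s < T;
  eq_zero : balance K T B s = 0;
  eq_below : forall r, 0 <= r < s -> 0 < balance K T B r;
  eq_above : forall r, s < r <= 1 -> balance K T B r < 0
}.

(** A point with coordinates [x] and [x * r] contributes
    [x ^ K.+1 * slope_weight K B r] to the integrand. *)
Definition slope_weight (K : nat) (B r : R) : R :=
  exp B * (1 + r) ^ K.+1 + exp (- B) * (1 - r) ^ K.+1.

Definition log_profile (K : nat) (T B r : R) : R :=
  ln (slope_weight K B r) - INR K.+1 / 2 * ln (1 + r * r / T).

(** At a zero of [balance] both terms of the integrand are rational in [T] and [s],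
    up to a common factor. *)
Lemma balance_factor (K : nat) (T B s : R) : 0 < s < T -> s < 1 -> balance K T B s = 0 ->
  exists2 lam, 0 < lam &
    exp B * (1 + s) ^ K = lam / (T - s) /\ exp (- B) * (1 - s) ^ K = lam / (T + s).
Proof.
move=> sT s1 b0; exists (exp B * (1 + s) ^ K * (T - s)).
  apply: Rmult_lt_0_compat; last lra.
  by apply: Rmult_lt_0_compat; [apply: exp_pos | apply: pow_lt; lra].
split; first by field; lra.
have -> : exp B * (1 + s) ^ K * (T - s) = exp (- B) * (1 - s) ^ K * (T + s).
  by move: b0; rewrite /balance; lra.
by field; lra.
Qed.

Lemma slope_weight_gt0 (K : nat) (B r : R) : 0 <= r <= 1 -> 0 < slope_weight K B r.
Proof.
move=> r01; apply: Rplus_lt_le_0_compat.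
  by apply: Rmult_lt_0_compat; [apply: exp_pos | apply: pow_lt; lra].
by apply: Rmult_le_pos; [apply: Rlt_le; apply: exp_pos | apply: pow_le; lra].
Qed.

Lemma log_profile_derive (K : nat) (T B r : R) : 0 < T -> 0 <= r <= 1 ->
  is_derive (log_profile K T B) r
    (INR K.+1 * balance K T B r / (slope_weight K B r * (T + r * r))).
Proof.
move=> T0 r01; have W0 := slope_weight_gt0 K B r01.
have q0 : 0 < 1 + r * r / T.
  have := Rdiv_le_0_compat (r * r) T (Rle_0_sqr r) T0; lra.
have q1 : 0 < T + r * r by have := Rle_0_sqr r; rewrite /Rsqr; lra.
rewrite /log_profile /slope_weight; rewrite /slope_weight in W0.
auto_derive; first by repeat split; try lra.
rewrite -/(INR K.+1) /balance -!tech_pow_Rmult; rewrite -!tech_pow_Rmult in W0.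
rewrite -!/(1 - r).
move: (INR _) => k; move: ((1 + r) ^ K) ((1 - r) ^ K) W0 => X Y W0.
by field; lra.
Qed.

Lemma log_profile_max (K : nat) (T B s r : R) : T < 1 -> equilibrium K T B s ->
  0 <= r <= 1 -> r <> s -> log_profile K T B r < log_profile K T B s.
Proof.
move=> T1 eq r01 rs; have sT := eq_in eq; have T0 : 0 < T by lra.
have pos c : 0 <= c <= 1 -> 0 < INR K.+1 / (slope_weight K B c * (T + c * c)).
  move=> c01; apply: Rdiv_lt_0_compat; first by apply: lt_0_INR; lia.
  apply: Rmult_lt_0_compat; first exact: slope_weight_gt0.
  by have := Rle_0_sqr c; rewrite /Rsqr; lra.
have D c : 0 <= c <= 1 -> derivable_pt_lim (log_profile K T B) c
    (INR K.+1 / (slope_weight K B c * (T + c * c)) * balance K T B c).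
  move=> c01; apply/is_derive_Reals.
  have -> : INR K.+1 / (slope_weight K B c * (T + c * c)) * balance K T B c =
    INR K.+1 * balance K T B c / (slope_weight K B c * (T + c * c)) by rewrite /Rdiv; ring.
  exact: log_profile_derive.
have [lt|gt] : r < s \/ s < r by lra.
  have [c [E ci]] := MVT_cor2 _ _ r s lt (fun c (H : r <= c <= s) => D c ltac:(lra)).
  have c01 : 0 <= c <= 1 by lra.
  have b0 : 0 < balance K T B c by apply: (eq_below eq); lra.
  have := Rmult_lt_0_compat _ _ (Rmult_lt_0_compat _ _ (pos c c01) b0) (_ : 0 < s - r).
  by rewrite -E; lra.
have [c [E ci]] := MVT_cor2 _ _ s r gt (fun c (H : s <= c <= r) => D c ltac:(lra)).
have c01 : 0 <= c <= 1 by lra.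
have b0 : 0 < - balance K T B c by have := @eq_above _ _ _ _ eq c; lra.
have := Rmult_lt_0_compat _ _ (Rmult_lt_0_compat _ _ (pos c c01) b0) (_ : 0 < r - s).
by lra.
Qed.

(** A bound of the absolute value of the integrand in terms of [x = ca * cos t] and
    [y = |cb * sin t|], which leaves one quadrant to search for the maximum. *)
Definition folded (K : nat) (B x y : R) : R :=
  exp B * (x + y) ^ K.+1 + exp (- B) * Rabs (x - y) ^ K.+1.

(** As [T < 1], the ellipse is longer in the direction of [x], so a point with
    [x < y] is improved by exchanging its coordinates; where [y <= x] the slope
    [r = y / x] lies in [[0, 1]] and [log_profile] has its maximum at [s]. *)
Lemma folded_max (K : nat) (T B s ca x y : R) : T < 1 -> equilibrium K T B s ->
  0 < ca -> 0 <= x -> 0 <= y -> x * x + y * y / T = ca * ca ->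
  folded K B x y <= exp (INR K.+1 * ln ca + log_profile K T B s) /\
  (folded K B x y = exp (INR K.+1 * ln ca + log_profile K T B s) -> y = s * x).
Proof.
move=> T1 eq ca0 x0 y0 xy; have sT := eq_in eq; have T0 : 0 < T by lra.
(* Up to an exchange of coordinates every point is [m * (1, r)] with [r <= 1]. *)
have main m r : 0 < m -> 0 <= r <= 1 -> m * m * (1 + r * r / T) <= ca * ca ->
    m ^ K.+1 * slope_weight K B r <= exp (INR K.+1 * ln ca + log_profile K T B r).
  move=> m0 r01 mr; have W0 := slope_weight_gt0 K B r01.
  have q0 : 0 < 1 + r * r / T.
    have := Rdiv_le_0_compat (r * r) T (Rle_0_sqr r) T0; lra.
  have mn0 : 0 < m ^ K.+1 by apply: pow_lt.
  rewrite -(exp_ln (m ^ K.+1 * _)); last by apply: Rmult_lt_0_compat.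
  rewrite ln_mult // ln_pow // /log_profile.
  have : ln (m * m * (1 + r * r / T)) <= ln (ca * ca).
    by apply: ln_le => //; apply: Rmult_lt_0_compat => //; apply: Rmult_lt_0_compat.
  rewrite !ln_mult //; last by apply: Rmult_lt_0_compat.
  have k0 := pos_INR K.+1.
  move=> H; have {}H := Rmult_le_compat_l _ _ _ k0 H.
  case: (Req_dec (INR K.+1 * ln m + ln (slope_weight K B r))
     (INR K.+1 * ln ca + (ln (slope_weight K B r) - INR K.+1 / 2 * ln (1 + r * r / T)))) => [->|ne].
    by lra.
  by apply: Rlt_le; apply: exp_increasing; lra.
have upto r : 0 <= r <= 1 -> r <> s -> exp (INR K.+1 * ln ca + log_profile K T B r) <
    exp (INR K.+1 * ln ca + log_profile K T B s).
  by move=> r01 rs; apply: exp_increasing; have := log_profile_max T1 eq r01 rs; lra.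
have [yx|xy'] := Rle_lt_dec y x.
  have x1 : 0 < x.
    case: (Rle_lt_or_eq_dec _ _ x0) => // x00.
    have y00 : y = 0 by lra.
    by move: xy; rewrite -x00 y00 /Rdiv !Rmult_0_l Rplus_0_r; nra.
  pose r := y / x.
  have yr : y = x * r by rewrite /r; field; lra.
  have r01 : 0 <= r <= 1.
    split; first exact: Rdiv_le_0_compat.
    by apply: (Rmult_le_reg_l x) => //; rewrite -yr; lra.
  have E : folded K B x y = x ^ K.+1 * slope_weight K B r.
    rewrite /folded yr Rabs_pos_eq; last by nra.
    have -> : x + x * r = x * (1 + r) by ring.
    have -> : x - x * r = x * (1 - r) by ring.
    by rewrite !Rpow_mult_distr /slope_weight; ring.
  have M : x ^ K.+1 * slope_weight K B r <= exp (INR K.+1 * ln ca + log_profile K T B r).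
    by apply: main => //; rewrite -xy yr; apply: Req_le; field; lra.
  case: (Req_dec r s) => [rs|rs].
    by rewrite E; split; [rewrite -rs | move=> _; rewrite yr rs; ring].
  by have := upto r r01 rs; rewrite E; lra.
have y1 : 0 < y by lra.
pose r := x / y.
have xr : x = y * r by rewrite /r; field; lra.
have r01 : 0 <= r < 1.
  split; first exact: Rdiv_le_0_compat.
  by apply: (Rmult_lt_reg_l y) => //; rewrite -xr; lra.
have r01' : 0 <= r <= 1 by lra.
have E : folded K B x y = y ^ K.+1 * slope_weight K B r.
  rewrite /folded xr Rabs_minus_sym Rabs_pos_eq; last by nra.
  have -> : y * r + y = y * (1 + r) by ring.
  have -> : y - y * r = y * (1 - r) by ring.
  by rewrite !Rpow_mult_distr /slope_weight; ring.
have iT : 1 < / T by rewrite -Rinv_1; apply: Rinv_lt_contravar; lra.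
have yy : 0 < y * y by nra.
have lt : y * y * (1 + r * r / T) < ca * ca.
  rewrite -xy xr /Rdiv.
  have : 0 < (y * y) * ((/ T - 1) * (1 - r * r)).
    apply: Rmult_lt_0_compat => //; apply: Rmult_lt_0_compat; first lra.
    by nra.
  by lra.
(* The exchanged point is strictly inside the ellipse and can be moved outwards. *)
have q0 : 0 < 1 + r * r / T.
  have := Rdiv_le_0_compat (r * r) T (Rle_0_sqr r) T0; lra.
have M := main y r y1 r01' (Rlt_le _ _ lt).
suff : folded K B x y < exp (INR K.+1 * ln ca + log_profile K T B s) by lra.
case: (Req_dec r s) => [rs|rs]; last by have := upto r r01' rs; rewrite E; lra.
rewrite E; pose m := ca / sqrt (1 + r * r / T).
have sq0 : 0 < sqrt (1 + r * r / T) by apply: sqrt_lt_R0.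
have sq2 : sqrt (1 + r * r / T) * sqrt (1 + r * r / T) = 1 + r * r / T by apply: sqrt_sqrt; lra.
have m0 : 0 < m by apply: Rdiv_lt_0_compat.
have mm : m * m * (1 + r * r / T) = ca * ca by rewrite -sq2 /m; field; lra.
have ym : y < m.
  apply: Rsqr_incrst_0; [rewrite /Rsqr | lra | lra].
  by apply: (Rmult_lt_reg_r (1 + r * r / T)) => //; rewrite mm.
apply: (Rlt_le_trans _ (m ^ K.+1 * slope_weight K B r)).
  apply: Rmult_lt_compat_r; first exact: slope_weight_gt0.
  by apply: pow_lt_compat; lra.
by rewrite -rs; apply: main => //; lra.
Qed.

Definition integrand1 (K : nat) (u v : R * R) (B t : R) : R :=
  INR K.+1 * (exp B * (wave u t ^ K * wave (snd u, - fst u) t) +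
              exp (- B) * (wave v t ^ K * wave (snd v, - fst v) t)).

Definition integrand2 (K : nat) (u v : R * R) (B t : R) : R :=
  INR K.+1 *
   (exp B * (INR K * wave u t ^ K.-1 * wave (snd u, - fst u) t ^ 2 - wave u t ^ K.+1) +
    exp (- B) * (INR K * wave v t ^ K.-1 * wave (snd v, - fst v) t ^ 2 - wave v t ^ K.+1)).

Lemma integrand_derive (K : nat) (u v : R * R) (B t : R) :
  is_derive (integrand K.+1 u v B) t (integrand1 K u v B t).
Proof.
rewrite /integrand /integrand1.
have aux w : is_derive (fun t => wave w t ^ K.+1) t
    (INR K.+1 * (wave w t ^ K * wave (snd w, - fst w) t)).
  have := is_derive_pow (wave w) K.+1 t _ (wave_derive w t).
  by have -> : INR K.+1 * wave (snd w, - fst w) t * wave w t ^ K.+1.-1 =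
     INR K.+1 * (wave w t ^ K * wave (snd w, - fst w) t) by rewrite [K.+1.-1]/=; ring.
evar_last.
  apply: (@is_derive_plus R_AbsRing R_NormedModule).
    by apply: is_derive_scal; apply: aux.
  by apply: is_derive_scal; apply: aux.
by rewrite /plus /=; move: (INR _) => k; ring.
Qed.

Lemma integrand1_derive (K : nat) (u v : R * R) (B t : R) :
  is_derive (integrand1 K u v B) t (integrand2 K u v B t).
Proof.
rewrite /integrand1 /integrand2.
have aux w : is_derive (fun t => wave w t ^ K * wave (snd w, - fst w) t) t
    (INR K * wave w t ^ K.-1 * wave (snd w, - fst w) t ^ 2 - wave w t ^ K.+1).
  evar_last.
    apply: is_derive_mult; last by move=> *; apply: Rmult_comm.
      by apply: is_derive_pow; exact: wave_derive.
    exact: wave_derive.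
  have -> : wave (snd (snd w, - fst w), - fst (snd w, - fst w)) t = - wave w t.
    by rewrite /wave /=; ring.
  by rewrite /plus /mult /=; move: (INR K) => k; ring.
apply: is_derive_scal; apply: (@is_derive_plus R_AbsRing R_NormedModule).
  by apply: is_derive_scal; apply: aux.
by apply: is_derive_scal; apply: aux.
Qed.

Lemma integrand2_cont (K : nat) (u v : R * R) (B t : R) :
  continuous (integrand2 K u v B) t.
Proof. by rewrite /integrand2; cont. Qed.

(** The point of slope [s] attains the bound of [folded_max]. Another angle could
    only attain it with slope [- s], where the positive field makes the integrand
    strictly smaller than its folded bound. *)
Lemma integrand_peak (K : nat) (ca cb T B s : R) :
  0 < B -> 0 < cb < ca -> T = cb * cb / (ca * ca) -> equilibrium K T B s ->
  exists2 t0, [/\ 0 < cos t0, cb * sin t0 = s * (ca * cos t0),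
     cos t0 * cos t0 * (T + s * s) = T &
     integrand K.+1 (ca, cb) (ca, - cb) B t0 = exp (INR K.+1 * ln ca + log_profile K T B s)] &
  peak (integrand K.+1 (ca, cb) (ca, - cb) B) (integrand1 K (ca, cb) (ca, - cb) B)
       (integrand2 K (ca, cb) (ca, - cb) B) (- (PI / 2)) (PI / 2) t0.
Proof.
move=> B0 cab ET eq; have sT := eq_in eq.
have T0 : 0 < T by lra.
have T1 : T < 1.
  rewrite ET; apply: (Rmult_lt_reg_r (ca * ca)); first by nra.
  by rewrite /Rdiv Rmult_assoc Rinv_l; nra.
pose t0 := atan (s * ca / cb).
have [t0l t0r] := atan_bound (s * ca / cb); rewrite -/t0 in t0l t0r.
have c0 : 0 < cos t0 by apply: cos_gt_0; lra.
have sn : cb * sin t0 = s * (ca * cos t0).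
  have : tan t0 = s * ca / cb by rewrite /t0 tan_atan.
  rewrite /tan => H; have -> : sin t0 = sin t0 / cos t0 * cos t0 by field; lra.
  by rewrite H; field; lra.
have ellipse t : (ca * cos t) * (ca * cos t) + (cb * sin t) * (cb * sin t) / T = ca * ca.
  have sc := sin2_cos2 t; rewrite /Rsqr in sc.
  have -> : cb * sin t * (cb * sin t) / T = ca * ca * (sin t * sin t).
    by rewrite ET; field; lra.
  by rewrite -[RHS]Rmult_1_r -sc; ring.
have cT : cos t0 * cos t0 * (T + s * s) = T.
  have := ellipse t0; rewrite sn => H.
  have ca2 : 0 < ca * ca by nra.
  apply: (Rmult_eq_reg_l (ca * ca / T)); last by have := Rdiv_lt_0_compat _ _ ca2 T0; lra.
  have -> : ca * ca / T * T = ca * ca by field; lra.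
  by rewrite -[RHS]H; field; lra.
have top : integrand K.+1 (ca, cb) (ca, - cb) B t0 = exp (INR K.+1 * ln ca + log_profile K T B s).
  have q0 : 0 < 1 + s * s / T.
    by have := Rdiv_le_0_compat (s * s) T (Rle_0_sqr s) T0; lra.
  have W0 : 0 < slope_weight K B s by apply: slope_weight_gt0; lra.
  have lc : ln (cos t0) = - (1 / 2 * ln (1 + s * s / T)).
    have : cos t0 * cos t0 * (1 + s * s / T) = 1.
      by apply: (Rmult_eq_reg_r T); [rewrite -[in RHS]cT; field; lra | lra].
    move/(f_equal ln); rewrite ln_1 !ln_mult //; last by nra.
    by lra.
  have -> : INR K.+1 * ln ca + log_profile K T B s =
            INR K.+1 * (ln ca + ln (cos t0)) + ln (slope_weight K B s).
    by rewrite /log_profile lc; field.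
  have cc : 0 < ca * cos t0 by apply: Rmult_lt_0_compat; lra.
  rewrite -ln_mult // ?(proj1 cab); try lra.
  rewrite -ln_pow // -ln_mult //; last by apply: pow_lt.
  rewrite exp_ln; last by apply: Rmult_lt_0_compat => //; apply: pow_lt.
  rewrite /integrand /slope_weight /wave ![fst (_, _)]/= ![snd (_, _)]/=.
  have -> : ca * cos t0 + cb * sin t0 = ca * cos t0 * (1 + s) by rewrite sn; ring.
  have -> : ca * cos t0 + - cb * sin t0 = ca * cos t0 * (1 - s).
    by rewrite -Ropp_mult_distr_l sn; ring.
  by rewrite !Rpow_mult_distr; ring.
exists t0 => //; split=> [t|t|t|||t tI tt0].
- exact: integrand_derive.
- exact: integrand1_derive.
- exact: integrand2_cont.
- by lra.
- by rewrite top; apply: exp_pos.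
rewrite top.
set x := ca * cos t; set y := cb * sin t.
have x0 : 0 <= x by apply: Rmult_le_pos; [lra | apply: cos_ge_0; lra].
have eB := exp_pos B; have eB' := exp_pos (- B).
have eBB : exp (- B) < exp B by apply: exp_increasing; lra.
have hE : integrand K.+1 (ca, cb) (ca, - cb) B t =
          exp B * (x + y) ^ K.+1 + exp (- B) * (x - y) ^ K.+1.
  rewrite /integrand /wave ![fst (_, _)]/= ![snd (_, _)]/=.
  by rewrite -/x -/y; have -> : x + - cb * sin t = x - y by rewrite /y; ring.
have el := ellipse t; rewrite -/x -/y in el.
have el' : x * x + Rabs y * Rabs y / T = ca * ca.
  by rewrite -Rabs_mult (Rabs_pos_eq (y * y)) //; apply: Rle_0_sqr.
have ca0 : 0 < ca by lra.
have [le eqy] := folded_max T1 eq ca0 x0 (Rabs_pos y) el'.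
set E := exp (_ + _) in le eqy *.
have bound : Rabs (integrand K.+1 (ca, cb) (ca, - cb) B t) <=
    exp B * Rabs (x + y) ^ K.+1 + exp (- B) * Rabs (x - y) ^ K.+1.
  rewrite hE; apply: Rle_trans (Rabs_triang _ _) _.
  rewrite (Rabs_mult (exp B)) (Rabs_mult (exp (- B))) -!RPow_abs.
  by rewrite (Rabs_pos_eq (exp B)) ?(Rabs_pos_eq (exp (- B))); lra.
have [y0|y0] := Rle_lt_dec 0 y.
  rewrite (Rabs_pos_eq y) // in le eqy.
  have bd : Rabs (integrand K.+1 (ca, cb) (ca, - cb) B t) <= folded K B x y.
    by move: bound; rewrite /folded (Rabs_pos_eq (x + y)) //; lra.
  case: (Rle_lt_or_eq_dec _ _ le) => [|/eqy ys]; first by lra.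
  exfalso; apply: tt0.
  have sz : sin (t - t0) = 0.
    rewrite sin_minus; apply: (Rmult_eq_reg_l cb); last by lra.
    have -> : cb * (sin t * cos t0 - cos t * sin t0) = y * cos t0 - cos t * (cb * sin t0).
      by rewrite /y; ring.
    by rewrite ys sn /x; ring.
  case: (Rtotal_order t t0) => [lt|[//|gt]].
    by have := sin_gt_0 (t0 - t); rewrite -(Ropp_minus_distr t t0) sin_neg sz; lra.
  by have := sin_gt_0 (t - t0); rewrite sz; lra.
rewrite (Rabs_left y) // in le eqy.
case: (Rle_lt_or_eq_dec _ _ le) => [lt|/eqy ys].
  apply: Rle_lt_trans bound _; apply: Rle_lt_trans lt.
  have p : 0 <= Rabs (x + y) <= x - y.
    by split; [apply: Rabs_pos | apply: Rabs_le; lra].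
  have pp := pow_incr _ _ K.+1 p.
  rewrite /folded (Rabs_pos_eq (x - y)); last by lra.
  have -> : x + - y = x - y by ring.
  have -> : x - - y = x + y by ring.
  move: (pow _ _) (pow _ _) pp => X Y pp.
  by nra.
have x1 : 0 < x by nra.
apply: Rle_lt_trans bound _; apply: Rlt_le_trans le.
have p : 0 <= Rabs (x + y) < x - y.
  by split; [apply: Rabs_pos | apply: Rabs_def1; lra].
have pp := pow_lt_compat K p.
rewrite /folded (Rabs_pos_eq (x - y)); last by lra.
have -> : x + - y = x - y by ring.
have -> : x - - y = x + y by ring.
move: (pow _ _) (pow _ _) pp => X Y pp.
by nra.
Qed.

(** * Finite-volume quantities *)

(** The integrand and the contrast are each other's derivative in [B]. *)
Definition contrast (d : nat) (u v : R * R) (B t : R) : R :=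
  exp B * wave u t ^ d - exp (- B) * wave v t ^ d.

Lemma cont_integrand (d : nat) (u v : R * R) (B t : R) : continuous (integrand d u v B) t.
Proof. by rewrite /integrand; cont. Qed.

Lemma cont_contrast (d : nat) (u v : R * R) (B t : R) : continuous (contrast d u v B) t.
Proof. by rewrite /contrast; cont. Qed.

#[local] Hint Resolve cont_integrand cont_contrast : cont.

(** This family is closed under differentiation in [B], by [mixed_derive]. *)
Definition mixed (d : nat) (u v : R * R) (i j : nat) (B : R) : R :=
  RInt (fun t => integrand d u v B t ^ i * contrast d u v B t ^ j) (- (PI / 2)) (PI / 2).

Lemma continuity_2d_pt_pow (f : R -> R -> R) (n : nat) (x y : R) :
  continuity_2d_pt f x y -> continuity_2d_pt (fun a b => f a b ^ n) x y.
Proof.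
move=> cf; elim: n => [|n IH] /=; first exact: continuity_2d_pt_const.
exact: continuity_2d_pt_mult.
Qed.

Lemma cont2_comp (f : R -> R) (g : R -> R -> R) (x y : R) :
  (forall z : R, continuous f z) -> continuity_2d_pt g x y ->
  continuity_2d_pt (fun a b => f (g a b)) x y.
Proof.
move=> cf cg; apply: continuity_1d_2d_pt_comp => //.
by apply/continuity_pt_filterlim; apply: cf.
Qed.

Lemma mixed_derive (d : nat) (u v : R * R) (i j : nat) (B : R) :
  is_derive (mixed d u v i j) B
    (INR i * mixed d u v i.-1 j.+1 B + INR j * mixed d u v i.+1 j.-1 B).
Proof.
pose D B t := INR i * (integrand d u v B t ^ i.-1 * contrast d u v B t ^ j.+1) +
              INR j * (integrand d u v B t ^ i.+1 * contrast d u v B t ^ j.-1).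
have dD B' t : is_derive (fun B => integrand d u v B t ^ i * contrast d u v B t ^ j) B' (D B' t).
  have dh : is_derive (fun B => integrand d u v B t) B' (contrast d u v B' t).
    by rewrite /integrand /contrast; auto_derive => //; ring.
  have dg : is_derive (fun B => contrast d u v B t) B' (integrand d u v B' t).
    by rewrite /integrand /contrast; auto_derive => //; ring.
  evar_last.
    apply: is_derive_mult; last by move=> *; apply: Rmult_comm.
      by apply: is_derive_pow; exact: dh.
    by apply: is_derive_pow; exact: dg.
  by rewrite /D /plus /mult /=; ring.
have E : INR i * mixed d u v i.-1 j.+1 B + INR j * mixed d u v i.+1 j.-1 B =
    RInt (fun t => Derive (fun B => integrand d u v B t ^ i * contrast d u v B t ^ j) B)
         (- (PI / 2)) (PI / 2).
  symmetry; apply: is_RInt_unique; apply: (is_RInt_ext (D B)).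
    by move=> t _; symmetry; apply: is_derive_unique.
  apply: (@is_RInt_plus R_NormedModule); apply: (@is_RInt_scal R_NormedModule);
    apply: (@RInt_correct R_CompleteNormedModule); apply: ex_RInt_cont => t; cont.
rewrite E; apply: is_derive_RInt_param.
- by exists (mkposreal _ Rlt_0_1) => B' _ t _; exists (D B' t); apply: dD.
- move=> t _; apply: (continuity_2d_pt_ext D).
    by move=> B' t'; symmetry; apply: is_derive_unique.
  have ce s : continuity_2d_pt (fun B' _ : R => exp (s * B')) B t.
    apply: (@cont2_comp exp (fun B' _ => s * B')).
      by move=> z; apply: ex_derive_continuous; auto_derive.
    by apply: continuity_2d_pt_mult; [apply: continuity_2d_pt_const | apply: continuity_2d_pt_id1].
  have cw w : continuity_2d_pt (fun _ t' : R => wave w t' ^ d) B t.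
    apply: (@cont2_comp (fun z => wave w z ^ d) (fun _ t' => t')); last exact: continuity_2d_pt_id2.
    by move=> z; cont.
  have ch : continuity_2d_pt (fun B' t' => integrand d u v B' t') B t.
    apply: (continuity_2d_pt_ext (fun B' t' => exp (1 * B') * wave u t' ^ d + exp (- (1) * B') * wave v t' ^ d)).
      by move=> B' t'; rewrite /integrand Rmult_1_l; congr (_ + exp _ * _); ring.
    by apply: continuity_2d_pt_plus; apply: continuity_2d_pt_mult.
  have cg : continuity_2d_pt (fun B' t' => contrast d u v B' t') B t.
    apply: (continuity_2d_pt_ext (fun B' t' => exp (1 * B') * wave u t' ^ d - exp (- (1) * B') * wave v t' ^ d)).
      by move=> B' t'; rewrite /contrast Rmult_1_l; congr (_ - exp _ * _); ring.
    by apply: continuity_2d_pt_minus; apply: continuity_2d_pt_mult.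
  by apply: continuity_2d_pt_plus; apply: continuity_2d_pt_mult; [apply: continuity_2d_pt_const | |
     apply: continuity_2d_pt_const |]; apply: continuity_2d_pt_mult; apply: continuity_2d_pt_pow.
- by exists (mkposreal _ Rlt_0_1) => B' _; apply: ex_RInt_cont => t; cont.
Qed.

Lemma Rsum_gt0 (I : finType) (P : pred I) (F : I -> R) (i0 : I) :
  P i0 -> (forall i, 0 < F i) -> 0 < \big[Rplus/0]_(i | P i) F i.
Proof.
move=> Pi F0; rewrite (bigD1 i0) //=; apply: Rplus_lt_le_0_compat => //.
by apply: (big_ind (fun x => 0 <= x)) => [|x y|i _]; [lra | lra | apply: Rlt_le].
Qed.

Definition normaliser (d n : nat) : R :=
  let j := (d * n)./2 in even_fact j / (PI * odd_fact j).

Lemma normaliser_bounds (d n : nat) : ~~ odd (d * n) ->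
  / PI <= normaliser d n <= (INR (d * n) + 1) / PI.
Proof.
move=> dn; rewrite /normaliser.
have := even_odd_fact (d * n)./2; rewrite mul2n even_halfK // plus_INR.
have := odd_fact_gt0 (d * n)./2; have P0 := PI_RGT_0.
move: (even_fact _) (odd_fact _) => e o o0 [lo up].
have -> : e / (PI * o) = e / o / PI by field; lra.
have H : 1 <= e / o <= INR (d * n) + 1.
  have E : e = e / o * o by field; lra.
  split; apply: (Rmult_le_reg_r o) => //; rewrite -E; first lra.
  by move: up; rewrite [INR 1]/=.
have iP : 0 < / PI by apply: Rinv_0_lt_compat.
by rewrite /Rdiv; split; [rewrite -{1}(Rmult_1_l (/ PI)) |]; apply: Rmult_le_compat_r; lra.
Qed.

Lemma pressure_formula (d n : nat) (b B : R) (u v : R * R) :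
  dot u u = exp b -> dot v v = exp b -> dot u v = exp (- b) -> ~~ odd (d * n) ->
  0 < mixed d u v n 0 B /\
  pressure_n d n b B = / INR n * ln (normaliser d n * mixed d u v n 0 B).
Proof.
move=> uu vv uv dn.
have dn2 : (d * n)%N = (2 * (d * n)./2)%N by rewrite mul2n even_halfK.
have E := expectation_partition B uu vv uv dn2.
have ME : RInt (fun t => integrand d u v B t ^ n) (- (PI / 2)) (PI / 2) = mixed d u v n 0 B.
  by apply: RInt_ext => t _ /=; ring.
rewrite ME -/(normaliser d n) in E.
have c0 : 0 < normaliser d n.
  by have [+ _] := normaliser_bounds dn; have := Rinv_0_lt_compat _ PI_RGT_0; lra.
split; last by rewrite /pressure_n E.
have cT : #|[set: half_edge n d]| = (2 * (d * n)./2)%N.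
  by rewrite cardsT card_prod !card_ord mulnC.
have Nj : 0 < INR #|matchings n d|.
  by rewrite matchings_pairings (pairing_sum1 cT); apply: odd_fact_gt0.
have [m0 m0M] : exists m, m \in matchings n d.
  apply/card_gt0P; rewrite lt0n; apply/eqP => z; rewrite z /= in Nj; lra.
have pos : 0 < expectation (@partition_function n d b B).
  apply: Rdiv_lt_0_compat => //; apply: (Rsum_gt0 (i0 := m0)) => // m.
  by apply: (Rsum_gt0 (i0 := [ffun=> true])) => // s; apply: exp_pos.
rewrite E in pos.
by apply: (Rmult_lt_reg_l (normaliser d n)) => //; rewrite Rmult_0_r.
Qed.

Lemma magnetization_formula (d n : nat) (b B : R) (u v : R * R) :
  dot u u = exp b -> dot v v = exp b -> dot u v = exp (- b) -> ~~ odd (d * n.+1) ->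
  magnetization_n d n.+1 b B = mixed d u v n 1 B / mixed d u v n.+1 0 B.
Proof.
move=> uu vv uv dn; have PF B' := pressure_formula B' uu vv uv dn.
have c0 : 0 < normaliser d n.+1.
  by have [+ _] := normaliser_bounds dn; have := Rinv_0_lt_compat _ PI_RGT_0; lra.
rewrite /magnetization_n (Derive_ext _ _ _ (fun B' => proj2 (PF B'))).
apply: is_derive_unique; have I0 := proj1 (PF B).
have n0 : 0 < INR n.+1 by apply: lt_0_INR; lia.
evar_last.
  apply: is_derive_scal.
  apply: (is_derive_comp ln (fun B => normaliser d n.+1 * mixed d u v n.+1 0 B)).
    by apply/is_derive_Reals; apply: derivable_pt_lim_ln; apply: Rmult_lt_0_compat.
  by apply: is_derive_scal; apply: mixed_derive.
rewrite /scal /= /mult /=; rewrite -/(INR n.+1).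
by field; lra.
Qed.

Lemma susceptibility_formula (d n : nat) (b B : R) (u v : R * R) :
  dot u u = exp b -> dot v v = exp b -> dot u v = exp (- b) -> ~~ odd (d * n.+2) ->
  susceptibility_n d n.+2 b B =
  1 + INR n.+1 * mixed d u v n 2 B / mixed d u v n.+2 0 B -
  INR n.+2 * (mixed d u v n.+1 1 B / mixed d u v n.+2 0 B) ^ 2.
Proof.
move=> uu vv uv dn; have PF B' := pressure_formula B' uu vv uv dn.
rewrite /susceptibility_n [Derive_n _ _ _]/=.
rewrite (Derive_ext _ (fun B => mixed d u v n.+1 1 B / mixed d u v n.+2 0 B)); last first.
  by move=> B'; apply: (magnetization_formula B' uu vv uv).
apply: is_derive_unique; have I0 := proj1 (PF B).
evar_last.
  apply: is_derive_div; [apply: mixed_derive | apply: mixed_derive | lra].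
rewrite ![_.+1.-1]/= [INR 1]/= [INR 0]/= !S_INR.
by field; lra.
Qed.

(** * The thermodynamic limit *)

Definition admissible (d : nat) : (nat -> Prop) -> Prop :=
  within (fun n => ~~ odd (d * n)) eventually.

#[local] Instance admissible_filter (d : nat) : Filter (admissible d).
Proof. exact: within_filter. Qed.

#[local] Instance admissible_proper (d : nat) : ProperFilter' (admissible d).
Proof.
split; last exact: admissible_filter.
case=> N HN; apply: (HN N.*2); last by rewrite oddM odd_double andbF.
by apply/leP; rewrite -addnn leq_addr.
Qed.

Lemma thermo_lim_eq (d : nat) (f : nat -> R) (l : R) :
  is_thermo_lim d f l -> thermo_lim d f = l.
Proof.
exact: (@iota_filterlim_locally R_AbsRing R_CompleteNormedModule nat (admissible d) _ f l).
Qed.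

(** Second derivatives in the field lower the exponent of the integrand by two. *)
Lemma admissible_shift2 (d : nat) (f : nat -> R) (l : R) :
  filterlim (fun n => f n.+2) (admissible d) (locally l) -> is_thermo_lim d f l.
Proof.
move=> H; apply/(filterlim_R (admissible_filter d)) => eps e0.
have [N HN] := proj1 (filterlim_R (admissible_filter d) _ _) H eps e0.
exists (N.+2) => -[|[|n]] nN dn; [lia | lia |].
apply: HN; first lia.
by move: dn; rewrite !oddM /= negbK.
Qed.

(** If [d * n] is even then either [n] is even, or [d] is even and both terms of the
    integrand are nonnegative. *)
Lemma integrand_weight (d : nat) (u v : R * R) (B : R) :
  weight_filter (integrand d u v B) (admissible d).
Proof.
have sq (x : R) k : 0 <= x ^ k.*2.
  by rewrite -mul2n pow_mult; apply: pow_le; apply: pow2_ge_0.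
split=> [|P [N HN]|]; first exact: admissible_filter.
  by exists N => n nN _; apply: HN.
exists 0%N => n _; rewrite oddM negb_and => /orP[] even t.
  apply: pow_le; rewrite /integrand -[d]odd_double_half (negbTE even) add0n.
  by apply: Rplus_le_le_0_compat; apply: Rmult_le_pos;
    [apply: Rlt_le; apply: exp_pos | apply: sq | apply: Rlt_le; apply: exp_pos | apply: sq].
by rewrite -[n]odd_double_half (negbTE even) add0n; apply: sq.
Qed.

(** With [g] the derivative of the integrand, this puts test functions in the form
    that [wmean_order1] and [wmean_order2] require. *)
Lemma order1_compare (f g : R -> R) (x0 f' g' : R) :
  f x0 = 0 -> g x0 = 0 -> is_derive f x0 f' -> is_derive g x0 g' -> g' <> 0 ->
  forall eps, 0 < eps -> exists2 del, 0 < del &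
    forall x, Rabs (x - x0) < del -> Rabs (f x - f' / g' * g x) <= eps * Rabs (g x).
Proof.
move=> f0 g0 df dg gn eps e0.
have ag : 0 < Rabs g' by apply: Rabs_pos_lt.
pose c := f' / g'.
have dk : is_derive (fun x => f x - c * g x) x0 0.
  evar_last.
    by apply: is_derive_minus; [exact: df | apply: is_derive_scal; exact: dg].
  by rewrite /minus /plus /opp /= /c; field.
have lin (h : R -> R) l : is_derive h x0 l -> h x0 = 0 -> forall e, 0 < e ->
    exists2 del, 0 < del & forall x, Rabs (x - x0) < del ->
      Rabs (h x - l * (x - x0)) <= e * Rabs (x - x0).
  move=> /is_derive_Reals dh h0 e ep.
  have [del Hd] := dh e ep; exists del; first exact: cond_pos.
  move=> x xd; case: (Req_dec x x0) => [->|xx].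
    by rewrite h0 /Rminus Rplus_opp_r Rmult_0_r Ropp_0 Rplus_0_r Rabs_R0; lra.
  have xn : x - x0 <> 0 by lra.
  have := Hd (x - x0) xn xd.
  have -> : x0 + (x - x0) = x by ring.
  rewrite h0 => H.
  have -> : h x - l * (x - x0) = ((h x - 0) / (x - x0) - l) * (x - x0) by field.
  by rewrite Rabs_mult; apply: Rmult_le_compat_r; [apply: Rabs_pos | lra].
have e1 : 0 < eps * (Rabs g' / 2) by apply: Rmult_lt_0_compat; lra.
have e2 : 0 < Rabs g' / 2 by lra.
have k0 : f x0 - c * g x0 = 0 by rewrite f0 g0; ring.
have [d1 d10 H1] := lin _ _ dk k0 _ e1.
have [d2 d20 H2] := lin _ _ dg g0 _ e2.
exists (Rmin d1 d2); first exact: Rmin_glb_lt.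
move=> x xd; have m1 := Rmin_l d1 d2; have m2 := Rmin_r d1 d2.
have := H1 x (_ : Rabs (x - x0) < d1); have := H2 x (_ : Rabs (x - x0) < d2).
rewrite Rmult_0_l Rminus_0_r => K2 K1.
have {}K1 := K1 (Rlt_le_trans _ _ _ xd m1).
have {}K2 := K2 (Rlt_le_trans _ _ _ xd m2).
have K3 : Rabs g' * Rabs (x - x0) <= Rabs (g x) + Rabs g' / 2 * Rabs (x - x0).
  rewrite -Rabs_mult; have -> : g' * (x - x0) = g x - (g x - g' * (x - x0)) by ring.
  by apply: Rle_trans (Rabs_triang _ _) _; rewrite Rabs_Ropp; lra.
apply: Rle_trans K1 _; rewrite Rmult_assoc.
by apply: Rmult_le_compat_l; lra.
Qed.

(** At equilibrium this is [tanh (B + d * artanh s)], the magnetization at a vertex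
    of the [d]-regular tree in which every edge carries the cavity field
    [artanh s]. *)
Definition equil_magnetization (T s : R) : R := (1 + T) * s / (T + s * s).

(** Up to positive factors, the derivative in [s] of the field needed to keep [s]
    in equilibrium ([field_of_derive]), and the curvature of the peak
    ([peak_values]). *)
Definition stiffness (k T s : R) : R := T * (1 - k * T) + (k - T) * (s * s).

Definition equil_susceptibility (k T s : R) : R :=
  (1 + T) * (1 - s * s) * (T * T - s * s) * (T - s * s) /
  ((T + s * s) * (T + s * s) * stiffness k T s).

Definition contrast1 (K : nat) (u v : R * R) (B t : R) : R :=
  INR K.+1 * (exp B * (wave u t ^ K * wave (snd u, - fst u) t) -
              exp (- B) * (wave v t ^ K * wave (snd v, - fst v) t)).

Lemma contrast_derive (K : nat) (u v : R * R) (B t : R) :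
  is_derive (contrast K.+1 u v B) t (contrast1 K u v B t).
Proof.
rewrite /contrast /contrast1.
have aux w : is_derive (fun t => wave w t ^ K.+1) t
    (INR K.+1 * (wave w t ^ K * wave (snd w, - fst w) t)).
  have := is_derive_pow (wave w) K.+1 t _ (wave_derive w t).
  by have -> : INR K.+1 * wave (snd w, - fst w) t * wave w t ^ K.+1.-1 =
     INR K.+1 * (wave w t ^ K * wave (snd w, - fst w) t) by rewrite [K.+1.-1]/=; ring.
evar_last.
  by apply: is_derive_minus; apply: is_derive_scal; apply: aux.
by rewrite /minus /plus /opp /=; move: (INR _) => k; ring.
Qed.

Lemma peak_values (k : nat) (ca cb T B s t0 : R) :
  0 < ca -> 0 < cb -> T = cb * cb / (ca * ca) -> T < 1 -> equilibrium k T B s ->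
  cb * sin t0 = s * (ca * cos t0) -> 0 < cos t0 ->
  let h := integrand k.+1 (ca, cb) (ca, - cb) B t0 in
  [/\ contrast k.+1 (ca, cb) (ca, - cb) B t0 = equil_magnetization T s * h,
      integrand1 k (ca, cb) (ca, - cb) B t0 = 0,
      integrand2 k (ca, cb) (ca, - cb) B t0 =
        - (INR k.+1 * h * stiffness (INR k) T s / (T * (1 - s * s))) &
      contrast1 k (ca, cb) (ca, - cb) B t0 =
        INR k.+1 * (ca / cb) * h * (T * T - s * s) / (T + s * s)].
Proof.
move=> ca0 cb0 ET T1 eq sn c0 h.
have sT := eq_in eq; have T0 : 0 < T by lra.
pose C := ca * cos t0.
have C0 : 0 < C by apply: Rmult_lt_0_compat.
have Pu : wave (ca, cb) t0 = C * (1 + s).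
  by rewrite /wave ![fst (_, _)]/= ![snd (_, _)]/= sn /C; ring.
have Pv : wave (ca, - cb) t0 = C * (1 - s).
  by rewrite /wave ![fst (_, _)]/= ![snd (_, _)]/= -Ropp_mult_distr_l sn /C; ring.
have sn' : sin t0 = s * C / cb by rewrite /C -sn; field; lra.
have cc : cos t0 = C / ca by rewrite /C; field; lra.
have cbE : cb * cb = T * (ca * ca) by rewrite ET; field; lra.
have Du : wave (cb, - ca) t0 = C * (ca / cb) * (T - s).
  rewrite /wave ![fst (_, _)]/= ![snd (_, _)]/= sn' cc ET; field; lra.
have Dv : wave (- cb, - ca) t0 = - (C * (ca / cb) * (T + s)).
  rewrite /wave ![fst (_, _)]/= ![snd (_, _)]/= sn' cc ET; field; lra.
have [lam lam0 [X Y]] := balance_factor sT (Rlt_trans _ _ _ (proj2 sT) T1) (eq_zero eq).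
pose A := C ^ k.
have PK x : (C * x) ^ k = A * x ^ k by rewrite Rpow_mult_distr.
have PS x : (C * x) ^ k.+1 = C * A * (x * x ^ k) by rewrite -tech_pow_Rmult PK; ring.
have s1 : s * s < 1 by nra.
have Ts : s * s < T * T by nra.
have hE : h = A * C * (lam * (2 * (T + s * s)) / (T * T - s * s)).
  rewrite /h /integrand Pu Pv !PS ?PK.
  have -> : exp B * (C * A * ((1 + s) * (1 + s) ^ k)) +
      exp (- B) * (C * A * ((1 - s) * (1 - s) ^ k)) =
      C * A * ((exp B * (1 + s) ^ k) * (1 + s) + (exp (- B) * (1 - s) ^ k) * (1 - s)) by ring.
  by rewrite X Y; field; nra.
have K1 x : x <> 0 -> INR k * x ^ k.-1 = INR k * x ^ k / x.
  by move=> x0; case: (k) => [|k']; [rewrite /=; field | rewrite -tech_pow_Rmult /=; field].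
split.
- rewrite /contrast Pu Pv !PS ?PK.
  have -> : exp B * (C * A * ((1 + s) * (1 + s) ^ k)) -
      exp (- B) * (C * A * ((1 - s) * (1 - s) ^ k)) =
      C * A * ((exp B * (1 + s) ^ k) * (1 + s) - (exp (- B) * (1 - s) ^ k) * (1 - s)) by ring.
  by rewrite X Y hE /equil_magnetization; field; nra.
- rewrite /integrand1 ![fst (_, _)]/= ![snd (_, _)]/= Pu Pv Du Dv !PK.
  have -> : exp B * (A * (1 + s) ^ k * (C * (ca / cb) * (T - s))) +
     exp (- B) * (A * (1 - s) ^ k * - (C * (ca / cb) * (T + s))) =
     A * C * (ca / cb) * ((exp B * (1 + s) ^ k) * (T - s) - (exp (- B) * (1 - s) ^ k) * (T + s)).
    by ring.
  by rewrite X Y; field; nra.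
- rewrite /integrand2 ![fst (_, _)]/= ![snd (_, _)]/= Pu Pv Du Dv.
  rewrite (K1 (C * (1 + s))); last by nra.
  rewrite (K1 (C * (1 - s))); last by nra.
  have N2 x : (- x) ^ 2 = x ^ 2 by ring.
  have D2 x : (C * (ca / cb) * x) ^ 2 = C ^ 2 * (ca / cb) ^ 2 * x ^ 2 by ring.
  rewrite !PS ?PK N2 !D2.
  have -> : exp B * (INR k * (A * (1 + s) ^ k) / (C * (1 + s)) * (C ^ 2 * (ca / cb) ^ 2 * (T - s) ^ 2) - C * A * ((1 + s) * (1 + s) ^ k)) = (exp B * (1 + s) ^ k) * (INR k * A / (C * (1 + s)) * (C ^ 2 * (ca / cb) ^ 2 * (T - s) ^ 2) - C * A * (1 + s)).
    by field; nra.
  have -> : exp (- B) * (INR k * (A * (1 - s) ^ k) / (C * (1 - s)) * (C ^ 2 * (ca / cb) ^ 2 * (T + s) ^ 2) - C * A * ((1 - s) * (1 - s) ^ k)) = (exp (- B) * (1 - s) ^ k) * (INR k * A / (C * (1 - s)) * (C ^ 2 * (ca / cb) ^ 2 * (T + s) ^ 2) - C * A * (1 - s)).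
    by field; nra.
  have -> : (ca / cb) ^ 2 = / T by rewrite ET; field; lra.
  by rewrite X Y hE /stiffness; field; nra.
- rewrite /contrast1 ![fst (_, _)]/= ![snd (_, _)]/= Pu Pv Du Dv !PK.
  have -> : exp B * (A * (1 + s) ^ k * (C * (ca / cb) * (T - s))) -
     exp (- B) * (A * (1 - s) ^ k * - (C * (ca / cb) * (T + s))) =
     A * C * (ca / cb) * ((exp B * (1 + s) ^ k) * (T - s) + (exp (- B) * (1 - s) ^ k) * (T + s)).
    by ring.
  by rewrite X Y hE; field; nra.
Qed.

Lemma mixed_wint (d : nat) (u v : R * R) (N i j : nat) (B : R) :
  mixed d u v (N + i) j B =
  wint (integrand d u v B) (- (PI / 2)) (PI / 2) N
       (fun t => integrand d u v B t ^ i * contrast d u v B t ^ j).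
Proof. by apply: RInt_ext => t _; rewrite pow_add /=; ring. Qed.

(** The fluctuations of [g / h] under the weight [h ^ n] are those of a Gaussian
    variable of variance [1 / n] over the curvature of [- ln h] at the peak. *)
Lemma susceptibility_lim (h h1 h2 g g1 : R -> R) (a b x0 m : R)
    (F : (nat -> Prop) -> Prop) :
  peak h h1 h2 a b x0 -> weight_filter h F ->
  (forall x, is_derive g x (g1 x)) -> g x0 = m * h x0 -> h1 x0 = 0 -> h2 x0 < 0 ->
  filterlim (fun n => INR n.+2 *
      (wmean h a b n (fun x => g x * g x) * wmean h a b n (fun x => h x * h x) -
       wmean h a b n (fun x => h x * g x) * wmean h a b n (fun x => h x * g x)) /
      (wmean h a b n (fun x => h x * h x) * wmean h a b n (fun x => h x * h x))) F
    (locally (- (g1 x0 * g1 x0 / (h x0 * h2 x0)))).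
Proof.
move=> pk wf dg gm h10 h2n; have FF := wf_filter wf.
have ch := peak_c0 pk; have ch1 := peak_c1 pk; have h0 := peak_pos pk.
have cg : forall x : R, continuous g x.
  by move=> x; apply: ex_derive_continuous; exists (g1 x).
(* Subtracting the multiple of [h] with the same value at the peak leaves the
   Gram determinant unchanged. *)
pose e (x : R) := g x - m * h x.
have ce : forall x : R, continuous e x by move=> x; rewrite /e; cont.
have e0 : e x0 = 0 by rewrite /e gm; ring.
have de : is_derive e x0 (g1 x0).
  evar_last.
    apply: is_derive_minus; [exact: dg | apply: is_derive_scal; exact: (peak_d1 pk)].
  by rewrite /minus /plus /opp /= h10; ring.
pose c := g1 x0 / h2 x0.
have cmp := order1_compare e0 h10 de (peak_d2 pk x0) (Rlt_not_eq _ _ h2n).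
rewrite -/c in cmp.
have chh : forall x : R, continuous (fun x : R => h x * h x) x by move=> x; cont.
have cgg : forall x : R, continuous (fun x : R => g x * g x) x by move=> x; cont.
have chg : forall x : R, continuous (fun x : R => h x * g x) x by move=> x; cont.
have cee : forall x : R, continuous (fun x : R => e x * e x) x by move=> x; cont.
have che : forall x : R, continuous (fun x : R => h x * e x) x by move=> x; cont.
have Lee : filterlim (fun n => INR n.+1 * wmean h a b n (fun x => e x * e x)) F
    (locally (c * c * - (h x0 * h2 x0))).
  apply: (wmean_order2 pk wf cee) => eps eps0.
  pose t := Rmin 1 (eps / (2 * Rabs c + 1)).
  have c0 := Rabs_pos c.
  have t0 : 0 < t by apply: Rmin_glb_lt; [lra | apply: Rdiv_lt_0_compat; lra].
  have t1 : t <= 1 by apply: Rmin_l.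
  have t2 : t * (2 * Rabs c + 1) <= eps.
    have H : t <= eps / (2 * Rabs c + 1) by apply: Rmin_r.
    have := Rmult_le_compat_r (2 * Rabs c + 1) _ _ (_ : 0 <= 2 * Rabs c + 1) H.
    have -> : eps / (2 * Rabs c + 1) * (2 * Rabs c + 1) = eps by field; lra.
    by apply; lra.
  have [del d0 nr] := cmp t t0; exists del => // x xd.
  have {}nr := nr x xd.
  have -> : e x * e x - c * c * (h1 x * h1 x) = (e x - c * h1 x) * (e x - c * h1 x + 2 * c * h1 x).
    by ring.
  have hh : h1 x * h1 x = Rabs (h1 x) * Rabs (h1 x).
    by rewrite -Rabs_mult Rabs_pos_eq //; apply: Rle_0_sqr.
  rewrite hh Rabs_mult.
  have p1 := Rabs_pos (h1 x); have p2 := Rabs_pos (e x - c * h1 x).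
  have tri : Rabs (e x - c * h1 x + 2 * c * h1 x) <= (t + 2 * Rabs c) * Rabs (h1 x).
    apply: Rle_trans (Rabs_triang _ _) _.
    by rewrite !(Rabs_mult _ (h1 x)) (Rabs_mult 2) (Rabs_pos_eq 2); lra.
  apply: (Rle_trans _ (t * Rabs (h1 x) * ((t + 2 * Rabs c) * Rabs (h1 x)))).
    by apply: Rmult_le_compat => //; apply: Rabs_pos.
  have -> : t * Rabs (h1 x) * ((t + 2 * Rabs c) * Rabs (h1 x)) =
    (t * (t + 2 * Rabs c)) * (Rabs (h1 x) * Rabs (h1 x)) by ring.
  by apply: Rmult_le_compat_r; nra.
have Lhe : filterlim (fun n => INR n.+1 * (wmean h a b n (fun x => h x * e x) *
     wmean h a b n (fun x => h x * e x))) F (locally 0).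
  have he0 : h x0 * e x0 = 0 by rewrite e0; ring.
  have dhe : is_derive (fun x => h x * e x) x0 (h x0 * g1 x0).
    evar_last.
      apply: is_derive_mult; [exact: (peak_d1 pk) | exact: de | by move=> *; apply: Rmult_comm].
    by rewrite /plus /mult /= e0; ring.
  exact: (wmean_order1 pk wf che (order1_compare he0 h10 dhe (peak_d2 pk x0) (Rlt_not_eq _ _ h2n))).
have Lhh := wmean_lim pk wf chh.
have hh0 : h x0 * h x0 <> 0 by nra.
pose proof (flim_inv_S (wf_le wf)) as Li.
have hhhh : h x0 * h x0 * (h x0 * h x0) <> 0 by apply: Rmult_integral_contrapositive.
pose proof (flim_minus (flim_mult Lee Lhh) Lhe) as L1.
pose proof (flim_mult (flim_plus (@flim_const _ F FF 1) Li) L1) as L2.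
pose proof (flim_mult L2 (flim_inv hhhh (flim_mult Lhh Lhh))) as L3.
apply: (flim_eq L3); last first.
  by rewrite /c; field; lra.
apply: filter_imp (wint_gt0 pk wf) => n I0.
have wl phi psi q r : (forall x : R, continuous phi x) -> (forall x : R, continuous psi x) ->
    wmean h a b n (fun x => q * phi x + r * psi x) =
    q * wmean h a b n phi + r * wmean h a b n psi.
  by move=> cp cq; rewrite /wmean (wint_lin n _ _ pk) //; field; lra.
have ext phi psi : (forall x, phi x = psi x) -> wmean h a b n phi = wmean h a b n psi.
  by move=> E; rewrite /wmean; congr (_ / _); apply: RInt_ext => x _; rewrite E.
set A := wmean h a b n (fun x => h x * h x).
set He := wmean h a b n (fun x => h x * e x).
set Ee := wmean h a b n (fun x => e x * e x).
have Ehg : wmean h a b n (fun x => h x * g x) = m * A + 1 * He.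
  by rewrite -wl //; apply: ext => x; rewrite /e; ring.
have Egg : wmean h a b n (fun x => g x * g x) = m * (m * A + 1 * He) + 1 * (m * He + 1 * Ee).
  have c1 : forall x : R, continuous (fun x => m * (h x * h x) + 1 * (h x * e x)) x by move=> x; cont.
  have c2 : forall x : R, continuous (fun x => m * (h x * e x) + 1 * (e x * e x)) x by move=> x; cont.
  by rewrite -!wl //; apply: ext => x; rewrite /e; ring.
rewrite Ehg Egg (S_INR n.+1); have n1 := INR_S_ge1 n.
move: (INR n.+1) n1 => k n1.
have -> : k + 1 = (1 + / k) * k by field; lra.
by rewrite /Rdiv; ring.
Qed.

Lemma thermo_setup (b : R) : 0 < b ->
  let ca := sqrt (cosh b) in let cb := sqrt (sinh b) in
  [/\ 0 < cb < ca, tanh b = cb * cb / (ca * ca),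
     dot (ca, cb) (ca, cb) = exp b, dot (ca, - cb) (ca, - cb) = exp b &
     dot (ca, cb) (ca, - cb) = exp (- b)].
Proof.
move=> b0 ca cb.
have ee : exp (- b) < exp b by apply: exp_increasing; lra.
have e1 := exp_pos (- b).
have sh : 0 < sinh b by rewrite /sinh; lra.
have cs : sinh b < cosh b by rewrite /sinh /cosh; lra.
have ca2 : ca * ca = cosh b by apply: sqrt_sqrt; lra.
have cb2 : cb * cb = sinh b by apply: sqrt_sqrt; lra.
split.
- by split; [apply: sqrt_lt_R0 | apply: sqrt_lt_1_alt; lra].
- by rewrite ca2 cb2.
- by rewrite /dot /= ca2 cb2 /sinh /cosh; field.
- have -> : dot (ca, - cb) (ca, - cb) = ca * ca + cb * cb by rewrite /dot /=; ring.
  by rewrite ca2 cb2 /sinh /cosh; field.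
- have -> : dot (ca, cb) (ca, - cb) = ca * ca - cb * cb by rewrite /dot /=; ring.
  by rewrite ca2 cb2 /sinh /cosh; field.
Qed.

Definition equil_pressure (k : nat) (b B s : R) : R :=
  INR k.+1 * ln (sqrt (cosh b)) + log_profile k (tanh b) B s.

Lemma normaliser_negligible (d : nat) :
  filterlim (fun n => / INR n * ln (normaliser d n)) (admissible d) (locally 0).
Proof.
have P0 := PI_RGT_0.
pose c := Rabs (ln PI) + ln (INR d + 1).
apply/(filterlim_R (admissible_filter d)) => eps e0.
have [N HN] := INR_unbounded (2 * c / eps + (4 / eps) * (4 / eps)).
exists (S N) => n nN dn; have [lo up] := normaliser_bounds dn.
have n0 : 0 < INR n by apply: lt_0_INR; lia.
have n1 : 1 <= INR n by apply: (le_INR 1); lia.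
have nN' : INR N <= INR n by apply: le_INR; lia.
have iP : 0 < / PI by apply: Rinv_0_lt_compat.
have dd := pos_INR d.
have l1 : - ln PI <= ln (normaliser d n).
  by rewrite -ln_Rinv //; apply: ln_le.
have l2 : ln (normaliser d n) <= ln (INR d + 1) + ln (INR n) - ln PI.
  have : normaliser d n <= (INR d + 1) * INR n / PI.
    apply: Rle_trans up _; apply: Rmult_le_compat_r; first lra.
    by rewrite mult_INR; nra.
  have p0 : 0 < normaliser d n by lra.
  have p1 : 0 < (INR d + 1) * INR n by apply: Rmult_lt_0_compat; lra.
  have -> : ln (INR d + 1) + ln (INR n) - ln PI = ln ((INR d + 1) * INR n / PI).
    by rewrite /Rdiv (ln_mult ((INR d + 1) * INR n)) // ln_Rinv // ln_mult //; lra.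
  exact: ln_le.
(* [ln n <= 2 sqrt n] is of smaller order than [n]. *)
have l3 : ln (INR n) <= 2 * sqrt (INR n).
  have sq := sqrt_lt_R0 _ n0.
  rewrite -{1}(sqrt_sqrt (INR n)); last lra.
  rewrite ln_mult //.
  have : ln (sqrt (INR n)) <= sqrt (INR n) - 1.
    have := exp_ineq1_le (ln (sqrt (INR n))); rewrite exp_ln //; lra.
  by lra.
have dc : 0 <= ln (INR d + 1) by rewrite -ln_1; apply: ln_le; lra.
have c0 : 0 <= 2 * c / eps.
  by apply: Rdiv_le_0_compat => //; rewrite /c; have := Rabs_pos (ln PI); lra.
have e4 : 0 < 4 / eps by apply: Rdiv_lt_0_compat; lra.
have l4 : 2 * sqrt (INR n) <= eps / 2 * INR n.
  have H : 4 / eps <= sqrt (INR n).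
    rewrite -(sqrt_square (4 / eps)); last lra.
    by apply: sqrt_le_1_alt; lra.
  have := Rmult_le_compat_l (eps / 2) _ _ (_ : 0 <= eps / 2) H.
  have -> : eps / 2 * (4 / eps) = 2 by field; lra.
  move=> {}H; have {}H : 2 <= eps / 2 * sqrt (INR n) by apply: H; lra.
  have sq := sqrt_lt_R0 _ n0.
  by rewrite -{2}(sqrt_sqrt (INR n)); [nra | lra].
have l5 : c <= eps / 2 * INR n.
  have H : 2 * c / eps <= INR n by have := Rmult_lt_0_compat _ _ e4 e4; lra.
  have := Rmult_le_compat_l (eps / 2) _ _ (_ : 0 <= eps / 2) H.
  have -> : eps / 2 * (2 * c / eps) = c by field; lra.
  by apply; lra.
have a1 := Rle_abs (ln PI); have a2 := Rle_abs (- ln PI); rewrite Rabs_Ropp in a2.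
rewrite Rminus_0_r; rewrite /c in l5.
have -> : / INR n * ln (normaliser d n) = ln (normaliser d n) / INR n by rewrite /Rdiv; ring.
rewrite Rabs_div ?(Rabs_pos_eq (INR n)); try lra.
apply: (Rmult_le_reg_r (INR n)) => //.
rewrite /Rdiv Rmult_assoc Rinv_l ?Rmult_1_r; last lra.
have sq := sqrt_lt_R0 _ n0.
by apply: Rabs_le; lra.
Qed.

(** The three limits are read off from the weighted means of the integrand and the
    contrast; the susceptibility adds to the derivative of the local magnetization
    the fluctuations computed in [susceptibility_lim]. *)
Lemma thermo_limits (k : nat) (b B s : R) : 0 < b -> 0 < B ->
  equilibrium k (tanh b) B s -> 0 < stiffness (INR k) (tanh b) s ->
  [/\ pressure k.+1 b B = equil_pressure k b B s,
      magnetization k.+1 b B = equil_magnetization (tanh b) s &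
      susceptibility k.+1 b B = equil_susceptibility (INR k) (tanh b) s].
Proof.
move=> b0 B0 eq D0; have [cab ET uu vv uv] := thermo_setup b0.
set ca := sqrt (cosh b) in cab ET uu vv uv *.
set cb := sqrt (sinh b) in cab ET uu vv uv *.
set T := tanh b in ET eq D0 *.
have sT := eq_in eq; have T0 : 0 < T by lra.
have ca2 : 0 < ca * ca by nra.
have T1 : T < 1.
  rewrite ET; apply: (Rmult_lt_reg_r (ca * ca)) => //.
  by rewrite /Rdiv Rmult_assoc Rinv_l; nra.
have [t0 [c0 sn cT top] pk] := integrand_peak B0 cab ET eq.
have wf := integrand_weight k.+1 (ca, cb) (ca, - cb) B.
set d := k.+1 in pk wf top *; set u := (ca, cb) in uu uv pk wf top *.
set v := (ca, - cb) in vv uv pk wf top *.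
have ca0 : 0 < ca by lra.
have cb0 : 0 < cb by lra.
have [gm h10 h2E g1E] := peak_values ca0 cb0 ET T1 eq sn c0.
rewrite -/d -/u -/v in gm h10 h2E g1E.
have h0 := peak_pos pk.
set h := integrand d u v B in pk wf gm h2E g1E h0 top *.
set g := contrast d u v B in gm *.
have ch := peak_c0 pk.
have cg : forall x : R, continuous g x by move=> x; rewrite /g; cont.
have ss : s * s < T * T by nra.
have s1 : s * s < 1 by nra.
have q0 : 0 < T + s * s by nra.
have dk : 0 < INR d by apply: lt_0_INR; rewrite /d; lia.
have evn : admissible d (fun n => ~~ odd (d * n.+2)).
  by exists 0%N => n _; rewrite !oddM /= negbK.
have I0 := wint_gt0 pk wf.
have chh : forall x : R, continuous (fun x : R => h x * h x) x by move=> x; cont.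
have cgg : forall x : R, continuous (fun x : R => g x * g x) x by move=> x; cont.
have chg : forall x : R, continuous (fun x : R => h x * g x) x by move=> x; cont.
have Lhh := wmean_lim pk wf chh; have Lhg := wmean_lim pk wf chg; have Lgg := wmean_lim pk wf cgg.
have hh0 : h t0 * h t0 <> 0 by nra.
have hhpos : 0 < h t0 * h t0 / 2 by nra.
have A0 : admissible d (fun n => wmean h (- (PI / 2)) (PI / 2) n (fun x => h x * h x) <> 0).
  apply: filter_imp (proj1 (filterlim_R (admissible_filter d) _ _) Lhh _ hhpos) => n H z.
  by move: H; rewrite z Rminus_0_l Rabs_Ropp Rabs_pos_eq; nra.
have m0 n : mixed d u v n.+2 0 B = wint h (- (PI / 2)) (PI / 2) n (fun x => h x * h x).
  by rewrite -addn2 mixed_wint; apply: RInt_ext => t _; rewrite /h /=; ring.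
have m1 n : mixed d u v n.+1 1 B = wint h (- (PI / 2)) (PI / 2) n (fun x => h x * g x).
  by rewrite -addn1 mixed_wint; apply: RInt_ext => t _; rewrite /h /g /=; ring.
have m2 n : mixed d u v n 2 B = wint h (- (PI / 2)) (PI / 2) n (fun x => g x * g x).
  have := mixed_wint d u v n 0 2 B; rewrite addn0 => ->.
  by apply: RInt_ext => t _; rewrite /h /g /=; ring.
split; apply: thermo_lim_eq.
- have c1 : filterlim (fun n => / INR n * ln (wint h (- (PI / 2)) (PI / 2) n one))
     (admissible d) (locally (ln (h t0))) by apply: (wint_pressure pk wf).
  pose proof (flim_plus (normaliser_negligible d) c1) as L.
  apply: (flim_eq L); last by rewrite top ln_exp Rplus_0_l.
  exists 0%N => n _ dn; have [p E] := pressure_formula B uu vv uv dn.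
  have nz : 0 < normaliser d n.
    by have [+ _] := normaliser_bounds dn; have := Rinv_0_lt_compat _ PI_RGT_0; lra.
  have mE : mixed d u v n 0 B = wint h (- (PI / 2)) (PI / 2) n one.
    by apply: RInt_ext => t _; rewrite /h /one /=; ring.
  by rewrite E ln_mult // mE; ring.
- apply: admissible_shift2.
  pose proof (flim_mult Lhg (flim_inv hh0 Lhh)) as L.
  apply: (flim_eq L); last by rewrite gm; field; lra.
  apply: filter_imp (filter_and _ _ (filter_and _ _ evn I0) A0) => n [[dn J0] a0].
  rewrite (magnetization_formula B uu vv uv dn) m0 m1.
  move: a0; rewrite /wmean => a0; field; split; last lra.
  by move=> z; apply: a0; rewrite z /Rdiv Rmult_0_l.
- have h2n : integrand2 k u v B t0 < 0.
    rewrite h2E; apply: Ropp_lt_gt_0_contravar; apply: Rdiv_lt_0_compat.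
      by apply: Rmult_lt_0_compat => //; apply: Rmult_lt_0_compat.
    by apply: Rmult_lt_0_compat; lra.
  have V := susceptibility_lim pk wf (contrast_derive k u v B) gm h10 h2n.
  apply: admissible_shift2.
  pose proof (flim_minus (@flim_const _ (admissible d) _ 1) (flim_mult Lgg (flim_inv hh0 Lhh))) as L1.
  pose proof (flim_plus L1 V) as L.
  apply: (flim_eq L); last first.
    rewrite gm g1E h2E /equil_susceptibility /equil_magnetization.
    have -> : INR d * (ca / cb) * h t0 * (T * T - s * s) / (T + s * s) *
      (INR d * (ca / cb) * h t0 * (T * T - s * s) / (T + s * s)) =
      (ca / cb) * (ca / cb) * ((INR d * h t0 * (T * T - s * s) / (T + s * s)) ^ 2).
      by field; lra.
    have -> : ca / cb * (ca / cb) = / T by rewrite ET; field; lra.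
    rewrite /d S_INR in dk *; rewrite /stiffness in D0 *.
    by field; repeat split; try lra; nra.
  apply: filter_imp (filter_and _ _ (filter_and _ _ evn I0) A0) => n [[dn J0] a0].
  rewrite (susceptibility_formula B uu vv uv dn) m0 m1 m2.
  rewrite (S_INR n.+1); move: (INR n.+1) => kn.
  move: a0; rewrite /wmean -/g => a0.
  move: J0 a0; move: (wint _ _ _ _ one) (wint _ _ _ _ (fun x => h x * h x))
    (wint _ _ _ _ (fun x => h x * g x)) (wint _ _ _ _ (fun x => g x * g x)) => I A G Q I1 a0.
  have A1 : A <> 0 by move=> z; apply: a0; rewrite z /Rdiv Rmult_0_l.
  by field; lra.
Qed.

(** * The equilibrium equation *)

(** [artanh (s / T) - k * artanh s], the field in which [s] is stationary: with
    [x = artanh s] the equation reads [tanh x = T * tanh (B + k * x)], the recursion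
    for cavity fields on the tree. *)
Definition field_of (k : nat) (T s : R) : R :=
  ln ((T + s) / (T - s)) / 2 - INR k / 2 * ln ((1 + s) / (1 - s)).

Lemma field_of0 (k : nat) (T : R) : 0 < T -> field_of k T 0 = 0.
Proof.
move=> T0; rewrite /field_of.
have -> : (T + 0) / (T - 0) = 1 by field; lra.
have -> : (1 + 0) / (1 - 0) = 1 by field.
by rewrite ln_1; lra.
Qed.

Lemma field_of_derive (k : nat) (T s : R) : T < 1 -> 0 <= s < T ->
  is_derive (field_of k T) s
    (stiffness (INR k) T s / ((T * T - s * s) * (1 - s * s))).
Proof.
move=> T1 sT; rewrite /field_of /stiffness.
have ss : 0 < T * T - s * s by nra.
have s1 : 0 < 1 - s * s by nra.
auto_derive.
  have p1 : 0 < (T + s) / (T - s) by apply: Rdiv_lt_0_compat; lra.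
  have p2 : 0 < (1 + s) / (1 - s) by apply: Rdiv_lt_0_compat; lra.
  by rewrite /Rdiv /Rminus in p1 p2; repeat split; try lra.
by move: (INR k) => K; field; repeat split; lra.
Qed.

Lemma balance_field (k : nat) (T B s : R) : T < 1 -> 0 <= s < T ->
  balance k T B s =
  exp (- B) * ((1 - s) ^ k * (T + s)) * (exp (2 * (B - field_of k T s)) - 1).
Proof.
move=> T1 sT.
have p1 : 0 < (T + s) / (T - s) by apply: Rdiv_lt_0_compat; lra.
have p2 : 0 < (1 + s) / (1 - s) by apply: Rdiv_lt_0_compat; lra.
have -> : 2 * (B - field_of k T s) =
    (B + B) + (INR k * ln ((1 + s) / (1 - s)) + - ln ((T + s) / (T - s))).
  by rewrite /field_of; field.
rewrite !exp_plus (exp_Ropp (ln _)) exp_ln // -ln_pow // exp_ln; last exact: pow_lt.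
rewrite /balance exp_Ropp; have eB := exp_pos B.
have -> : (1 + s) ^ k = ((1 + s) / (1 - s)) ^ k * (1 - s) ^ k.
  by rewrite -Rpow_mult_distr; congr (_ ^ _); field; lra.
by field; repeat split; lra.
Qed.

Lemma balance_gt0 (k : nat) (T B s : R) : T < 1 -> 0 <= s < T ->
  field_of k T s < B -> 0 < balance k T B s.
Proof.
move=> T1 sT fB; rewrite balance_field //.
apply: Rmult_lt_0_compat; last first.
  have : exp 0 < exp (2 * (B - field_of k T s)) by apply: exp_increasing; lra.
  by rewrite exp_0; lra.
apply: Rmult_lt_0_compat; first exact: exp_pos.
by apply: Rmult_lt_0_compat; [apply: pow_lt | ]; lra.
Qed.

Lemma balance_lt0 (k : nat) (T B s : R) : T < 1 -> 0 <= s < T ->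
  B < field_of k T s -> balance k T B s < 0.
Proof.
move=> T1 sT fB; rewrite balance_field //.
have : exp (2 * (B - field_of k T s)) < exp 0 by apply: exp_increasing; lra.
rewrite exp_0 => e1.
have : 0 < exp (- B) * ((1 - s) ^ k * (T + s)).
  apply: Rmult_lt_0_compat; first exact: exp_pos.
  by apply: Rmult_lt_0_compat; [apply: pow_lt | ]; lra.
by nra.
Qed.

Lemma balance_eq0 (k : nat) (T B s : R) : T < 1 -> 0 <= s < T ->
  field_of k T s = B <-> balance k T B s = 0.
Proof.
move=> T1 sT; split=> [E|E].
  by rewrite balance_field // E Rminus_diag Rmult_0_r exp_0 Rminus_diag Rmult_0_r.
case: (Rtotal_order (field_of k T s) B) => [lt|[//|gt]].
  by have := balance_gt0 T1 sT lt; lra.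
by have := balance_lt0 T1 sT gt; lra.
Qed.

Lemma deriv_compare (f g f' g' : R -> R) (a b : R) : a <= b ->
  (forall x, a <= x <= b -> is_derive f x (f' x)) ->
  (forall x, a <= x <= b -> is_derive g x (g' x)) ->
  (forall x, a <= x <= b -> f' x <= g' x) -> f b - f a <= g b - g a.
Proof.
move=> ab df dg le; case: (Req_dec a b) => [->|ne]; first lra.
have lt : a < b by lra.
have D x : a <= x <= b -> derivable_pt_lim (fun x => g x - f x) x (g' x - f' x).
  move=> xab; apply/is_derive_Reals.
  exact: (is_derive_minus _ _ _ _ _ (dg x xab) (df x xab)).
have [c [E ci]] := MVT_cor2 _ _ a b lt D.
have lec : f' c <= g' c by apply: le; lra.
have := Rmult_le_pos (g' c - f' c) (b - a); lra.
Qed.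

Lemma stiffness_mono (K T r s : R) : T < K -> 0 <= r < s -> stiffness K T r < stiffness K T s.
Proof.
move=> TK rs; have lt : r * r < s * s by nra.
have := Rmult_lt_compat_l (K - T) _ _ (_ : 0 < K - T) lt; rewrite /stiffness.
by move=> /(_ ltac:(lra)); lra.
Qed.

(** [field_of k T] decreases, then increases: where it is nonnegative it is
    already in its increasing part. *)
Lemma stiffness_gt0 (k : nat) (T s : R) : T < 1 -> 1 <= INR k -> 0 < s < T ->
  0 <= field_of k T s -> 0 < stiffness (INR k) T s.
Proof.
move=> T1 k1 sT f0; case: (Rlt_le_dec 0 (stiffness (INR k) T s)) => // neg.
have D x : 0 <= x <= s -> derivable_pt_lim (field_of k T) x
    (stiffness (INR k) T x / ((T * T - x * x) * (1 - x * x))).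
  by move=> xs; apply/is_derive_Reals; apply: field_of_derive; lra.
have [c [E ci]] := MVT_cor2 _ _ 0 s (proj1 sT) D.
rewrite field_of0 in E; last lra.
have sc : stiffness (INR k) T c < 0.
  by have := @stiffness_mono (INR k) T c s; lra.
have w0 : 0 < (T * T - c * c) * (1 - c * c) by apply: Rmult_lt_0_compat; nra.
have : stiffness (INR k) T c / ((T * T - c * c) * (1 - c * c)) < 0.
  by apply: Rdiv_neg_pos.
by nra.
Qed.

Lemma field_of_mono (k : nat) (T r s : R) : T < 1 -> 1 <= INR k -> 0 < r < s -> s < T ->
  0 <= field_of k T r -> field_of k T r < field_of k T s.
Proof.
move=> T1 k1 rs sT f0; have D0 := stiffness_gt0 T1 k1 (conj (proj1 rs) (_ : r < T)) f0.
have {}D0 := D0 (Rlt_trans _ _ _ (proj2 rs) sT).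
have D x : r <= x <= s -> derivable_pt_lim (field_of k T) x
    (stiffness (INR k) T x / ((T * T - x * x) * (1 - x * x))).
  by move=> xs; apply/is_derive_Reals; apply: field_of_derive; lra.
have [c [E ci]] := MVT_cor2 _ _ r s (proj2 rs) D.
have sc : stiffness (INR k) T r < stiffness (INR k) T c by apply: stiffness_mono; lra.
have w0 : 0 < (T * T - c * c) * (1 - c * c) by apply: Rmult_lt_0_compat; nra.
have : 0 < stiffness (INR k) T c / ((T * T - c * c) * (1 - c * c)).
  by apply: Rdiv_lt_0_compat; lra.
by nra.
Qed.

Lemma field_of_solve (k : nat) (T r B : R) : T < 1 -> 0 <= r < T ->
  field_of k T r < B -> exists2 s, r < s < T & field_of k T s = B.
Proof.
move=> T1 rT fB.
have br := balance_gt0 T1 rT fB.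
have bT : balance k T B T < 0.
  rewrite /balance Rminus_diag Rmult_0_r Rminus_0_l.
  apply: Ropp_lt_gt_0_contravar; apply: Rmult_lt_0_compat; last lra.
  by apply: Rmult_lt_0_compat; [apply: exp_pos | apply: pow_lt; lra].
have ct : continuity (balance k T B).
  move=> x; have ex : ex_derive (balance k T B) x by rewrite /balance; auto_derive.
  by apply/continuity_pt_filterlim; exact: (ex_derive_continuous _ _ ex).
have sgn : balance k T B r * balance k T B T <= 0 by nra.
have [z [zi bz]] := IVT_cor _ r T ct (Rlt_le _ _ (proj2 rT)) sgn.
have zr : z <> r by move=> e; rewrite e in bz; lra.
have zT : z <> T by move=> e; rewrite e in bz; lra.
by exists z; [lra | apply/balance_eq0 => //; lra].
Qed.

Lemma field_of_equilibrium (k : nat) (T B s : R) : T < 1 -> 1 <= INR k -> 0 < B ->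
  0 < s < T -> field_of k T s = B -> equilibrium k T B s.
Proof.
move=> T1 k1 B0 sT fs.
have T0 : 0 < T by lra.
split=> //; first by apply/balance_eq0 => //; lra.
- move=> r rs; apply: balance_gt0 => //; first lra.
  case: (Rlt_le_dec (field_of k T r) B) => // fr.
  have r0 : r <> 0 by move=> e; rewrite e field_of0 // in fr; lra.
  have rs' : 0 < r < s by lra.
  have := @field_of_mono k T r s T1 k1 rs' (proj2 sT); lra.
- move=> r rs; case: (Rlt_le_dec r T) => rT.
    apply: balance_lt0 => //; first lra.
    have sr : 0 < s < r by lra.
    by have := @field_of_mono k T s r T1 k1 sr rT; lra.
  rewrite /balance.
  have q1 : 0 < exp B * (1 + r) ^ k by apply: Rmult_lt_0_compat; [apply: exp_pos | apply: pow_lt; lra].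
  have q2 : 0 <= exp (- B) * (1 - r) ^ k.
    by apply: Rmult_le_pos; [apply: Rlt_le; apply: exp_pos | apply: pow_le; lra].
  case: (Rle_lt_or_eq_dec _ _ rT) => [lt|e]; first by nra.
  rewrite -e in rs q2 *.
  have : 0 < exp (- B) * (1 - T) ^ k.
    by apply: Rmult_lt_0_compat; [apply: exp_pos | apply: pow_lt; lra].
  by nra.
Qed.

(** The solution is unique for [0 <= B], by [root_ofP]. *)
Definition root_of (k : nat) (T B : R) : R :=
  Hierarchy.iota (fun s : R => 0 < s < T /\ field_of k T s = B).

Lemma root_ofP (k : nat) (T B s : R) : T < 1 -> 1 <= INR k -> 0 <= B ->
  0 < s < T -> field_of k T s = B -> root_of k T B = s.
Proof.
move=> T1 k1 B0 sT fs.
apply: (@iota_unique R_AbsRing R_CompleteNormedModule) => // y [yT fy].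
case: (Rtotal_order y s) => [lt|[//|gt]].
  have ys : 0 < y < s by lra.
  by have := field_of_mono T1 k1 ys (proj2 sT); lra.
have sy : 0 < s < y by lra.
by have := field_of_mono T1 k1 sy (proj2 yT); lra.
Qed.

Lemma root_of_solve (k : nat) (T B : R) : 0 < T < 1 -> 1 <= INR k -> 0 < B ->
  0 < root_of k T B < T /\ field_of k T (root_of k T B) = B.
Proof.
move=> T01 k1 B0.
have f0 : field_of k T 0 < B by rewrite field_of0; lra.
have [s sT fs] := field_of_solve (proj2 T01) (conj (Rle_refl 0) (proj1 T01)) f0.
by rewrite (root_ofP (proj2 T01) k1 (Rlt_le _ _ B0) sT fs).
Qed.

Lemma lt_root_of (k : nat) (T B r : R) : 0 < T < 1 -> 1 <= INR k -> 0 < B ->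
  0 < r < T -> field_of k T r < B -> r < root_of k T B.
Proof.
move=> T01 k1 B0 rT fr; have [sT fs] := root_of_solve T01 k1 B0.
case: (Rlt_le_dec r (root_of k T B)) => // sr.
case: (Req_dec r (root_of k T B)) => [e|ne]; first by rewrite e in fr; lra.
have sr' : 0 < root_of k T B < r by lra.
by have := field_of_mono (proj2 T01) k1 sr' (proj2 rT); lra.
Qed.

Lemma root_of_lt (k : nat) (T B r : R) : 0 < T < 1 -> 1 <= INR k -> 0 < B ->
  0 < r < T -> B < field_of k T r -> root_of k T B < r.
Proof.
move=> T01 k1 B0 rT fr; have [sT fs] := root_of_solve T01 k1 B0.
case: (Rlt_le_dec (root_of k T B) r) => // sr.
case: (Req_dec r (root_of k T B)) => [e|ne]; first by rewrite e in fr; lra.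
have sr' : 0 < r < root_of k T B by lra.
by have := field_of_mono (proj2 T01) k1 sr' (proj2 sT); lra.
Qed.

Lemma tanh_in01 (b : R) : 0 < b -> 0 < tanh b < 1.
Proof.
move=> b0; rewrite /tanh /sinh /cosh.
have e1 : exp (- b) < exp b by apply: exp_increasing; lra.
have e2 := exp_pos (- b).
split; first by apply: Rdiv_lt_0_compat; lra.
apply: (Rmult_lt_reg_r ((exp b + exp (- b)) / 2)); first lra.
by rewrite /Rdiv Rmult_assoc Rinv_l; lra.
Qed.

Lemma positive_field (k : nat) (b B : R) : 1 <= INR k -> 0 < b -> 0 < B ->
  let s := root_of k (tanh b) B in
  [/\ pressure k.+1 b B = equil_pressure k b B s,
      magnetization k.+1 b B = equil_magnetization (tanh b) s,
      susceptibility k.+1 b B = equil_susceptibility (INR k) (tanh b) s &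
      0 < stiffness (INR k) (tanh b) s].
Proof.
move=> k1 b0 B0 s; have T01 := tanh_in01 b0.
have [sT fs] := root_of_solve T01 k1 B0; rewrite -/s in sT fs.
have D0 : 0 < stiffness (INR k) (tanh b) s.
  by apply: (stiffness_gt0 (proj2 T01) k1 sT); rewrite fs; lra.
have [p m x] := thermo_limits b0 B0 (field_of_equilibrium (proj2 T01) k1 B0 sT fs) D0.
by split.
Qed.

(** The zero of the field that the root selects as [B] decreases to [0], by
    [root_of_right_lim]: the last one before the field becomes positive. *)
Definition spontaneous (k : nat) (T s : R) : Prop :=
  [/\ 0 <= s < T, field_of k T s = 0 & forall r, s < r < T -> 0 < field_of k T r].

Lemma spontaneous_high (k : nat) (T : R) : 0 < T < 1 -> 1 <= INR k -> INR k * T <= 1 ->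
  spontaneous k T 0.
Proof.
move=> T01 k1 kT; split; [lra | by apply: field_of0; lra |] => r rT.
have D x : 0 <= x <= r -> derivable_pt_lim (field_of k T) x
    (stiffness (INR k) T x / ((T * T - x * x) * (1 - x * x))).
  by move=> xs; apply/is_derive_Reals; apply: field_of_derive; lra.
have [c [E ci]] := MVT_cor2 _ _ 0 r (proj1 rT) D.
rewrite field_of0 in E; last lra.
have sc : 0 < stiffness (INR k) T c.
  have := @stiffness_mono (INR k) T 0 c; rewrite {1}/stiffness; nra.
have w0 : 0 < (T * T - c * c) * (1 - c * c) by apply: Rmult_lt_0_compat; nra.
have : 0 < stiffness (INR k) T c / ((T * T - c * c) * (1 - c * c)).
  by apply: Rdiv_lt_0_compat; lra.
by nra.
Qed.

(** Above the critical coupling the field is negative up to the zero of the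
    stiffness, so that it vanishes again beyond it. *)
Lemma spontaneous_low (k : nat) (T : R) : 0 < T < 1 -> 1 <= INR k -> 1 < INR k * T ->
  spontaneous k T (root_of k T 0) /\ 0 < root_of k T 0.
Proof.
move=> T01 k1 kT.
pose q := T * (INR k * T - 1) / (INR k - T).
have q0 : 0 < q by apply: Rdiv_lt_0_compat; nra.
pose r := sqrt q; have r0 : 0 < r by apply: sqrt_lt_R0.
have rr : r * r = q by apply: sqrt_sqrt; lra.
have qE : q * (INR k - T) = T * (INR k * T - 1) by rewrite /q; field; nra.
have rT : r < T.
  apply: Rsqr_incrst_0; rewrite /Rsqr ?rr; try lra.
  apply: (Rmult_lt_reg_r (INR k - T)); first lra.
  by rewrite qE; nra.
have D x : 0 <= x <= r -> derivable_pt_lim (field_of k T) x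
    (stiffness (INR k) T x / ((T * T - x * x) * (1 - x * x))).
  by move=> xs; apply/is_derive_Reals; apply: field_of_derive; lra.
have [c [E ci]] := MVT_cor2 _ _ 0 r r0 D.
rewrite field_of0 in E; last lra.
have sc : stiffness (INR k) T c < 0.
  have := @stiffness_mono (INR k) T c r.
  have -> : stiffness (INR k) T r = 0 by rewrite /stiffness rr; lra.
  by apply; lra.
have w0 : 0 < (T * T - c * c) * (1 - c * c) by apply: Rmult_lt_0_compat; nra.
have nq : stiffness (INR k) T c / ((T * T - c * c) * (1 - c * c)) < 0.
  by apply: Rdiv_neg_pos.
have fr : field_of k T r < 0 by nra.
have [s srT fs] := field_of_solve (proj2 T01) (conj (Rlt_le _ _ r0) rT) fr.
have sT : 0 < s < T by lra.
rewrite (root_ofP (proj2 T01) k1 (Rle_refl 0) sT fs).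
split; last lra.
split=> //; first lra; move=> x xs.
have sx : 0 < s < x by lra.
by have := field_of_mono (proj2 T01) k1 sx (proj2 xs); lra.
Qed.

Lemma root_of_right_lim (k : nat) (T s : R) : 0 < T < 1 -> 1 <= INR k ->
  spontaneous k T s -> is_right_lim0 (root_of k T) s.
Proof.
move=> T01 k1 [sT fs up].
apply/(@filterlim_R _ (at_right 0) _) => eps e0.
have [e [ep e1 e2]] : exists e, [/\ 0 < e, e <= eps & s + e < T].
  exists (Rmin eps ((T - s) / 2)); have := Rmin_l eps ((T - s) / 2).
  have := Rmin_r eps ((T - s) / 2); split; try lra.
  by apply: Rmin_glb_lt; lra.
have f1 : 0 < field_of k T (s + e) by apply: up; lra.
exists (mkposreal _ f1) => B; rewrite /ball /= /AbsRing_ball /= /abs /minus /plus /opp /= => Bf B0.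
have {}Bf : B < field_of k T (s + e).
  by move: Bf; rewrite Rabs_pos_eq; lra.
have u1 : root_of k T B < s + e by apply: root_of_lt => //; lra.
have [rT _] := root_of_solve T01 k1 B0.
have l1 : s <= root_of k T B.
  case: (Req_dec s 0) => [->|ns]; first lra.
  by apply: Rlt_le; apply: lt_root_of; lra.
by apply: Rabs_le; lra.
Qed.

(** * Dependence on the temperature *)

Lemma tanh_derive (b : R) : is_derive tanh b (1 - tanh b * tanh b).
Proof.
rewrite /tanh /sinh /cosh.
have e1 := exp_pos b; have e2 := exp_pos (- b).
auto_derive; first by lra.
by field; lra.
Qed.

Lemma inverse_derive (g f : R -> R) (y l : R) :
  continuous f y -> locally y (fun z => g (f z) = z) -> is_derive g (f y) l -> l <> 0 ->
  is_derive f y (/ l).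
Proof.
move=> cf inv dg l0.
pose x0 := f y.
have gy : g x0 = y by apply: (locally_singleton _ _ inv).
pose q x := if Req_EM_T x x0 then l else (g x - g x0) / (x - x0).
have qE x : (x - x0) * q x = g x - g x0.
  rewrite /q; case: Req_EM_T => [e|ne] /=; first by rewrite e /Rminus !Rplus_opp_r Rmult_0_l.
  by field; lra.
have cq : continuous q x0.
  apply/(@filterlim_R _ (locally x0) _) => eps e0.
  have q0 : q x0 = l by rewrite /q; case: Req_EM_T.
  have [del Hd] := proj1 (is_derive_Reals _ _ _) dg eps e0.
  exists del => x xd; rewrite q0 /q; case: Req_EM_T => [e|ne] /=.
    by rewrite Rminus_diag Rabs_R0; lra.
  have := Hd (x - x0) (_ : x - x0 <> 0) xd.
  rewrite -/x0; have -> : x0 + (x - x0) = x by ring.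
  by move=> H; apply: Rlt_le; apply: H; lra.
have q0 : q (f y) = l by rewrite /q -/x0; case: Req_EM_T.
have lim : filterlim (fun z => / q (f z)) (locally y) (locally (/ l)).
  apply: flim_inv => //; rewrite -q0.
  exact: (flim_cont cf cq).
apply/is_derive_Reals => eps e0.
have e2 : 0 < eps / 2 by lra.
have [del Hd] := filter_and _ _ (proj1 (@filterlim_R _ (locally y) _ _ _) lim _ e2) inv.
exists del => t t0 td.
have yt : ball y del (y + t).
  rewrite /ball /= /AbsRing_ball /= /abs /minus /plus /opp /=.
  by have -> : y + t + - y = t by ring.
have [H1 H2] := Hd _ yt.
have E := qE (f (y + t)); rewrite H2 gy in E.
have q1 : q (f (y + t)) <> 0 by move=> z; rewrite z in E; lra.
have -> : (f (y + t) - f y) / t = / q (f (y + t)).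
  have -> : t = (f (y + t) - x0) * q (f (y + t)) by rewrite E; ring.
  have d0 : f (y + t) - x0 <> 0 by move=> z; rewrite z in E; lra.
  rewrite -/x0; have -> : y + (f (y + t) - x0) * q (f (y + t)) = y + t by rewrite E; ring.
  by field.
by lra.
Qed.

Lemma root_of_cont (k : nat) (T0 B : R) : 0 < T0 < 1 -> 1 <= INR k -> 0 < B ->
  continuous (fun T => root_of k T B) T0.
Proof.
move=> T01 k1 B0; have [sT fs] := root_of_solve T01 k1 B0.
set s0 := root_of k T0 B in sT fs *.
have cT r : 0 <= r < T0 -> continuous (fun T => field_of k T r) T0.
  move=> rT; apply: ex_derive_continuous; rewrite /field_of.
  have p1 : 0 < (T0 + r) / (T0 - r) by apply: Rdiv_lt_0_compat; lra.
  by rewrite /Rdiv /Rminus in p1; auto_derive; repeat split; lra.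
apply/(@filterlim_R _ (locally T0) _) => eps e0; rewrite -/s0.
have [e [ep e1 e2 e3]] : exists e, [/\ 0 < e, e <= eps, s0 + e < T0 & 0 < s0 - e].
  have [e ep [e1 e2 e3]] : exists2 e, 0 < e & [/\ e < eps, e < T0 - s0 & e < s0].
    by apply: below3; lra.
  by exists e; split; lra.
have f1 : field_of k T0 (s0 - e) < B.
  case: (Rlt_le_dec (field_of k T0 (s0 - e)) B) => // H.
  have lt : 0 < s0 - e < s0 by lra.
  by have := field_of_mono (proj2 T01) k1 lt (proj2 sT); lra.
have f2 : B < field_of k T0 (s0 + e).
  have lt : 0 < s0 < s0 + e by lra.
  by have := field_of_mono (proj2 T01) k1 lt e2; lra.
have L1 : locally T0 (fun T => field_of k T (s0 - e) < B).
  have r0 : 0 <= s0 - e < T0 by lra.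
  exact: (cT _ r0 _ (open_lt B _ f1)).
have L2 : locally T0 (fun T => B < field_of k T (s0 + e)).
  have r0 : 0 <= s0 + e < T0 by lra.
  exact: (cT _ r0 _ (open_gt B _ f2)).
have L3 : locally T0 (fun T => s0 + e < T) by exact: (open_gt (s0 + e) _ e2).
have L4 : locally T0 (fun T => T < 1) by exact: (open_lt 1 _ (proj2 T01)).
apply: filter_imp (filter_and _ _ (filter_and _ _ L1 L2) (filter_and _ _ L3 L4)) => T [[H1 H2] [H3 H4]].
have TT : 0 < T < 1 by lra.
have u1 : root_of k T B < s0 + e by apply: root_of_lt => //; lra.
have l1 : s0 - e < root_of k T B by apply: lt_root_of => //; lra.
by apply: Rabs_le; lra.
Qed.

(** In a fixed field the coupling [T = tanh b] is an explicit function of the root,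
    so that the root is differentiated by inverting a function of one variable. *)
Definition coupling_of (k : nat) (B s : R) : R :=
  s * (exp B * (1 + s) ^ k + exp (- B) * (1 - s) ^ k) /
      (exp B * (1 + s) ^ k - exp (- B) * (1 - s) ^ k).

Lemma coupling_of_root (k : nat) (T B s : R) : T < 1 -> 0 < s < T ->
  field_of k T s = B -> coupling_of k B s = T /\
  is_derive (coupling_of k B) s (stiffness (INR k) T s / (s * (1 - s * s))).
Proof.
move=> T1 sT fs.
have b0 : balance k T B s = 0 by apply/balance_eq0 => //; lra.
have s01 : 0 <= s < T by lra.
have [lam l0 [X Y]] := balance_factor sT (Rlt_trans _ _ _ (proj2 sT) T1) b0.
have ss : 0 < T * T - s * s by nra.
have den : exp B * (1 + s) ^ k - exp (- B) * (1 - s) ^ k = lam * (2 * s) / (T * T - s * s).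
  by rewrite X Y; field; repeat split; lra.
have den0 : 0 < exp B * (1 + s) ^ k - exp (- B) * (1 - s) ^ k.
  by rewrite den; apply: Rdiv_lt_0_compat => //; apply: Rmult_lt_0_compat; lra.
have K1 x : x <> 0 -> INR k * x ^ k.-1 = INR k * x ^ k / x.
  by move=> x0; case: (k) => [|k']; [rewrite /=; field | rewrite -tech_pow_Rmult /=; field].
split.
  by rewrite /coupling_of den X Y; field; repeat split; lra.
rewrite /coupling_of; auto_derive.
  by rewrite /Rminus in den0; lra.
rewrite (_ : 1 + - s = 1 - s) //.
rewrite (K1 (1 + s)); last lra.
rewrite (K1 (1 - s)); last lra.
have C1 a U : a * (1 * (INR k * U / (1 + s))) = INR k * (a * U) / (1 + s) by field; lra.
have C2 a U : a * (- (1) * (INR k * U / (1 - s))) = - (INR k * (a * U) / (1 - s)) by field; lra.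
rewrite !C1 !C2 X Y /stiffness; move: (INR k) => K.
by field; repeat split; nra.
Qed.

Lemma root_of_derive (k : nat) (T B : R) : 0 < T < 1 -> 1 <= INR k -> 0 < B ->
  let s := root_of k T B in
  is_derive (fun T => root_of k T B) T (s * (1 - s * s) / stiffness (INR k) T s).
Proof.
move=> T01 k1 B0 s; have [sT fs] := root_of_solve T01 k1 B0; rewrite -/s in sT fs.
have D0 : 0 < stiffness (INR k) T s by apply: (stiffness_gt0 (proj2 T01)); lra.
have [_ dt] := coupling_of_root (proj2 T01) sT fs.
have s1 : 0 < 1 - s * s by nra.
have -> : s * (1 - s * s) / stiffness (INR k) T s =
          / (stiffness (INR k) T s / (s * (1 - s * s))) by field; lra.
apply: (inverse_derive (g := coupling_of k B)) => //.
- exact: root_of_cont.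
- have L1 : locally T (fun x => x < 1) by exact: (open_lt 1 _ (proj2 T01)).
  have L2 : locally T (fun x => 0 < x) by exact: (open_gt 0 _ (proj1 T01)).
  apply: filter_imp (filter_and _ _ L1 L2) => x [x1 x0].
  have [sx fx] := root_of_solve (conj x0 x1) k1 B0.
  by have [] := coupling_of_root x1 sx fx.
- have : 0 < stiffness (INR k) T s / (s * (1 - s * s)).
    by apply: Rdiv_lt_0_compat => //; apply: Rmult_lt_0_compat; lra.
  by lra.
Qed.

Definition equil_energy (k T s : R) : R :=
  (k + 1) / 2 * ((T ^ 3 + s ^ 2) / (T * (T + s ^ 2))).

Definition equil_heat (k T s : R) : R :=
  (k + 1) / 2 * (1 - T * T) *
  ((T ^ 4 + 2 * T ^ 3 * s ^ 2 - 2 * T * s ^ 2 - s ^ 4) / (T ^ 2 * (T + s ^ 2) ^ 2) +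
   2 * (1 - T * T) * s ^ 2 * (1 - s ^ 2) / ((T + s ^ 2) ^ 2 * stiffness k T s)).

Lemma slope_weight_derive (k : nat) (T B s : R) : T < 1 -> 0 < s < T ->
  field_of k T s = B ->
  is_derive (slope_weight k B) s (slope_weight k B s * (INR k.+1 * s / (T + s * s))).
Proof.
move=> T1 sT fs.
have b0 : balance k T B s = 0 by apply/balance_eq0 => //; lra.
have [lam _ [X Y]] := balance_factor sT (Rlt_trans _ _ _ (proj2 sT) T1) b0.
have q0 : 0 < T + s * s by nra.
rewrite /slope_weight; auto_derive => //.
rewrite -/(INR k.+1) -!tech_pow_Rmult (_ : 1 + - s = 1 - s) //; move: (INR k.+1) => K.
have -> : exp B * (1 * (K * (1 + s) ^ k)) + exp (- B) * (- (1) * (K * (1 - s) ^ k)) =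
  K * (exp B * (1 + s) ^ k - exp (- B) * (1 - s) ^ k) by ring.
have -> : exp B * ((1 + s) * (1 + s) ^ k) + exp (- B) * ((1 - s) * (1 - s) ^ k) =
  (1 + s) * (exp B * (1 + s) ^ k) + (1 - s) * (exp (- B) * (1 - s) ^ k) by ring.
by rewrite X Y; field; lra.
Qed.

(** The root maximises the pressure, so its own variation does not contribute. *)
Lemma pressure_derive (k : nat) (b B : R) : 1 <= INR k -> 0 < b -> 0 < B ->
  is_derive (fun b => equil_pressure k b B (root_of k (tanh b) B)) b
            (equil_energy (INR k) (tanh b) (root_of k (tanh b) B)).
Proof.
move=> k1 b0 B0; have T01 := tanh_in01 b0.
have [sT fs] := root_of_solve T01 k1 B0.
pose S b := root_of k (tanh b) B.
have dS := is_derive_comp _ _ _ _ _ (root_of_derive T01 k1 B0) (tanh_derive b).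
have dW := is_derive_comp (slope_weight k B) S b _ _ (slope_weight_derive (proj2 T01) sT fs) dS.
rewrite -/(S b) in dW dS sT fs *.
set s' := scal _ _ in dS dW.
have dT := tanh_derive b.
have W0 : 0 < slope_weight k B (S b) by apply: slope_weight_gt0; lra.
rewrite /equil_pressure /log_profile -/(S _).
set T := tanh b in T01 sT fs dT dS dW *.
have exS : ex_derive S b by exists s'.
have exT : ex_derive tanh b by exists (1 - T * T).
have cosh0 : 0 < cosh b by rewrite /cosh; have := exp_pos b; have := exp_pos (- b); lra.
have dc : is_derive cosh b (sinh b) by rewrite /cosh /sinh; auto_derive => //; field.
have exc : ex_derive cosh b by exists (sinh b).
pose W b := slope_weight k B (S b).
have exW : ex_derive W b by eexists; exact: dW.
have DW : Derive W b = s' * (slope_weight k B (S b) * (INR k.+1 * S b / (T + S b * S b))).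
  by apply: is_derive_unique; exact: dW.
have DS : Derive S b = s' by apply: is_derive_unique; exact: dS.
have DT : Derive tanh b = 1 - T * T by apply: is_derive_unique.
have Dc : Derive cosh b = sinh b by apply: is_derive_unique.
have r0 : 0 < 1 + S b * S b / T.
  by have := Rdiv_le_0_compat (S b * S b) T (Rle_0_sqr (S b)) (proj1 T01); lra.
have q0 : 0 < T + S b * S b by nra.
apply: (is_derive_ext (fun b => INR k.+1 * ln (sqrt (cosh b)) +
   (ln (W b) - INR k.+1 / 2 * ln (1 + S b * S b / tanh b)))) => //.
have sq := sqrt_lt_R0 _ cosh0.
auto_derive.
  by repeat split => //; rewrite -/T; lra.
have E1 : 1 * sinh b * / (2 * sqrt (cosh b)) * / sqrt (cosh b) = T / 2.
  rewrite /T /tanh -{3}(sqrt_sqrt (cosh b)); last lra.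
  by field; lra.
rewrite -/(INR k.+1) E1 -/T.
change (Derive (fun x : R => W x) b) with (Derive W b).
change (Derive (fun x : R => S x) b) with (Derive S b).
change (Derive (fun x : R => tanh x) b) with (Derive tanh b).
rewrite DW DS DT /equil_energy -/(W b) S_INR.
change (0 < W b) in W0.
move: (S b) (W b) W0 sT r0 q0 (INR k) s' {dS dW DW DS fs} => s w w0 sT r0 q0 K s'.
by field; lra.
Qed.

Lemma energy_derive (k : nat) (b B : R) : 1 <= INR k -> 0 < b -> 0 < B ->
  is_derive (fun b => equil_energy (INR k) (tanh b) (root_of k (tanh b) B)) b
            (equil_heat (INR k) (tanh b) (root_of k (tanh b) B)).
Proof.
move=> k1 b0 B0; have T01 := tanh_in01 b0.
have [sT fs] := root_of_solve T01 k1 B0.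
have D0 : 0 < stiffness (INR k) (tanh b) (root_of k (tanh b) B).
  by apply: (stiffness_gt0 (proj2 T01)); lra.
pose S b := root_of k (tanh b) B.
have dT := tanh_derive b.
have dS := is_derive_comp (fun T => root_of k T B) tanh b _ _ (root_of_derive T01 k1 B0) dT.
rewrite -/(S b) in dS sT D0 *.
have exS : ex_derive S b by eexists; exact: dS.
have exT : ex_derive tanh b by eexists; exact: dT.
have DT : Derive tanh b = 1 - tanh b * tanh b by apply: is_derive_unique.
have DS : Derive S b = (1 - tanh b * tanh b) * (S b * (1 - S b * S b) / stiffness (INR k) (tanh b) (S b)).
  by apply: is_derive_unique; exact: dS.
have q0 : 0 < tanh b + S b * S b by nra.
apply: (is_derive_ext (fun b => equil_energy (INR k) (tanh b) (S b))) => //.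
rewrite /equil_energy; auto_derive.
  repeat split => //; apply: Rgt_not_eq; apply: Rmult_lt_0_compat; try lra.
change (Derive (fun x : R => S x) b) with (Derive S b).
change (Derive (fun x : R => tanh x) b) with (Derive tanh b).
rewrite DS DT /equil_heat.
move: (S b) (tanh b) (stiffness _ _ _) T01 sT q0 D0 => s T D T01 sT q0 D0.
by field; repeat split; nra.
Qed.

Lemma specific_heat_field (k : nat) (b B : R) : 1 <= INR k -> 0 < b -> 0 < B ->
  specific_heat k.+1 b B = equil_heat (INR k) (tanh b) (root_of k (tanh b) B).
Proof.
move=> k1 b0 B0; rewrite /specific_heat [Derive_n _ _ _]/=.
have near x : 0 < x -> locally x (fun y => 0 < y) by move=> x0; exact: (open_gt 0 x x0).
rewrite (Derive_ext_loc _ (fun b => equil_energy (INR k) (tanh b) (root_of k (tanh b) B))).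
  by apply: is_derive_unique; apply: energy_derive.
apply: filter_imp (near b b0) => x x0.
apply: is_derive_unique.
apply: (is_derive_ext_loc (fun b => equil_pressure k b B (root_of k (tanh b) B))).
  apply: filter_imp (near x x0) => y y0.
  by have [-> _ _ _] := positive_field k1 y0 B0.
exact: pressure_derive.
Qed.

(** * Zero-field limits *)

Lemma right_lim_comp (k : nat) (T s : R) (phi : R -> R) (f : R -> R) :
  0 < T < 1 -> 1 <= INR k -> spontaneous k T s -> ex_derive phi s ->
  (forall B, 0 < B -> f B = phi (root_of k T B)) -> is_right_lim0 f (phi s).
Proof.
move=> T01 k1 sp ex E.
have cphi : continuous phi s by apply: ex_derive_continuous.
have L := flim_cont (root_of_right_lim T01 k1 sp) cphi.
apply: filterlim_ext_loc L.
by exists (mkposreal _ Rlt_0_1) => B _ B0; rewrite E.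
Qed.

Lemma magnetization_right0 (k : nat) (b s : R) : 1 <= INR k -> 0 < b ->
  spontaneous k (tanh b) s ->
  is_right_lim0 (magnetization k.+1 b) (equil_magnetization (tanh b) s).
Proof.
move=> k1 b0 sp; have T01 := tanh_in01 b0.
have s2 := Rle_0_sqr s; rewrite /Rsqr in s2.
apply: (right_lim_comp T01 k1 sp) => [|B B0].
  by rewrite /equil_magnetization; auto_derive; lra.
by have [_ -> _ _] := positive_field k1 b0 B0.
Qed.

Lemma susceptibility_right0 (k : nat) (b s : R) : 1 <= INR k -> 0 < b ->
  spontaneous k (tanh b) s -> 0 < stiffness (INR k) (tanh b) s ->
  is_right_lim0 (susceptibility k.+1 b) (equil_susceptibility (INR k) (tanh b) s).
Proof.
move=> k1 b0 sp D0; have T01 := tanh_in01 b0.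
have s2 := Rle_0_sqr s; rewrite /Rsqr in s2.
apply: (right_lim_comp T01 k1 sp) => [|B B0].
  rewrite /equil_susceptibility /stiffness in D0 *; auto_derive; move=> z.
  have : 0 < (tanh b + s * s) * (tanh b + s * s) *
    (tanh b * (1 - INR k * tanh b) + (INR k - tanh b) * (s * s)).
    by apply: Rmult_lt_0_compat => //; apply: Rmult_lt_0_compat; lra.
  by rewrite /Rminus; lra.
by have [_ _ -> _] := positive_field k1 b0 B0.
Qed.

Lemma specific_heat_right0 (k : nat) (b s : R) : 1 <= INR k -> 0 < b ->
  spontaneous k (tanh b) s -> 0 < stiffness (INR k) (tanh b) s ->
  is_right_lim0 (specific_heat k.+1 b) (equil_heat (INR k) (tanh b) s).
Proof.
move=> k1 b0 sp D0; have T01 := tanh_in01 b0.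
have s2 := Rle_0_sqr s; rewrite /Rsqr in s2.
apply: (right_lim_comp T01 k1 sp) => [|B B0].
  rewrite /equil_heat /stiffness in D0 *; auto_derive.
  have q0 : 0 < (tanh b + s * s) * (tanh b + s * s) by apply: Rmult_lt_0_compat; lra.
  have t0 : 0 < tanh b * tanh b by nra.
  split; last split => //; apply: Rgt_not_eq.
    by have := Rmult_lt_0_compat _ _ t0 q0; lra.
  by have := Rmult_lt_0_compat _ _ q0 D0; lra.
exact: specific_heat_field.
Qed.

(** * The critical point *)

Definition critical_b (k : nat) : R := ln ((INR k + 1) / (INR k - 1)) / 2.

Lemma tanh_lt (x y : R) : 0 < x < y -> tanh x < tanh y.
Proof.
move=> xy.
have D z : x <= z <= y -> derivable_pt_lim tanh z (1 - tanh z * tanh z).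
  by move=> _; apply/is_derive_Reals; apply: tanh_derive.
have [c [E ci]] := MVT_cor2 _ _ x y (proj2 xy) D.
have c01 : 0 < tanh c < 1 by apply: tanh_in01; lra.
have : 0 < (1 - tanh c * tanh c) * (y - x) by apply: Rmult_lt_0_compat; nra.
by lra.
Qed.

Lemma tanh_critical (k : nat) : 2 <= INR k ->
  0 < critical_b k /\ tanh (critical_b k) = / INR k.
Proof.
move=> k2; rewrite /critical_b; set K := INR k in k2 *.
have q1 : 1 < (K + 1) / (K - 1).
  by apply: (Rmult_lt_reg_r (K - 1)); [lra | rewrite /Rdiv Rmult_assoc Rinv_l; lra].
split.
  by have := ln_increasing 1 _ Rlt_0_1 q1; rewrite ln_1; lra.
set x := ln _ / 2.
have ex : exp x * exp x = (K + 1) / (K - 1).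
  rewrite -exp_plus (_ : x + x = ln ((K + 1) / (K - 1))) ?exp_ln //; first by lra.
  by rewrite /x; field.
have e0 := exp_pos x.
rewrite /tanh /sinh /cosh exp_Ropp.
have -> : (exp x - / exp x) / 2 / ((exp x + / exp x) / 2) =
          (exp x * exp x - 1) / (exp x * exp x + 1) by field; nra.
by rewrite ex; field; lra.
Qed.

Lemma tanh_le_critical (k : nat) (b : R) : 2 <= INR k -> 0 < b ->
  INR k * tanh b <= 1 <-> b <= critical_b k.
Proof.
move=> k2 b0; have [c0 tc] := tanh_critical k2.
have ktc : INR k * tanh (critical_b k) = 1 by rewrite tc; field; lra.
split=> H.
  case: (Rle_lt_dec b (critical_b k)) => // lt.
  have := tanh_lt (conj c0 lt); nra.
case: (Rle_lt_or_eq_dec _ _ H) => [lt|->]; last lra.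
have := tanh_lt (conj b0 lt); nra.
Qed.

(** Spontaneous magnetization appears exactly where the zero-field root leaves
    [0]. *)
Lemma beta_cE (k : nat) : 2 <= INR k -> beta_c k.+1 = critical_b k.
Proof.
move=> k2; have k1 : 1 <= INR k by lra.
have [c0 tc] := tanh_critical k2.
rewrite /beta_c.
rewrite (is_glb_Rbar_unique _ (Finite (critical_b k))) //.
split=> [b [b0 [m [lim m0]]]|l lb].
  rewrite /=; case: (Rle_lt_dec (critical_b k) b) => // /Rlt_le lt.
  have T01 := tanh_in01 b0.
  have sp := spontaneous_high T01 k1 (proj2 (tanh_le_critical k2 b0) lt).
  have L := magnetization_right0 k1 b0 sp.
  have e : m = equil_magnetization (tanh b) 0.
    exact: (filterlim_locally_unique (F := at_right 0) _ _ _ lim L).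
  by move: m0; rewrite e /equil_magnetization /Rdiv Rmult_0_r Rmult_0_l; lra.
have inE b : critical_b k < b -> Rbar_le l b.
  move=> lt; apply: lb; have b0 : 0 < b by lra.
  have T01 := tanh_in01 b0.
  have kT : 1 < INR k * tanh b.
    by case: (Rlt_le_dec 1 (INR k * tanh b)) => // /(tanh_le_critical k2 b0); lra.
  have [sp s0] := spontaneous_low T01 k1 kT.
  split=> //; exists (equil_magnetization (tanh b) (root_of k (tanh b) 0)).
  split; first exact: magnetization_right0.
  by apply: Rdiv_lt_0_compat; nra.
case: l lb inE => [l| |] _ inE //=.
  case: (Rle_lt_dec l (critical_b k)) => // lt.
  have lt2 : critical_b k < (critical_b k + l) / 2 by lra.
  by have := inE _ lt2; rewrite /=; lra.
by have := inE (critical_b k + 1) ltac:(lra).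
Qed.

(** Replaces the denominator in [field_of_derive] by its value at [0], so that the
    derivative can be integrated term by term. *)
Lemma weight_bounds (T A C x : R) : 0 < T < 1 -> 0 <= A -> 0 <= C -> 0 <= x <= T / 2 ->
  let N := - A + C * (x * x) in
  N / (T * T) - A * (4 / T ^ 4) * x ^ 2 <= N / ((T * T - x * x) * (1 - x * x)) <=
  N / (T * T) + C * (4 / T ^ 4) * x ^ 4.
Proof.
move=> T01 A0 C0 xT N.
have xx : x * x <= T * T / 4 by nra.
have TT : 0 < T * T < 1 by nra.
have x20 : 0 <= x * x by nra.
set w := (T * T - x * x) * (1 - x * x).
have w1 : w <= T * T by rewrite /w; nra.
have w2 : T * T / 2 <= w by rewrite /w; nra.
have w3 : T * T - w <= 2 * (x * x) by rewrite /w; nra.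
have w0 : 0 < w by lra.
pose G := / w - / (T * T).
have G0 : 0 <= G.
  by have := Rinv_le_contravar _ _ w0 w1; rewrite /G; lra.
have G1 : G <= 4 / T ^ 4 * (x * x).
  have -> : G = (T * T - w) / (w * (T * T)) by rewrite /G; field; lra.
  have -> : 4 / T ^ 4 * (x * x) = 2 * (x * x) / (T * T / 2 * (T * T)) by field; lra.
  rewrite /Rdiv; apply: Rmult_le_compat => //; first by lra.
    by apply: Rlt_le; apply: Rinv_0_lt_compat; apply: Rmult_lt_0_compat; lra.
  apply: Rinv_le_contravar; first by apply: Rmult_lt_0_compat; lra.
  by apply: Rmult_le_compat_r; lra.
have -> : N / w = N / (T * T) + N * G by rewrite /G /Rdiv; ring.
have C1 : 0 <= C * (x * x) by apply: Rmult_le_pos.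
have H1 : C * (x * x) * G <= C * (4 / T ^ 4) * x ^ 4.
  have -> : C * (4 / T ^ 4) * x ^ 4 = C * (x * x) * (4 / T ^ 4 * (x * x)) by ring.
  exact: Rmult_le_compat_l.
have H2 : A * G <= A * (4 / T ^ 4) * x ^ 2.
  have -> : A * (4 / T ^ 4) * x ^ 2 = A * (4 / T ^ 4 * (x * x)) by ring.
  exact: Rmult_le_compat_l.
have H3 : 0 <= A * G by apply: Rmult_le_pos.
have H4 : 0 <= C * (x * x) * G by apply: Rmult_le_pos.
have -> : N * G = - (A * G) + C * (x * x) * G by rewrite /N; ring.
by lra.
Qed.

(** The Landau expansion of the equation of state, with explicit remainders: a
    linear term that changes sign at criticality and a positive cubic term. *)
Lemma field_of_bounds (k : nat) (T s : R) : 0 < T < 1 -> 1 <= INR k ->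
  1 <= INR k * T -> 0 <= s <= T / 2 ->
  let A := T * (INR k * T - 1) in let C := INR k - T in
  (- A * s + C * s ^ 3 / 3) / (T * T) - A * (4 / T ^ 4) * (s ^ 3 / 3) <= field_of k T s <=
  (- A * s + C * s ^ 3 / 3) / (T * T) + C * (4 / T ^ 4) * (s ^ 5 / 5).
Proof.
move=> T01 k1 kT sT A C.
have A0 : 0 <= A by rewrite /A; nra.
have C0 : 0 <= C by rewrite /C; lra.
have TT : 0 < T * T by nra.
have f0 : field_of k T 0 = 0 by apply: field_of0; lra.
have df x : 0 <= x <= s -> is_derive (field_of k T) x
    ((- A + C * (x * x)) / ((T * T - x * x) * (1 - x * x))).
  move=> xs; have -> : - A + C * (x * x) = stiffness (INR k) T x.
    by rewrite /A /C /stiffness; ring.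
  by apply: field_of_derive; lra.
split.
  pose g x := (- A * x + C * x ^ 3 / 3) / (T * T) - A * (4 / T ^ 4) * (x ^ 3 / 3).
  have -> : (- A * s + C * s ^ 3 / 3) / (T * T) - A * (4 / T ^ 4) * (s ^ 3 / 3) = g s - g 0.
    by rewrite /g; field; lra.
  have -> : field_of k T s = field_of k T s - field_of k T 0 by rewrite f0; ring.
  apply: (deriv_compare (f := g) (g := field_of k T) (f' := fun x => (- A + C * (x * x)) / (T * T) - A * (4 / T ^ 4) * x ^ 2)
    (proj1 sT) _ df).
    by move=> x _; rewrite /g; auto_derive => //; field; lra.
  move=> x xs; have xT : 0 <= x <= T / 2 by lra.
  by have [] := weight_bounds T01 A0 C0 xT.
pose g x := (- A * x + C * x ^ 3 / 3) / (T * T) + C * (4 / T ^ 4) * (x ^ 5 / 5).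
have -> : (- A * s + C * s ^ 3 / 3) / (T * T) + C * (4 / T ^ 4) * (s ^ 5 / 5) = g s - g 0.
  by rewrite /g; field; lra.
have -> : field_of k T s = field_of k T s - field_of k T 0 by rewrite f0; ring.
apply: (deriv_compare (f := field_of k T) (g := g) (g' := fun x => (- A + C * (x * x)) / (T * T) + C * (4 / T ^ 4) * x ^ 4)
    (proj1 sT) df).
  by move=> x _; rewrite /g; auto_derive => //; field; lra.
move=> x xs; have xT : 0 <= x <= T / 2 by lra.
by have [] := weight_bounds T01 A0 C0 xT.
Qed.

(** At the nonzero root the linear and the cubic term of [field_of_bounds] balance,
    which makes [C * s^2] about [3 * A] and the stiffness [C * s^2 - A] about
    [2 * A]. *)
Lemma low_root_bounds (k : nat) (T : R) : 0 < T < 1 -> 1 <= INR k ->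
  1 < INR k * T -> let s := root_of k T 0 in s <= T / 2 ->
  let A := T * (INR k * T - 1) in let C := INR k - T in
  [/\ A <= C * (s * s), C * (s * s) <= 4 * A & C * (s * s) / 3 <= stiffness (INR k) T s].
Proof.
move=> T01 k1 kT s sT A C.
have [[_ f0 _] s0] := spontaneous_low T01 k1 kT; rewrite -/s in f0 s0.
have sT' : 0 <= s <= T / 2 by lra.
have [lo up] := field_of_bounds T01 k1 (Rlt_le _ _ kT) sT'.
rewrite f0 -/A -/C in lo up.
have A0 : 0 < A by rewrite /A; nra.
have C0 : 0 < C by rewrite /C; lra.
have TT : 0 < T * T by nra.
have ss : s * s / (T * T) <= 1 / 4.
  by apply: (Rmult_le_reg_r (T * T)) => //; rewrite /Rdiv Rmult_assoc Rinv_l; nra.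
set z := s * s / (T * T) in ss.
have z0 : 0 <= z by apply: Rdiv_le_0_compat; nra.
have Ts : 0 < T * T / s by apply: Rdiv_lt_0_compat.
have {}up : 0 <= - A + C * (s * s) * (1 / 3 + 4 / 5 * z).
  have := Rmult_le_compat_l _ _ _ (Rlt_le _ _ Ts) up; rewrite Rmult_0_r.
  have -> // : T * T / s * ((- A * s + C * s ^ 3 / 3) / (T * T) + C * (4 / T ^ 4) * (s ^ 5 / 5)) =
    - A + C * (s * s) * (1 / 3 + 4 / 5 * z) by rewrite /z; field; lra.
have {}lo : - A + C * (s * s) / 3 - A * (4 / 3 * z) <= 0.
  have := Rmult_le_compat_l _ _ _ (Rlt_le _ _ Ts) lo; rewrite Rmult_0_r.
  have -> // : T * T / s * ((- A * s + C * s ^ 3 / 3) / (T * T) - A * (4 / T ^ 4) * (s ^ 3 / 3)) =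
    - A + C * (s * s) / 3 - A * (4 / 3 * z) by rewrite /z; field; lra.
have Cs : 0 < C * (s * s) by apply: Rmult_lt_0_compat; nra.
have -> : stiffness (INR k) T s = C * (s * s) - A by rewrite /stiffness /A /C; ring.
have P1 : C * (s * s) * z <= C * (s * s) * (1 / 4) by apply: Rmult_le_compat_l; lra.
have P2 : A * z <= A * (1 / 4) by apply: Rmult_le_compat_l; lra.
by split; lra.
Qed.

Lemma low_root_small (k : nat) (r : R) : 2 <= INR k -> 0 < r < / INR k ->
  exists2 del, 0 < del & forall T, / INR k < T < / INR k + del -> T < 1 -> root_of k T 0 < r.
Proof.
move=> k2 rk; have k1 : 1 <= INR k by lra.
have i1 : / INR k < 1 by rewrite -Rinv_1; apply: Rinv_lt_contravar; lra.
have T01 : 0 < / INR k < 1 by lra.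
have kT : INR k * / INR k <= 1 by rewrite Rinv_r; lra.
have [_ _ up] := spontaneous_high T01 k1 kT.
have f0 := up r rk.
have cT : continuous (fun T => field_of k T r) (/ INR k).
  apply: ex_derive_continuous; rewrite /field_of.
  have p1 : 0 < (/ INR k + r) / (/ INR k - r) by apply: Rdiv_lt_0_compat; lra.
  by rewrite /Rdiv /Rminus in p1; auto_derive; repeat split; lra.
have [del Hd] := cT _ (open_gt 0 _ f0).
exists del; first exact: cond_pos.
move=> T TI T1.
have fT : 0 < field_of k T r.
  apply: Hd; rewrite /ball /= /AbsRing_ball /= /abs /minus /plus /opp /=.
  by apply: Rabs_def1; lra.
have T01' : 0 < T < 1 by lra.
have kT' : 1 < INR k * T.
  by have := Rmult_lt_compat_l (INR k) _ _ ltac:(lra) (proj1 TI); rewrite Rinv_r; lra.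
have [[sT fs _] s0] := spontaneous_low T01' k1 kT'.
case: (Rlt_le_dec (root_of k T 0) r) => // rs.
case: (Req_dec r (root_of k T 0)) => [e|ne]; first by rewrite e in fT; lra.
have lt : 0 < r < root_of k T 0 by lra.
by have := field_of_mono T1 k1 lt (proj2 sT); lra.
Qed.

(** * Critical exponents *)

Lemma at_right_intro (x del : R) (P : R -> Prop) : 0 < del ->
  (forall b, x < b < x + del -> P b) -> at_right x P.
Proof.
move=> d0 H; exists (mkposreal _ d0) => b.
rewrite /ball /= /AbsRing_ball /= /abs /minus /plus /opp /= => bd xb; apply: H.
by move: bd; rewrite Rabs_pos_eq; lra.
Qed.

Lemma at_left_intro (x del : R) (P : R -> Prop) : 0 < del ->
  (forall b, x - del < b < x -> P b) -> at_left x P.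
Proof.
move=> d0 H; exists (mkposreal _ d0) => b.
rewrite /ball /= /AbsRing_ball /= /abs /minus /plus /opp /= => bd xb; apply: H.
by move: bd; rewrite Rabs_left; lra.
Qed.

Lemma tanh_bounds (x y : R) : 0 < x < y ->
  (1 - tanh y * tanh y) * (y - x) <= tanh y - tanh x <= y - x.
Proof.
move=> xy.
have D z : x <= z <= y -> derivable_pt_lim tanh z (1 - tanh z * tanh z).
  by move=> _; apply/is_derive_Reals; apply: tanh_derive.
have [c [E ci]] := MVT_cor2 _ _ x y (proj2 xy) D.
have c0 : 0 < c by lra.
have c01 := tanh_in01 c0.
have cy : tanh c < tanh y by apply: tanh_lt; lra.
rewrite E; split; first by apply: Rmult_le_compat_r; nra.
have := Rmult_le_compat_r (y - x) (1 - tanh c * tanh c) 1 ltac:(lra); nra.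
Qed.

Lemma asymp_intro (F : (R -> Prop) -> Prop) (FF : Filter F) (f g : R -> R) (c C : R) :
  0 < c -> 0 < C -> F (fun x => 0 < g x /\ c * g x <= f x <= C * g x) -> asymp F f g.
Proof.
move=> c0 C0 H; exists c, C; split=> //; split=> //.
apply: filter_imp H => x [g0 [lo up]].
by split; apply: (Rmult_le_reg_r (g x)) => //; rewrite /Rdiv Rmult_assoc Rinv_l; lra.
Qed.

(** The bound [T ^ 4 / 16] on the squared root, stronger than [s <= T / 2], keeps the
    first term of [equil_heat] positive. *)
Lemma low_temperature (k : nat) : 2 <= INR k ->
  exists c del, [/\ 0 < c, 0 < del & forall b, critical_b k < b < critical_b k + del ->
    let T := tanh b in let s := root_of k T 0 in let x := b - critical_b k in
    [/\ / INR k < T < 1, spontaneous k T s, 0 < s <= T / 2, s * s <= T ^ 4 / 16 &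
    [/\ c * x <= (INR k - T) * (s * s), (INR k - T) * (s * s) <= 4 * INR k * x,
        (INR k - T) * (s * s) / 3 <= stiffness (INR k) T s &
        stiffness (INR k) T s <= (INR k - T) * (s * s)]]].
Proof.
move=> k2; have k1 : 1 <= INR k by lra.
have [b0 tc] := tanh_critical k2.
have i0 : 0 < / INR k by apply: Rinv_0_lt_compat; lra.
have i2 : / INR k <= / 2 by apply: Rinv_le_contravar; lra.
have rk : 0 < / INR k * / INR k / 4 < / INR k by split; nra.
have [del0 d0 small] := low_root_small k2 rk.
have T1 : 0 < tanh (critical_b k + 1) < 1 by apply: tanh_in01; lra.
exists (1 - tanh (critical_b k + 1) * tanh (critical_b k + 1)), (Rmin del0 1).
split; [by nra | by apply: Rmin_glb_lt; lra |].
move=> b bI T s x.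
have m1 := Rmin_l del0 1; have m2 := Rmin_r del0 1.
have bb : 0 < b by lra.
have T01 : 0 < T < 1 by apply: tanh_in01.
have lt : / INR k < T by rewrite -tc; apply: tanh_lt; lra.
have [lo up] := tanh_bounds (conj b0 (proj1 bI)).
rewrite tc -/T -/x in lo up.
have kT : 1 < INR k * T.
  by have := Rmult_lt_compat_l (INR k) _ _ ltac:(lra) lt; rewrite Rinv_r; lra.
have [sp s0] := spontaneous_low T01 k1 kT; rewrite -/s in sp s0.
have sr : s < / INR k * / INR k / 4.
  by apply: small; [rewrite /x in up; lra | lra].
have sT : s <= T / 2 by nra.
have [e1 e2 e3] := low_root_bounds T01 k1 kT sT; rewrite -/s in e1 e2 e3.
have AE : T * (INR k * T - 1) = INR k * T * (T - / INR k).
  by field; lra.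
have A1 : T - / INR k <= T * (INR k * T - 1) by rewrite AE; nra.
have A2 : T * (INR k * T - 1) <= INR k * (T - / INR k) by rewrite AE; nra.
have Tt : tanh b < tanh (critical_b k + 1) by apply: tanh_lt; lra.
have lo2 : (1 - tanh (critical_b k + 1) * tanh (critical_b k + 1)) * x <= T - / INR k.
  apply: Rle_trans lo; apply: Rmult_le_compat_r; first by rewrite /x; lra.
  by rewrite -/T in Tt; nra.
have up2 : INR k * (T - / INR k) <= INR k * x by apply: Rmult_le_compat_l; lra.
split=> //; first by split; lra.
  have TT : / INR k * / INR k <= T * T by nra.
  have -> : T ^ 4 / 16 = (T * T / 4) * (T * T / 4) by field.
  by apply: Rmult_le_compat; lra.
split; try lra.
have -> : stiffness (INR k) T s = (INR k - T) * (s * s) - T * (INR k * T - 1).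
  by rewrite /stiffness; ring.
by lra.
Qed.

Lemma equil_magnetization_bounds (K T s : R) : 0 < T < 1 -> 1 <= K * T -> 0 < s <= T / 2 ->
  s / 2 <= equil_magnetization T s <= 2 * K * s.
Proof.
move=> T01 kT sI.
have ss : 0 < s * s <= 1 by nra.
have q0 : 0 < T + s * s by lra.
have K0 : 0 < K by nra.
rewrite /equil_magnetization.
split; apply: (Rmult_le_reg_r (T + s * s)) => //.
  by rewrite {2}/Rdiv (Rmult_assoc ((1 + T) * s)) Rinv_l; nra.
rewrite /Rdiv (Rmult_assoc ((1 + T) * s)) Rinv_l; last lra.
have p1 : (1 + T) * s <= 2 * s by nra.
have p2 : 2 * s <= 2 * s * (K * T) by nra.
have p3 : 0 <= 2 * K * s * (s * s) by apply: Rmult_le_pos; nra.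
by nra.
Qed.

Lemma magnetization_exponent (k : nat) : 2 <= INR k ->
  asymp_right0 (at_right (critical_b k)) (magnetization k.+1)
    (fun b => Rpower (b - critical_b k) (1 / 2)).
Proof.
move=> k2; have k1 : 1 <= INR k by lra.
have [b0 tc] := tanh_critical k2.
have [c [del [c0 d0 low]]] := low_temperature k2.
exists (fun b => equil_magnetization (tanh b) (root_of k (tanh b) 0)); split.
  apply: (at_right_intro d0) => b bI; have [_ sp _ _ _] := low b bI.
  by apply: magnetization_right0 => //; lra.
have ck : 0 < c / INR k by apply: Rdiv_lt_0_compat; lra.
apply: (@asymp_intro _ _ _ _ (sqrt (c / INR k) / 2) (2 * INR k * sqrt (4 * INR k))).
- by have := sqrt_lt_R0 _ ck; lra.
- have : 0 < sqrt (4 * INR k) by apply: sqrt_lt_R0; lra.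
  by nra.
apply: (at_right_intro d0) => b bI; have := low b bI; cbv zeta.
set T := tanh b; set s := root_of k T 0; set x := b - critical_b k.
move=> [T01 _ sI _ [e1 e2 _ _]].
have x0 : 0 < x by rewrite /x; lra.
rewrite (_ : 1 / 2 = / 2) ?Rpower_sqrt //; last by field.
have sx := sqrt_lt_R0 _ x0.
have i0 : 0 < / INR k by apply: Rinv_0_lt_compat; lra.
have ss : 0 < s * s by nra.
have l1 : sqrt (c / INR k) * sqrt x <= s.
  rewrite -sqrt_mult; try lra.
  rewrite -[X in _ <= X]sqrt_square; last lra.
  apply: sqrt_le_1_alt; apply: (Rmult_le_reg_l (INR k)); first lra.
  have -> : INR k * (c / INR k * x) = c * x by field; lra.
  by nra.
have l2 : s <= sqrt (4 * INR k) * sqrt x.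
  rewrite -sqrt_mult; try lra.
  rewrite -[X in X <= _]sqrt_square; last lra.
  by apply: sqrt_le_1_alt; nra.
have kT : 1 <= INR k * T.
  by have := Rmult_le_compat_l (INR k) _ _ ltac:(lra) (Rlt_le _ _ (proj1 T01)); rewrite Rinv_r; lra.
have T01' : 0 < T < 1 by lra.
have [m1 m2] := equil_magnetization_bounds T01' kT sI.
split=> //; split; first by nra.
apply: Rle_trans m2 _; rewrite (Rmult_assoc (2 * INR k)).
by apply: Rmult_le_compat_l; lra.
Qed.

(** At criticality the linear term of [field_of_bounds] vanishes and the field is of
    the order of the cube of the root. *)
Lemma critical_isotherm (k : nat) : 2 <= INR k ->
  asymp (at_right 0) (magnetization k.+1 (critical_b k)) (fun B => Rpower B (/ 3)).
Proof.
move=> k2; have k1 : 1 <= INR k by lra.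
have [b0 tc] := tanh_critical k2.
set T := tanh (critical_b k) in tc *.
have T01 : 0 < T < 1 by apply: tanh_in01.
have kT : INR k * T = 1 by rewrite tc; field; lra.
have sp := spontaneous_high T01 k1 (Req_le _ _ kT).
pose C := INR k - T.
have C0 : 0 < C by rewrite /C; lra.
have TT : 0 < T * T by nra.
pose c1 := C / (3 * (T * T)); pose c2 := 2 * C / (T * T).
have c10 : 0 < c1 by apply: Rdiv_lt_0_compat; lra.
have c20 : 0 < c2 by apply: Rdiv_lt_0_compat; lra.
have pc1 : 0 < Rpower c1 (/ 3) by apply: exp_pos.
have pc2 : 0 < Rpower c2 (/ 3) by apply: exp_pos.
have near : at_right 0 (fun B => 0 < B /\ root_of k T B <= T / 2).
  have L := root_of_right_lim T01 k1 sp.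
  have T2 : 0 < T / 2 by lra.
  pose proof (proj1 (@filterlim_R _ (at_right 0) _ _ _) L _ T2) as H.
  have H0 : at_right 0 (fun B => 0 < B) by exists (mkposreal _ Rlt_0_1).
  pose proof (filter_and _ _ H0 H) as HH; move: HH; apply: (@filter_imp _ (at_right 0) _) => B [B0 HB]; split=> //.
  by have := Rle_abs (root_of k T B - 0); lra.
apply: (@asymp_intro _ _ _ _ (/ (2 * Rpower c2 (/ 3))) (2 * INR k / Rpower c1 (/ 3))).
- by apply: Rinv_0_lt_compat; lra.
- by apply: Rdiv_lt_0_compat; lra.
move: near; apply: (@filter_imp _ (at_right 0) _) => B [B0 sT].
have [_ m _ _] := positive_field k1 b0 B0; rewrite m -/T.
have [sI fs] := root_of_solve T01 k1 B0.
move: (root_of k T B) sT sI fs => s sT sI fs {m}.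
have sT' : 0 <= s <= T / 2 by lra.
have [lo up] := field_of_bounds T01 k1 (Req_le _ _ (esym kT)) sT'.
rewrite fs kT Rminus_diag Rmult_0_r -/C in lo up.
have s3 : 0 < s ^ 3 by apply: pow_lt; lra.
have lo' : c1 * s ^ 3 <= B.
  apply: Rle_trans lo; apply: Req_le; rewrite /c1; field; lra.
have up' : B <= c2 * s ^ 3.
  apply: Rle_trans up _.
  have -> : (- 0 * s + C * s ^ 3 / 3) / (T * T) + C * (4 / T ^ 4) * (s ^ 5 / 5) =
    C * s ^ 3 / (T * T) * (1 / 3 + 4 / 5 * (s * s / (T * T))) by field; lra.
  have ss : s * s / (T * T) <= 1.
    by apply: (Rmult_le_reg_r (T * T)) => //; rewrite /Rdiv Rmult_assoc Rinv_l; nra.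
  have -> : c2 * s ^ 3 = C * s ^ 3 / (T * T) * 2 by rewrite /c2; field; lra.
  apply: Rmult_le_compat_l; last lra.
  by apply: Rlt_le; apply: Rdiv_lt_0_compat => //; apply: Rmult_lt_0_compat.
have root3 c : 0 < c -> Rpower (c * s ^ 3) (/ 3) = Rpower c (/ 3) * s.
  move=> cp; rewrite -Rpower_mult_distr //; congr (_ * _).
  rewrite -Rpower_pow; last lra.
  rewrite Rpower_mult (_ : INR 3 * / 3 = 1) ?Rpower_1 //; first lra.
  by rewrite /=; field.
have u1 : Rpower c1 (/ 3) * s <= Rpower B (/ 3).
  rewrite -root3 //; apply: Rle_Rpower_l; first lra.
  by split=> //; apply: Rmult_lt_0_compat.
have u2 : Rpower B (/ 3) <= Rpower c2 (/ 3) * s.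
  by rewrite -root3 //; apply: Rle_Rpower_l; lra.
have [m1 m2] := equil_magnetization_bounds T01 (Req_le _ _ (esym kT)) (conj (proj1 sI) sT).
split; first exact: exp_pos.
split.
  apply: Rle_trans m1; apply: (Rmult_le_reg_l (2 * Rpower c2 (/ 3))); first lra.
  by rewrite -Rmult_assoc Rinv_r; lra.
apply: Rle_trans m2 _.
have -> : 2 * INR k / Rpower c1 (/ 3) * Rpower B (/ 3) =
  2 * INR k * (Rpower B (/ 3) / Rpower c1 (/ 3)) by rewrite /Rdiv; ring.
apply: Rmult_le_compat_l; first lra.
apply: (Rmult_le_reg_l (Rpower c1 (/ 3))) => //.
have -> // : Rpower c1 (/ 3) * (Rpower B (/ 3) / Rpower c1 (/ 3)) = Rpower B (/ 3) by field; lra.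
Qed.

Lemma high_temperature (k : nat) (b : R) : 2 <= INR k -> 0 < b < critical_b k ->
  [/\ 0 < tanh b < / INR k, spontaneous k (tanh b) 0,
      (1 - / INR k * / INR k) * (critical_b k - b) <= / INR k - tanh b <= critical_b k - b &
      0 < stiffness (INR k) (tanh b) 0].
Proof.
move=> k2 bI; have [b0 tc] := tanh_critical k2.
have T01 := tanh_in01 (proj1 bI).
have lt : tanh b < / INR k by rewrite -tc; apply: tanh_lt.
have := tanh_bounds bI; rewrite tc => bd.
have kT : INR k * tanh b < 1.
  by have := Rmult_lt_compat_l (INR k) _ _ ltac:(lra) lt; rewrite Rinv_r; lra.
split=> //; first by split; lra.
  by apply: spontaneous_high; lra.
by rewrite /stiffness !Rmult_0_r Rplus_0_r; apply: Rmult_lt_0_compat; lra.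
Qed.

Lemma susceptibility_high_exponent (k : nat) : 2 <= INR k ->
  asymp_right0 (at_left (critical_b k)) (susceptibility k.+1)
    (fun b => Rpower (critical_b k - b) (- 1)).
Proof.
move=> k2; have k1 : 1 <= INR k by lra.
have [b0 tc] := tanh_critical k2.
exists (fun b => equil_susceptibility (INR k) (tanh b) 0); split.
  apply: (at_left_intro b0) => b bI; have bI' : 0 < b < critical_b k by lra.
  have [_ sp _ D0] := high_temperature k2 bI'.
  by apply: susceptibility_right0 => //; lra.
have i0 : 0 < / INR k by apply: Rinv_0_lt_compat; lra.
have i1 : / INR k <= / 2 by apply: Rinv_le_contravar; lra.
have q0 : 0 < 1 - / INR k * / INR k by nra.
apply: (@asymp_intro _ _ _ _ (/ INR k) (2 / (1 - / INR k * / INR k))) => //.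
  by apply: Rdiv_lt_0_compat; lra.
apply: (at_left_intro b0) => b bI; have bI' : 0 < b < critical_b k by lra.
have [T01 _ bd D0] := high_temperature k2 bI'.
set x := critical_b k - b in bd *; have x0 : 0 < x by rewrite /x; lra.
set T := tanh b in T01 bd D0 *.
rewrite Rpower_Ropp Rpower_1 //.
have t0 : 0 < / INR k - T by lra.
have -> : equil_susceptibility (INR k) T 0 = (1 + T) * / INR k * / (/ INR k - T).
  rewrite /equil_susceptibility /stiffness in D0 *.
  have e : 1 - INR k * T = INR k * (/ INR k - T) by field; lra.
  rewrite e; field; repeat split; try lra.
  by move=> z; rewrite -/(Rminus _ _) in z; nra.
have ix : 0 < / x by apply: Rinv_0_lt_compat.
have it : / x <= / (/ INR k - T) by apply: Rinv_le_contravar; lra.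
have it2 : / (/ INR k - T) <= / (1 - / INR k * / INR k) * / x.
  by rewrite -Rinv_mult; apply: Rinv_le_contravar; nra.
split=> //; split.
  have p : 0 <= (1 + T) * / INR k - / INR k by nra.
  by nra.
have p : (1 + T) * / INR k <= 2 by nra.
have -> : 2 / (1 - / INR k * / INR k) * / x = 2 * (/ (1 - / INR k * / INR k) * / x).
  by rewrite /Rdiv; ring.
have hp : 0 <= (1 + T) * / INR k by nra.
by apply: Rmult_le_compat; lra.
Qed.

Lemma susceptibility_low_exponent (k : nat) : 2 <= INR k ->
  asymp_right0 (at_right (critical_b k)) (susceptibility k.+1)
    (fun b => Rpower (b - critical_b k) (- 1)).
Proof.
move=> k2; have k1 : 1 <= INR k by lra.
have [b0 tc] := tanh_critical k2.
have [c [del [c0 d0 low]]] := low_temperature k2.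
have i0 : 0 < / INR k by apply: Rinv_0_lt_compat; lra.
have pos T s c' : 0 < c' -> c' <= (INR k - T) * (s * s) ->
   (INR k - T) * (s * s) / 3 <= stiffness (INR k) T s -> 0 < stiffness (INR k) T s by lra.
exists (fun b => equil_susceptibility (INR k) (tanh b) (root_of k (tanh b) 0)); split.
  apply: (at_right_intro d0) => b bI; have [_ sp _ _ [e1 _ e3 _]] := low b bI.
  apply: susceptibility_right0 => //; first lra.
  by apply: (pos _ _ (c * (b - critical_b k))) => //; apply: Rmult_lt_0_compat; lra.
apply: (@asymp_intro _ _ _ _ (/ INR k / 64 / INR k) (6 / c)).
- by apply: Rdiv_lt_0_compat; lra.
- by apply: Rdiv_lt_0_compat; lra.
apply: (at_right_intro d0) => b bI; have := low b bI; cbv zeta.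
set T := tanh b; set s := root_of k T 0; set x := b - critical_b k.
move=> [T01 _ sI s4 [e1 e2 e3 e4]].
have x0 : 0 < x by rewrite /x; lra.
have cx : 0 < c * x by apply: Rmult_lt_0_compat.
have D0 := pos _ _ _ cx e1 e3.
rewrite Rpower_Ropp Rpower_1 //.
have ss : 0 <= s * s <= T * T / 4 by nra.
have TT : 0 < T * T <= T by nra.
pose num := (1 + T) * (1 - s * s) * (T * T - s * s) * (T - s * s).
have n1 : T * T * T / 4 <= num.
  have a1 : 3 / 4 <= (1 + T) * (1 - s * s) by nra.
  have a2 : 3 / 4 * (T * T) <= T * T - s * s by lra.
  have a3 : 3 / 4 * T <= T - s * s by lra.
  have a12 : 3 / 4 * (3 / 4 * (T * T)) <= (1 + T) * (1 - s * s) * (T * T - s * s).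
    by apply: Rmult_le_compat; lra.
  have t3 : 0 < T * T * T by apply: Rmult_lt_0_compat; lra.
  have : 3 / 4 * (3 / 4 * (T * T)) * (3 / 4 * T) <= num.
    by apply: Rmult_le_compat; lra || nra.
  by lra.
have n2 : num <= 2 * (T * T * T).
  have a1 : (1 + T) * (1 - s * s) <= 2 by nra.
  have a12 : (1 + T) * (1 - s * s) * (T * T - s * s) <= 2 * (T * T).
    by apply: Rmult_le_compat; nra.
  have : num <= 2 * (T * T) * T by apply: Rmult_le_compat; nra.
  by lra.
pose den := (T + s * s) * (T + s * s).
have d1 : T * T <= den by apply: Rmult_le_compat; lra.
have d2 : den <= 4 * (T * T).
  have : den <= (2 * T) * (2 * T) by apply: Rmult_le_compat; lra.
  by lra.
have r1 : T / 16 <= num / den.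
  apply: (Rmult_le_reg_r den); first lra.
  by rewrite {2}/Rdiv Rmult_assoc Rinv_l; nra.
have r2 : num / den <= 2 * T.
  apply: (Rmult_le_reg_r den); first lra.
  by rewrite {1}/Rdiv Rmult_assoc Rinv_l; nra.
have E : equil_susceptibility (INR k) T s = num / den * / stiffness (INR k) T s.
  rewrite /equil_susceptibility -/num -/den /Rdiv Rinv_mult; ring.
rewrite E; move: (stiffness _ _ _) D0 e3 e4 {E} => D D0 e3 e4.
have D1 : D <= 4 * INR k * x by lra.
have D2 : c * x / 3 <= D by lra.
have iD1 : / (4 * INR k * x) <= / D by apply: Rinv_le_contravar.
have iD2 : / D <= / (c * x / 3) by apply: Rinv_le_contravar; lra.
have k4 : 0 < 4 * INR k * x by apply: Rmult_lt_0_compat; lra.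
have ik4 : 0 < / (4 * INR k * x) by apply: Rinv_0_lt_compat.
split; first exact: Rinv_0_lt_compat.
split.
  have -> : / INR k / 64 / INR k * / x = / INR k / 16 * / (4 * INR k * x) by field; lra.
  by apply: Rmult_le_compat; lra.
have -> : 6 / c * / x = 2 * / (c * x / 3) by field; lra.
have r0 : 0 <= num / den by lra.
by apply: Rmult_le_compat; lra.
Qed.

(** At the root [0] the singular term of [equil_heat] is absent. *)
Lemma heat_high_exponent (k : nat) : 2 <= INR k ->
  asymp_right0 (at_left (critical_b k)) (specific_heat k.+1)
    (fun b => Rpower (critical_b k - b) (- 0)).
Proof.
move=> k2; have k1 : 1 <= INR k by lra.
have [b0 tc] := tanh_critical k2.
exists (fun b => equil_heat (INR k) (tanh b) 0); split.
  apply: (at_left_intro b0) => b bI; have bI' : 0 < b < critical_b k by lra.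
  have [_ sp _ D0] := high_temperature k2 bI'.
  by apply: specific_heat_right0 => //; lra.
have i0 : 0 < / INR k by apply: Rinv_0_lt_compat; lra.
have i1 : / INR k <= / 2 by apply: Rinv_le_contravar; lra.
apply: (@asymp_intro _ _ _ _ ((INR k + 1) / 4) ((INR k + 1) / 2)); try lra.
apply: (at_left_intro b0) => b bI; have bI' : 0 < b < critical_b k by lra.
have [T01 _ _ D0] := high_temperature k2 bI'.
have x0 : 0 < critical_b k - b by lra.
rewrite Ropp_0 Rpower_O //.
move: (tanh b) T01 D0 => T T01 D0.
have -> : equil_heat (INR k) T 0 = (INR k + 1) / 2 * (1 - T * T).
  by rewrite /equil_heat; field; lra.
have TT : 0 <= T * T <= 1 / 4 by nra.
by split; [lra | nra].
Qed.

(** The vanishing stiffness in the second term of [equil_heat] is compensated by the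
    squared root in its numerator. *)
Lemma heat_low_exponent (k : nat) : 2 <= INR k ->
  asymp_right0 (at_right (critical_b k)) (specific_heat k.+1)
    (fun b => Rpower (b - critical_b k) (- 0)).
Proof.
move=> k2; have k1 : 1 <= INR k by lra.
have [b0 tc] := tanh_critical k2.
have [c [del [c0 d0 low]]] := low_temperature k2.
have T1 : 0 < tanh (critical_b k + 1) < 1 by apply: tanh_in01; lra.
set T1' := tanh (critical_b k + 1) in T1.
have i0 : 0 < / INR k by apply: Rinv_0_lt_compat; lra.
have stiff0 b : critical_b k < b < critical_b k + del ->
    0 < stiffness (INR k) (tanh b) (root_of k (tanh b) 0).
  move=> bI; have [_ _ _ _ [e1 _ e3 _]] := low b bI.
  have : 0 < c * (b - critical_b k) by apply: Rmult_lt_0_compat; lra.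
  by lra.
exists (fun b => equil_heat (INR k) (tanh b) (root_of k (tanh b) 0)); split.
  apply: (at_right_intro d0) => b bI; have [_ sp _ _ _] := low b bI.
  by apply: specific_heat_right0 => //; [lra | apply: stiff0].
apply: (@asymp_intro _ _ _ _ ((INR k + 1) / 2 * (1 - T1' * T1') / 8)
   ((INR k + 1) / 2 * (3 + 6 * (INR k * INR k)))).
- have : 0 < (INR k + 1) / 2 * (1 - T1' * T1') by apply: Rmult_lt_0_compat; nra.
  by lra.
- by apply: Rmult_lt_0_compat; nra.
have dm : 0 < Rmin del 1 by apply: Rmin_glb_lt; lra.
apply: (at_right_intro dm) => b bI0.
have m1 := Rmin_l del 1; have m2 := Rmin_r del 1.
have bI : critical_b k < b < critical_b k + del by lra.
have x0 : 0 < b - critical_b k by lra.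
rewrite Ropp_0 Rpower_O //.
have lt1 : tanh b < T1' by apply: tanh_lt; lra.
have D0 := stiff0 b bI; have [T01 _ sI s4 [e1 _ e3 _]] := low b bI.
move: (tanh b) (root_of k (tanh b) 0) lt1 D0 T01 sI s4 e1 e3 => T s lt1 D0 T01 sI s4 e1 e3.
split; first lra.
rewrite !Rmult_1_r /equil_heat.
move: (stiffness _ _ _) D0 e3 => D D0 e3.
have kT : 1 <= INR k * T.
  by have := Rmult_le_compat_l (INR k) _ _ ltac:(lra) (Rlt_le _ _ (proj1 T01)); rewrite Rinv_r; lra.
have qE : s ^ 2 = s * s by ring.
have q4 : s ^ 4 = (s * s) * (s * s) by ring.
rewrite q4 !qE.
have q0 : 0 < s * s by nra.
move: (s * s) q0 s4 e3 {e1 qE q4} => q q0 s4 e3.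
have TT : 0 < T * T < 1 by nra.
have T4E : T ^ 4 = (T * T) * (T * T) by ring.
have T4 : 0 < T ^ 4 < T * T by rewrite T4E; nra.
have qT : q <= T by nra.
have q1 : q < 1 by lra.
set E1 := _ / (T ^ 2 * _); set E2 := _ / (_ * D).
have den1 : T ^ 4 <= T ^ 2 * (T + q) ^ 2.
  have -> : T ^ 2 * (T + q) ^ 2 = (T * T) * ((T + q) * (T + q)) by ring.
  by rewrite T4E; apply: Rmult_le_compat_l; nra.
have den2 : T ^ 2 * (T + q) ^ 2 <= 4 * T ^ 4.
  have -> : T ^ 2 * (T + q) ^ 2 = (T * T) * ((T + q) * (T + q)) by ring.
  have -> : 4 * T ^ 4 = (T * T) * (4 * (T * T)) by ring.
  by apply: Rmult_le_compat_l; nra.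
have Tq : 0 < T * q <= T ^ 4 / 16 by nra.
have qq : 0 < q * q <= T ^ 4 / 16 by nra.
have T3q : 0 < T ^ 3 * q <= T ^ 4.
  have -> : T ^ 3 * q = (T * T) * (T * q) by ring.
  by nra.
have [e1lo e1up] : 1 / 8 <= E1 <= 3.
  split; apply: (Rmult_le_reg_r (T ^ 2 * (T + q) ^ 2)); try lra.
    by rewrite /E1 {2}/Rdiv Rmult_assoc Rinv_l; lra.
  by rewrite /E1 /Rdiv Rmult_assoc Rinv_l; lra.
have dd : 0 < (T + q) ^ 2 * D.
  by apply: Rmult_lt_0_compat => //; apply: pow_lt; lra.
have [e2lo e2up] : 0 <= E2 <= 6 * (INR k * INR k).
  have n0 : 0 <= 2 * (1 - T * T) * q * (1 - q).
    by apply: Rmult_le_pos; [apply: Rmult_le_pos|]; lra.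
  split; first exact: Rdiv_le_0_compat.
  apply: (Rmult_le_reg_r ((T + q) ^ 2 * D)) => //.
  rewrite /E2 /Rdiv Rmult_assoc Rinv_l; last lra.
  have a1 : 2 * (1 - T * T) * q * (1 - q) <= 2 * q.
    have := Rmult_le_compat (2 * (1 - T * T) * q) (2 * q) (1 - q) 1; nra.
  have a2 : q <= 3 * D.
    have : 1 * q <= (INR k - T) * q by apply: Rmult_le_compat_r; lra.
    by lra.
  have a3 : 1 * 1 <= (INR k * (T + q)) * (INR k * (T + q)).
    have : 0 < INR k * q by apply: Rmult_lt_0_compat; lra.
    by move=> kq; apply: Rmult_le_compat; lra.
  have a4 := Rmult_le_compat_r D _ _ (Rlt_le _ _ D0) a3.
  by lra.
have k3 : 0 < (INR k + 1) / 2 by lra.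
have g1 : 0 < 1 - T1' * T1' <= 1 - T * T by nra.
split.
  have -> : (INR k + 1) / 2 * (1 - T1' * T1') / 8 = (INR k + 1) / 2 * ((1 - T1' * T1') * (1 / 8)) by field.
  rewrite Rmult_assoc; apply: Rmult_le_compat_l; first lra.
  by apply: Rmult_le_compat; lra.
rewrite Rmult_assoc; apply: Rmult_le_compat_l; first lra.
have := Rmult_le_compat (1 - T * T) 1 (E1 + E2) (3 + 6 * (INR k * INR k)); lra.
Qed.

Theorem theorem1p2 (d : nat) (hd : (3 <= d)%N) :
  critical_exponents d (1 / 2) 3 1 1 0 0.
Proof.
case: d hd => // k hk.
have k2 : 2 <= INR k by apply: (le_INR 2); apply/leP.
rewrite /critical_exponents beta_cE //.
split; [exact: magnetization_exponent | exact: critical_isotherm | split].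
- exact: susceptibility_high_exponent.
- exact: susceptibility_low_exponent.
- exact: heat_high_exponent.
- exact: heat_low_exponent.
Qed.
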